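(* Let $E\subset\mathbb R$ be a finite union of compact intervals and points, and let $f$ be an algebraic function, single-valued and holomorphic on $\mathbb C\setminus E$. Assume $$f(\bar z)=\overline{f(z)},\qquad \operatorname{Im}f(z)<0\quad(\operatorname{Im}z>0),\qquad f(z)=\frac{a_0}{z}+O(z^{-2})\ (z\to\infty),\quad a_0>0.\qquad( * )$$ Then $f=\mathcal C_\mu$ on $\mathbb C\setminus E$ for a unique positive measure $\mu$ of mass $a_0$. The support of $\mu$ is a finite union of compact intervals and points. Hence $\mu$ is a positive mother-body measure and, if $P$ is the irreducible defining polynomial of $f$, then $\delta_P(f;K)=0$ for every compact convex $K\supset E$. Conversely, if $\mu$ is a nonzero positive measure on $E$ whose Cauchy transform $f=\mathcal C_\mu$ is algebraic, then $f$ satisfies $( * )$ (with some $a_0>0$).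
   Context: $dA$ is planar Lebesgue measure. For a finite compactly supported complex Borel measure $\mu$ on $\mathbb C$, its Cauchy transform is $\mathcal C_\mu(z)=\int_{\mathbb C}\frac{d\mu(\zeta)}{z-\zeta}$ (defined for almost every $z$, holomorphic off $\operatorname{supp}\mu$). The irreducible defining polynomial of an algebraic germ $f$ at infinity is the irreducible $P(z,w)\in\mathbb C[z,w]$, $d=\deg_wP\ge1$, with $P(z,f(z))=0$ near infinity (unique up to a nonzero constant). A positive mother-body measure for a germ $f(z)=a_0/z+O(z^{-2})$, $a_0>0$, is a positive compactly supported measure whose Cauchy transform has germ $f$ at infinity, whose support is a finite union of compact semi-analytic arcs and isolated points, and whose Cauchy transform is a branch of $P(z,w)=0$ in every component of the complement of the support. For compact convex $K$, $\mathcal M_f(K)$ is the set of positive measures supported in $K$ whose Cauchy transform has germ $f$ at infinity; $\mathfrak D_{P,K}(\mu)=\int_K|P(z,\mathcal C_\mu(z))|^{1/d}\,dA(z)$ and $\delta_P(f;K)=\min_{\mu\in\mathcal M_f(K)}\mathfrak D_{P,K}(\mu)$. *)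

(* Defs.v *)
From HB Require Import structures.
From mathcomp Require Import all_boot all_order all_algebra.
From mathcomp Require Import all_classical all_reals all_analysis.
From mathcomp Require Import complex.

Set Implicit Arguments.
Unset Strict Implicit.
Unset Printing Implicit Defensive.

Import Order.TTheory GRing.Theory Num.Theory.
Import numFieldNormedType.Exports.

Local Open Scope classical_set_scope.
Local Open Scope ring_scope.
Local Open Scope complex_scope.

(* Subsets of the complex plane and measures on it live on R * R, which carries
   the product topology, the Borel sigma-algebra and the planar Lebesgue measure;
   functions of a complex variable are functions R[i] -> R[i]. *)
Definition cplx (R : realType) (p : R * R) : R[i] := p.1 +i* p.2.

Definition realset (R : realType) (E : set R) : set (R * R) := E `*` [set 0].

Definition cabs (R : realType) (z : R[i]) : R := complex.Re `|z|.

Definition planar_lebesgue (R : realType) : set (R * R) -> \bar R :=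
  (@lebesgue_measure R \x @lebesgue_measure R)%E.

Definition near_infty (R : realType) (Q : R[i] -> Prop) : Prop :=
  exists r : R, forall z : R[i], r < cabs z -> Q z.

(* R[i]^o is a normed module over R[i]: this is complex differentiability. *)
Definition holomorphic_on (R : realType) (U : set (R * R)) (f : R[i] -> R[i]) :
  Prop := forall p, U p -> derivable (f : R[i]^o -> R[i]^o) (cplx p) 1.

Definition finite_union_itv_pts (R : realType) (E : set R) : Prop :=
  exists (I : seq (R * R)) (F : seq R),
    {in I, forall ab, ab.1 <= ab.2} /\
    E = (\bigcup_(ab in [set` I]) [set` `[ab.1, ab.2]]) `|` [set` F].

(* C[z, w] is represented as C[z][w]: the outer variable is w. *)
Definition evalP (R : realType) (P : {poly {poly R[i]}}) (z w : R[i]) : R[i] :=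
  P.[w%:P].[z].

Definition algebraic_on (R : realType) (U : set (R * R)) (f : R[i] -> R[i]) :
  Prop :=
  exists2 P : {poly {poly R[i]}}, P != 0 &
    forall p, U p -> evalP P (cplx p) (f (cplx p)) = 0.

(* irreducible_poly over {poly R[i]} would be irreducibility over C(z) and would
   allow nonconstant factors in C[z]. *)
Definition irreducible_elt (A : idomainType) (a : A) : Prop :=
  [/\ a != 0, a \isn't a GRing.unit &
      forall b c : A, a = b * c -> b \is a GRing.unit \/ c \is a GRing.unit].

Definition degw (R : realType) (P : {poly {poly R[i]}}) : nat := (size P).-1.

Definition defining_poly (R : realType) (P : {poly {poly R[i]}})
  (f : R[i] -> R[i]) : Prop :=
  [/\ irreducible_elt P, (1 <= degw P)%N &
      near_infty (fun z => evalP P z (f z) = 0)].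

Definition msupport (R : realType) (mu : set (R * R) -> \bar R) :
  set (R * R) :=
  [set p | forall U : set (R * R), open U -> U p -> (0 < mu U)%E].

(* Total function: at the points where the integral is not absolutely convergent
   (a planar null set for a finite mu) its value is irrelevant. *)
Definition cauchy_transform (R : realType)
  (mu : {finite_measure set (R * R)%type -> \bar R}) (z : R[i]) : R[i] :=
  (\int[mu]_p complex.Re (z - cplx p)^-1) +i*
  (\int[mu]_p complex.Im (z - cplx p)^-1).

(* The square partial sums suffice: the bound on c gives absolute convergence. *)
Definition analytic_at (R : realType) (g : R * R -> R) (p : R * R) : Prop :=
  exists (r M : R) (c : nat -> nat -> R),
    [/\ 0 < r, forall i j, `|c i j| * r ^+ (i + j) <= M &
        forall x y : R, `|x| < r -> `|y| < r ->
          (fun n : nat => \sum_(i < n) \sum_(j < n) c i j * x ^+ i * y ^+ j)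
            @ \oo --> g (p.1 + x, p.2 + y)].

(* Lojasiewicz: near every point of the plane, A is a finite union of sets given
   by finitely many conditions g = 0 or g > 0 with g real-analytic. *)
Definition semianalytic (R : realType) (A : set (R * R)) : Prop :=
  forall p : R * R, exists U : set (R * R),
    [/\ open U, U p & exists (n m : nat) (g : 'I_n -> 'I_m -> R * R -> R)
                             (strict : 'I_n -> 'I_m -> bool),
      (forall i j q, U q -> analytic_at (g i j) q) /\
      forall q, U q -> (A q <-> exists i, forall j,
        if strict i j then (0 < g i j q : Prop) else g i j q = 0)].

Definition compact_semianalytic_arc (R : realType) (A : set (R * R)) : Prop :=
  semianalytic A /\
  exists gamma : R -> R * R,
    [/\ {within `[0, 1], continuous gamma},
        {in `[0, 1] &, injective gamma} & A = gamma @` `[0, 1]].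

Definition finite_union_arcs_isolated (R : realType) (S : set (R * R)) : Prop :=
  exists (n : nat) (A : 'I_n -> set (R * R)) (F : seq (R * R)),
    [/\ forall i, compact_semianalytic_arc (A i),
        [set` F] `<=` isolated S &
        S = (\bigcup_i A i) `|` [set` F]].

Definition branch_on (R : realType) (P : {poly {poly R[i]}}) (U : set (R * R))
  (g : R[i] -> R[i]) : Prop :=
  holomorphic_on U g /\ forall p, U p -> evalP P (cplx p) (g (cplx p)) = 0.

(* Defined for germs at infinity f with f(z) = a0 / z + O(z^-2), a0 > 0. *)
Definition mother_body (R : realType) (f : R[i] -> R[i])
  (mu : {finite_measure set (R * R)%type -> \bar R}) : Prop :=
  [/\ compact (msupport mu),
      near_infty (fun z => cauchy_transform mu z = f z),
      finite_union_arcs_isolated (msupport mu) &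
      exists2 P, defining_poly P f &
        forall p, ~ msupport mu p ->
          branch_on P (connected_component (~` msupport mu) p)
            (cauchy_transform mu)].

Definition germ_measures (R : realType) (f : R[i] -> R[i]) (K : set (R * R)) :
  set {finite_measure set (R * R)%type -> \bar R} :=
  [set mu : {finite_measure set (R * R)%type -> \bar R} |
    msupport mu `<=` K /\ near_infty (fun z => cauchy_transform mu z = f z)].

Definition defect (R : realType) (P : {poly {poly R[i]}}) (K : set (R * R))
  (mu : {finite_measure set (R * R)%type -> \bar R}) : \bar R :=
  (\int[@planar_lebesgue R]_(p in K)
    ((cabs (evalP P (cplx p) (cauchy_transform mu (cplx p)))
       `^ ((degw P)%:R^-1))%R)%:E)%E.

(* delta_P(f; K) is a minimum, so it is stated as an attained lower bound. *)
Definition is_delta (R : realType) (P : {poly {poly R[i]}}) (f : R[i] -> R[i])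
  (K : set (R * R)) (v : \bar R) : Prop :=
  (exists2 mu, germ_measures f K mu & defect P K mu = v) /\
  forall mu, germ_measures f K mu -> (v <= defect P K mu)%E.

Definition condition_star (R : realType) (E : set R) (f : R[i] -> R[i]) (a0 : R) : Prop :=
  [/\ forall p, ~ realset E p -> f (conjc (cplx p)) = conjc (f (cplx p)),
      forall z, 0 < complex.Im z -> complex.Im (f z) < 0,
      (exists M : R, near_infty (fun z =>
         cabs (f z - a0%:C / z) <= M / cabs z ^+ 2)) &
      0 < a0].

(* Main.v *)
(* The function v = - Im f is positive and harmonic in the upper half plane, up
   to the finitely many critical points of a minimal algebraic relation P(z, f) = 0,
   and it decays at infinity. By the maximum principle, v(. + i e) is uniformly
   close to the Poisson integral of a step function; a limit along an ultrafilter
   of the distribution functions of these step functions defines a measure mu on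
   the real line with v = - Im C_mu, and f = C_mu follows from the
   Cauchy-Riemann equations and the decay at infinity.

   At a real point x0 where P(x0, w) has only simple roots and full degree, f
   follows one root near x0 in the upper half plane. As the roots come in
   conjugate pairs, either this root is not real, so that - Im f is bounded below
   and x0 is interior to the support, or it stays real along the axis, so that
   - Im f tends to 0 and x0 is off the support. Hence the indicator of the support
   is locally constant off a finite set.

   For uniqueness, Fubini gives the integral of - Im C_nu along horizontal lines:
   it forces nu onto the real line, and then determines nu on intervals. The
   defect of mu vanishes because its integrand vanishes off the real line. *)

Require Import Defs.
From HB Require Import structures.
From mathcomp Require Import all_boot all_order all_algebra.
From mathcomp Require Import all_classical all_reals all_analysis.
From mathcomp Require Import complex separable measurable_realfun.
From mathcomp Require Import ring lra zify.
Set Implicit Arguments.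
Unset Strict Implicit.
Unset Printing Implicit Defensive.
Import Order.TTheory GRing.Theory Num.Theory.
Import numFieldNormedType.Exports HBNNSimple.
Local Open Scope classical_set_scope.
Local Open Scope ring_scope.
Local Open Scope complex_scope.

(** * Complex differentiability in terms of moduli *)

(** Holomorphy enters only as a bare complex derivative, so smoothness and identity principles are
    drawn from the algebraic relation instead. Identities travel along segments that avoid the roots
    of [c] and reach the roots by continuity. No boundary values of f on E are available, so v is
    read at a height e > 0, picked after the tolerance so that v(. + i e) is small outside an
    interval [-L, L]; finitely many cells in this interval then suffice. The value of v near the
    point i bounds all their masses. A competing measure may charge the whole plane, and its Cauchy
    transform may diverge at some points. Integrating - Im of the kernel over a segment of a
    horizontal line gives the angle under which the segment is seen: a bounded function, positive
    below the line and negative above it. The bound pi justifies Fubini, and the sign locates the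
    mass. *)

Lemma cabsE (R : realType) (z : R[i]) :
  cabs z = Num.sqrt (complex.Re z ^+ 2 + complex.Im z ^+ 2).
Proof. by rewrite /cabs normc_def. Qed.

Lemma cabsC (R : realType) (z : R[i]) : (cabs z)%:C = `|z|.
Proof. by rewrite /cabs normc_def. Qed.

Lemma cabs_ge0 (R : realType) (z : R[i]) : 0 <= cabs z.
Proof. by rewrite -ler0c cabsC. Qed.

Lemma cabs_eq0 (R : realType) (z : R[i]) : (cabs z == 0) = (z == 0).
Proof. by rewrite -(inj_eq (@complexI R)) cabsC normr_eq0. Qed.

Lemma cabs_gt0 (R : realType) (z : R[i]) : (0 < cabs z) = (z != 0).
Proof. by rewrite lt0r cabs_eq0 cabs_ge0 andbT. Qed.

Lemma cabs0 (R : realType) : cabs (0 : R[i]) = 0.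
Proof. by apply/eqP; rewrite cabs_eq0. Qed.

Lemma cabsM (R : realType) (z w : R[i]) : cabs (z * w) = cabs z * cabs w.
Proof. by apply: (@complexI R); rewrite rmorphM /= !cabsC normrM. Qed.

Lemma cabsN (R : realType) (z : R[i]) : cabs (- z) = cabs z.
Proof. by apply: (@complexI R); rewrite !cabsC normrN. Qed.

Lemma cabsB (R : realType) (z w : R[i]) : cabs (z - w) = cabs (w - z).
Proof. by rewrite -cabsN opprB. Qed.

Lemma cabsV (R : realType) (z : R[i]) : cabs z^-1 = (cabs z)^-1.
Proof. by apply: (@complexI R); rewrite fmorphV /= !cabsC normfV. Qed.

Lemma cabs1 (R : realType) : cabs (1 : R[i]) = 1.
Proof. by apply: (@complexI R); rewrite cabsC normr1. Qed.

Lemma cabsJ (R : realType) (z : R[i]) : cabs (conjc z) = cabs z.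
Proof. by case: z => a b; rewrite !cabsE /= sqrrN. Qed.

Lemma cabs_real (R : realType) (x : R) : cabs x%:C = `|x|.
Proof. by rewrite cabsE /= expr0n addr0 sqrtr_sqr. Qed.

Lemma cabsD (R : realType) (z w : R[i]) : cabs (z + w) <= cabs z + cabs w.
Proof. by rewrite -lecR rmorphD /= !cabsC ler_normD. Qed.

Lemma cabs_distD (R : realType) (y z w : R[i]) :
  cabs (z - w) <= cabs (z - y) + cabs (y - w).
Proof. by rewrite (le_trans _ (cabsD _ _))// addrA subrK. Qed.

Lemma ler_cabsB (R : realType) (z w : R[i]) : cabs z - cabs w <= cabs (z - w).
Proof. by rewrite lerBlDr (le_trans _ (cabsD _ _))// subrK. Qed.

Lemma Re_le_cabs (R : realType) (z : R[i]) : `|complex.Re z| <= cabs z.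
Proof. by rewrite cabsE -sqrtr_sqr ler_wsqrtr// lerDl sqr_ge0. Qed.

Lemma Im_le_cabs (R : realType) (z : R[i]) : `|complex.Im z| <= cabs z.
Proof. by rewrite cabsE -sqrtr_sqr ler_wsqrtr// lerDr sqr_ge0. Qed.

Lemma cabs_le (R : realType) (z : R[i]) :
  cabs z <= `|complex.Re z| + `|complex.Im z|.
Proof.
rewrite cabsE -[leRHS]ger0_norm ?addr_ge0// -sqrtr_sqr ler_wsqrtr//.
rewrite sqrrD -[complex.Re z ^+ 2]real_normK ?num_real//.
rewrite -[complex.Im z ^+ 2]real_normK ?num_real//.
by rewrite lerD2r lerDl mulrn_wge0// mulr_ge0.
Qed.

Lemma cabs_sqr (R : realType) (z : R[i]) :
  cabs z ^+ 2 = complex.Re z ^+ 2 + complex.Im z ^+ 2.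
Proof. by rewrite cabsE sqr_sqrtr// addr_ge0// sqr_ge0. Qed.

Lemma ReB (R : realType) (z w : R[i]) :
  complex.Re (z - w) = complex.Re z - complex.Re w.
Proof. by case: z w => [a b] [c d]. Qed.

Lemma ImB (R : realType) (z w : R[i]) :
  complex.Im (z - w) = complex.Im z - complex.Im w.
Proof. by case: z w => [a b] [c d]. Qed.

Lemma ReD (R : realType) (z w : R[i]) :
  complex.Re (z + w) = complex.Re z + complex.Re w.
Proof. by case: z w => [a b] [c d]. Qed.

Lemma ImD (R : realType) (z w : R[i]) :
  complex.Im (z + w) = complex.Im z + complex.Im w.
Proof. by case: z w => [a b] [c d]. Qed.

Lemma ImV (R : realType) (z : R[i]) :
  complex.Im z^-1 = - complex.Im z / cabs z ^+ 2.
Proof. by rewrite cabs_sqr; case: z => a b /=; rewrite mulNr. Qed.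

Lemma ReV (R : realType) (z : R[i]) :
  complex.Re z^-1 = complex.Re z / cabs z ^+ 2.
Proof. by rewrite cabs_sqr; case: z => a b. Qed.

(** The difference quotient multiplied out, with real tolerances and moduli: estimates take place in
    the ordered field [R] rather than in the partially ordered [R[i]]. *)
Definition cderiv (R : realType) (f : R[i] -> R[i]) (z l : R[i]) :=
  forall e : R, 0 < e -> exists2 d : R, 0 < d &
    forall h, cabs h < d -> cabs (f (z + h) - f z - l * h) <= e * cabs h.

Definition ccont (R : realType) (f : R[i] -> R[i]) (z : R[i]) :=
  forall e : R, 0 < e -> exists2 d : R, 0 < d &
    forall w, cabs (w - z) < d -> cabs (f w - f z) < e.

(** The order of [R[i]] relates only numbers with the same imaginary part, so the radii and
    tolerances of its topology are real. *)
Lemma gt0_complex (R : realType) (e : R[i]) : 0 < e -> e = (complex.Re e)%:C.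
Proof. by move=> /ltW/ger0_real/RRe_real ->. Qed.

Lemma derivable_cderiv (R : realType) (f : R[i] -> R[i]) (z : R[i]) :
  derivable (f : R[i]^o -> R[i]^o) z 1 ->
  cderiv f z ('D_1 (f : R[i]^o -> R[i]^o) z).
Proof.
move=> df e e0; set l : R[i] := 'D_1 (f : R[i]^o -> R[i]^o) z.
have := @cvgr_dist_le R[i] R[i]^o _ _ _ _ l df e%:C _.
rewrite ltcR => /(_ _ e0); rewrite /at_right /nbhs_ball /within /= => H.
have [d /= d0 dH] := (nbhs_ballP _ _).1 H.
have dE := gt0_complex d0; exists (complex.Re d); first by rewrite -ltcR -dE.
move=> h hd; have [->|h0] := eqVneq h 0.
  by rewrite addr0 subrr mulr0 subrr cabs0 mulr0.
have : `|0 - h| < d by rewrite sub0r normrN -cabsC dE ltcR.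
move/dH => /(_ h0) K.
have {}K : cabs (l - h^-1 * (f (h + z) - f z)) <= e.
  by rewrite -lecR cabsC; move: K; rewrite /GRing.scale /= mulr1.
rewrite (addrC z).
have -> : f (h + z) - f z - l * h = - (h * (l - h^-1 * (f (h + z) - f z))).
  by field.
by rewrite cabsN cabsM mulrC ler_wpM2r ?cabs_ge0.
Qed.

Lemma cderiv_is_derive (R : realType) (f : R[i] -> R[i]) (z l : R[i]) :
  cderiv f z l -> is_derive (z : R[i]^o) 1 (f : R[i]^o -> R[i]^o) l.
Proof.
move=> df.
have H : (fun h : R[i] => h^-1 *: ((f (h *: (1 : R[i]^o) + z) - f z) : R[i]^o))
   @ (0 : R[i]^o)^' --> (l : R[i]^o).
  apply/cvgrPdist_le => e e0; rewrite (gt0_complex e0).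
  have e0' : 0 < complex.Re e by rewrite -ltcR -gt0_complex.
  have [d d0 dH] := df _ e0'.
  apply/nbhs_ballP; exists d%:C => /=; first by rewrite ltcR.
  move=> h; rewrite -ball_normE /ball_ /= sub0r normrN -cabsC ltcR => hd h0.
  rewrite -cabsC lecR; have {dH} := dH _ hd.
  have -> : f (z + h) - f z - l * h = - (h * (l - h^-1 * (f (h + z) - f z))).
    by rewrite (addrC z); field.
  rewrite cabsN cabsM mulrC ler_pM2r ?cabs_gt0//.
  by rewrite /GRing.scale /= mulr1.
apply: DeriveDef; first by apply/cvg_ex; exists l.
exact: (@cvg_lim R[i]^o).
Qed.

Lemma cderivable (R : realType) (f : R[i] -> R[i]) (z l : R[i]) :
  cderiv f z l -> derivable (f : R[i]^o -> R[i]^o) z 1.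
Proof. by move/cderiv_is_derive => ?; exact: ex_derive. Qed.

Lemma is_derive_cderiv (R : realType) (f : R[i] -> R[i]) (z l : R[i]) :
  is_derive (z : R[i]^o) 1 (f : R[i]^o -> R[i]^o) l -> cderiv f z l.
Proof.
move=> df; have := @derivable_cderiv R f z (@ex_derive _ _ _ _ _ _ _ df).
by rewrite derive_val.
Qed.

Lemma cderiv_ccont (R : realType) (f : R[i] -> R[i]) (z l : R[i]) :
  cderiv f z l -> ccont f z.
Proof.
move=> df e e0; have [d d0 dH] := df 1 ltr01.
have K0 : 0 < cabs l + 1 + 1 by have := cabs_ge0 l; lra.
exists (Num.min d (e / (cabs l + 1 + 1))).
  by rewrite lt_min d0 divr_gt0.
move=> w; rewrite lt_min => /andP[wd we]; have := dH _ wd.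
rewrite [z + _]addrC subrK mul1r => H.
have -> : f w - f z = (f w - f z - l * (w - z)) + l * (w - z) by rewrite subrK.
apply: le_lt_trans (cabsD _ _) _; rewrite cabsM.
move: we; rewrite ltr_pdivlMr// => we.
have := cabs_ge0 (w - z); have := cabs_ge0 l.
nra.
Qed.

Lemma real_is_derive (R : realType) (g : R -> R) (t c : R) :
  (forall e : R, 0 < e -> exists2 d : R, 0 < d &
     forall h, `|h| < d -> `|g (t + h) - g t - c * h| <= e * `|h|) ->
  is_derive t 1 g c.
Proof.
move=> dg.
have H : (fun h : R => h^-1 *: (g (h *: 1 + t) - g t)) @ 0^' --> c.
  apply/cvgrPdist_le => e e0; have [d d0 dH] := dg _ e0.
  apply/nbhs_ballP; exists d => //.
  move=> h; rewrite -ball_normE /ball_ /= sub0r normrN => hd h0.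
  have := dH _ hd.
  have -> : g (t + h) - g t - c * h =
      - (h * (c - h^-1 * (g (h + t) - g t))).
    by rewrite (addrC t); field.
  rewrite normrN normrM mulrC ler_pM2r ?normr_gt0//.
  by rewrite /GRing.scale /= mulr1.
apply: DeriveDef; first by apply/cvg_ex; exists c.
exact: cvg_lim.
Qed.

(** With the next two lemmas, the Cauchy-Riemann equations: a real increment [h] gives the
    x-derivative, and the increment [0 +i* h] the y-derivatives. *)
Lemma cderiv_Im_x (R : realType) (f : R[i] -> R[i]) (x y : R) (l : R[i]) :
  cderiv f (x +i* y) l ->
  is_derive x 1 (fun t : R => complex.Im (f (t +i* y))) (complex.Im l).
Proof.
move=> df; apply: real_is_derive => e e0; have [d d0 dH] := df _ e0.
exists d => // h hd; have := dH h%:C; rewrite cabs_real => /(_ hd).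
apply: le_trans; apply: le_trans (Im_le_cabs _).
have -> : x +i* y + h%:C = (x + h) +i* y by rewrite /= /real_complex_def; simpc.
by rewrite !ImB; case: l {df dH} => a b /=; simpc.
Qed.

Lemma cderiv_Im_y (R : realType) (f : R[i] -> R[i]) (x y : R) (l : R[i]) :
  cderiv f (x +i* y) l ->
  is_derive y 1 (fun t : R => complex.Im (f (x +i* t))) (complex.Re l).
Proof.
move=> df; apply: real_is_derive => e e0; have [d d0 dH] := df _ e0.
exists d => // h hd; have := dH (0 +i* h).
have -> : cabs (0 +i* h) = `|h| by rewrite cabsE /= expr0n add0r sqrtr_sqr.
move=> /(_ hd); apply: le_trans; apply: le_trans (Im_le_cabs _).
have -> : x +i* y + (0 +i* h) = x +i* (y + h) by simpc.
by rewrite !ImB; case: l {df dH} => a b /=; simpc.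
Qed.

Lemma cderiv_Re_y (R : realType) (f : R[i] -> R[i]) (x y : R) (l : R[i]) :
  cderiv f (x +i* y) l ->
  is_derive y 1 (fun t : R => complex.Re (f (x +i* t))) (- complex.Im l).
Proof.
move=> df; apply: real_is_derive => e e0; have [d d0 dH] := df _ e0.
exists d => // h hd; have := dH (0 +i* h).
have -> : cabs (0 +i* h) = `|h| by rewrite cabsE /= expr0n add0r sqrtr_sqr.
move=> /(_ hd); apply: le_trans; apply: le_trans (Re_le_cabs _).
have -> : x +i* y + (0 +i* h) = x +i* (y + h) by simpc.
by rewrite !ReB; case: l {df dH} => a b /=; simpc.
Qed.

(** Connectedness of a segment, in the form used by every continuation argument: the supremum of the
    [t] up to which [p] keeps its truth value at [a] must be [b]. *)
Lemma locally_constant_itv (R : realType) (a b : R) (p : R -> Prop) :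
  a <= b ->
  (forall t, a <= t <= b -> exists2 d : R, 0 < d &
     forall s, a <= s <= b -> `|s - t| < d -> (p s <-> p t)) ->
  (p a <-> p b).
Proof.
move=> ab H.
pose A := [set t | a <= t <= b /\ forall s, a <= s <= t -> (p s <-> p a)].
have Aa : A a.
  by split; [rewrite lexx|move=> s /le_anti ->].
have Ab : ubound A b by move=> t [/andP[]].
have supA : has_sup A by split; [exists a|exists b].
set c := sup A.
have cab : a <= c <= b.
  by rewrite (ub_le_sup supA.2)//= ge_sup//; exists a.
have [d d0 dH] := H c cab.
have [t [/andP[at_ tb] At] ct] := sup_adherent d0 supA.
rewrite -/c in ct.
have tc : t <= c by apply: (ub_le_sup supA.2); split; rewrite ?at_.
have pca : p c <-> p a.
  rewrite -(At t) ?at_ ?lexx//.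
  apply: iff_sym; apply: dH; first by rewrite at_.
  by rewrite ltr_norml; apply/andP; split; lra.
have nearc s : a <= s <= b -> `|s - c| < d -> (p s <-> p a).
  by move=> sab sc; rewrite (dH s).
suff <- : c = b by symmetry.
apply/eqP; rewrite eq_le; have /andP[_ ->] := cab; rewrite /= leNgt.
apply/negP => cb.
(* If [c < b], this point lies beyond the supremum [c] and still belongs to [A]. *)
set u := Num.min b (c + d / 2).
have cu : c < u by rewrite /u lt_min cb ltrDl divr_gt0.
have : u <= c.
  apply: ub_le_sup; first by exists b.
  split; first by rewrite /u ge_min lexx andbT le_min ab/=; lra.
  move=> s /andP[as_ su]; have [st|ts] := leP s t.
    by apply: At; rewrite as_.
  have : s <= c + d / 2 by rewrite (le_trans su)// /u ge_min lexx orbT.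
  have sb : s <= b by rewrite (le_trans su)// /u ge_min lexx.
  move=> sc; apply: nearc; first by rewrite as_.
  by rewrite ltr_norml; apply/andP; split; lra.
by rewrite leNgt cu.
Qed.

Lemma ccont_cst (R : realType) (c z : R[i]) : ccont (fun=> c) z.
Proof. by move=> e e0; exists 1 => // w _; rewrite subrr cabs0. Qed.

Lemma ccont_id (R : realType) (z : R[i]) : ccont (fun z => z) z.
Proof. by move=> e e0; exists e. Qed.

Lemma ccontD (R : realType) (f g : R[i] -> R[i]) z :
  ccont f z -> ccont g z -> ccont (fun z => f z + g z) z.
Proof.
move=> cf cg e e0; have e2 : 0 < e / 2 by rewrite divr_gt0.
have [d d0 dH] := cf _ e2; have [d' d'0 d'H] := cg _ e2.
exists (Num.min d d'); first by rewrite lt_min d0.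
move=> w; rewrite lt_min => /andP[/dH ? /d'H ?].
have -> : f w + g w - (f z + g z) = (f w - f z) + (g w - g z) by ring.
by apply: le_lt_trans (cabsD _ _) _; lra.
Qed.

Lemma ccontM (R : realType) (f g : R[i] -> R[i]) z :
  ccont f z -> ccont g z -> ccont (fun z => f z * g z) z.
Proof.
move=> cf cg e e0; set K := cabs (f z) + cabs (g z) + 1.
have fz0 := cabs_ge0 (f z); have gz0 := cabs_ge0 (g z).
have K0 : 0 < K by rewrite /K; lra.
have e2 : 0 < Num.min 1 (e / (K * 2)) by rewrite lt_min ltr01 divr_gt0 ?mulr_gt0.
have [d d0 dH] := cf _ e2; have [d' d'0 d'H] := cg _ e2.
exists (Num.min d d'); first by rewrite lt_min d0.
move=> w; rewrite lt_min => /andP[/dH + /d'H]; rewrite !lt_min => /andP[f1 fe] /andP[g1 ge].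
have -> : f w * g w - f z * g z =
  (f w - f z) * (g w - g z) + ((f w - f z) * g z + f z * (g w - g z)) by ring.
have h1 := cabsD ((f w - f z) * (g w - g z)) ((f w - f z) * g z + f z * (g w - g z)).
have h2 := cabsD ((f w - f z) * g z) (f z * (g w - g z)).
rewrite !cabsM in h1 h2; apply: le_lt_trans h1 _.
have fw0 := cabs_ge0 (f w - f z); have gw0 := cabs_ge0 (g w - g z).
rewrite ltr_pdivlMr ?mulr_gt0// in fe; rewrite ltr_pdivlMr ?mulr_gt0// in ge.
set a := cabs (f w - f z) in f1 fe fw0 h2 *.
set b := cabs (g w - g z) in g1 ge gw0 h2 *.
have h3 : a * b <= a by rewrite ler_piMr// ltW.
apply: (@le_lt_trans _ _ (a + (a * cabs (g z) + cabs (f z) * b))); first by rewrite lerD.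
have : a * (cabs (g z) + 1) <= a * K by rewrite ler_wpM2l// /K; lra.
have : cabs (f z) * b <= K * b by rewrite ler_wpM2r// /K; lra.
by nra.
Qed.

Lemma ccont_neq0 (R : realType) (f : R[i] -> R[i]) z :
  ccont f z -> f z != 0 ->
  exists2 d : R, 0 < d & forall w, cabs (w - z) < d -> f w != 0.
Proof.
move=> cf f0; have := cf (cabs (f z)); rewrite cabs_gt0 => /(_ f0)[d d0 dH].
exists d => // w /dH; apply: contraTneq => ->.
by rewrite sub0r cabsN ltxx.
Qed.

(** * Algebraic relations on slit domains *)

Lemma evalPD (R : realType) (P Q : {poly {poly R[i]}}) z w :
  evalP (P + Q) z w = evalP P z w + evalP Q z w.
Proof. by rewrite /evalP !hornerE. Qed.

Lemma evalPB (R : realType) (P Q : {poly {poly R[i]}}) z w :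
  evalP (P - Q) z w = evalP P z w - evalP Q z w.
Proof. by rewrite /evalP !hornerE. Qed.

Lemma evalPM (R : realType) (P Q : {poly {poly R[i]}}) z w :
  evalP (P * Q) z w = evalP P z w * evalP Q z w.
Proof. by rewrite /evalP !hornerE. Qed.

Lemma evalPC (R : realType) (c : {poly R[i]}) z w : evalP c%:P z w = c.[z].
Proof. by rewrite /evalP hornerC. Qed.

Lemma evalPZ (R : realType) (c : {poly R[i]}) P z w :
  evalP (c *: P) z w = c.[z] * evalP P z w.
Proof. by rewrite /evalP !hornerE. Qed.

Lemma evalPX (R : realType) (z w : R[i]) : evalP 'X z w = w.
Proof. by rewrite /evalP !hornerE. Qed.

Lemma evalPE (R : realType) (P : {poly {poly R[i]}}) (z w : R[i]) :
  evalP P z w = (map_poly (horner_eval z) P).[w].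
Proof.
elim/poly_ind: P => [|P c IH]; first by rewrite /evalP map_poly0 !horner0.
by rewrite evalPD evalPM evalPX evalPC rmorphD rmorphM /= map_polyX map_polyC
  /= !hornerE IH horner_evalE.
Qed.

Lemma horner_ccont (R : realType) (c : {poly R[i]}) z : ccont (fun z => c.[z]) z.
Proof.
elim/poly_ind: c => [|c a IH].
  by under eq_fun do rewrite horner0; exact: ccont_cst.
under eq_fun do rewrite !hornerE.
by apply: ccontD; [apply: ccontM => //; exact: ccont_id|exact: ccont_cst].
Qed.

Lemma evalP_ccont (R : realType) (P : {poly {poly R[i]}}) f z :
  ccont f z -> ccont (fun z => evalP P z (f z)) z.
Proof.
move=> cf; elim/poly_ind: P => [|P c IH].
  by under eq_fun do rewrite /evalP !horner0; exact: ccont_cst.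
under eq_fun do rewrite evalPD evalPM evalPX evalPC.
by apply: ccontD; [exact: ccontM|exact: horner_ccont].
Qed.

Lemma nonroot_seq (R : realType) (c : {poly R[i]}) (g : nat -> R[i]) :
  c != 0 -> injective g -> exists k, c.[g k] != 0.
Proof.
move=> c0 gi; apply: contrapT => /forallNP H.
suff : (size [seq g k | k <- iota 0 (size c)] < size c)%N.
  by rewrite size_map size_iota ltnn.
apply: max_poly_roots => //; last by rewrite map_inj_uniq ?iota_uniq.
by apply/allP => _ /mapP[k _ ->]; apply/rootP/eqP/negPn/negP; exact: H.
Qed.

(* The domains on which algebraic relations are propagated; [f] is only assumed
   continuous, and connectedness replaces the identity theorem. *)
Definition slit_domain (R : realType) (D : R[i] -> Prop) (f : R[i] -> R[i]) :=
  [/\ forall z, D z -> ccont f z,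
      forall z, D z -> exists2 r : R, 0 < r & forall w, cabs (w - z) < r -> D w,
      forall z, complex.Im z != 0 -> D z &
      exists L : R, forall z, L < cabs z -> D z].

Definition annihilates (R : realType) (D : R[i] -> Prop) (f : R[i] -> R[i])
  (P : {poly {poly R[i]}}) := forall z, D z -> evalP P z (f z) = 0.

(** The points z + i s r / (k + 2) are infinitely many, so one of them is not a root; the sign [s]
    makes them move away from the real axis, hence they are nonreal even if z is real. *)
Lemma nonreal_nonroot_near (R : realType) (c : {poly R[i]}) (z : R[i]) (r : R) :
  c != 0 -> 0 < r ->
  exists w, [/\ complex.Im w != 0, cabs (w - z) < r & c.[w] != 0].
Proof.
move=> c0 r0; pose s : R := if 0 <= complex.Im z then 1 else -1.
pose g (k : nat) := z + (0 +i* (s * (r / k.+2%:R))).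
have s0 : s != 0 by rewrite /s; case: ifP; rewrite ?oppr_eq0 oner_eq0.
have gi : injective g.
  move=> j k /addrI[]/(mulfI s0)/(mulfI (lt0r_neq0 r0))/invr_inj/eqP.
  by rewrite eqr_nat => /eqP[].
have [k ck] := nonroot_seq c0 gi; exists (g k); split => //.
- rewrite /g ImD /= /s; case: (leP 0 (complex.Im z)) => h.
    by rewrite gt_eqF// ltr_wpDl// mul1r divr_gt0.
  have : 0 < r / k.+2%:R by rewrite divr_gt0.
  by move: (r / _) => q q0; rewrite lt_eqF// mulN1r; lra.
- rewrite /g addrC addKr cabsE /= expr0n add0r sqrtr_sqr normrM.
  have -> : `|s| = 1 by rewrite /s; case: ifP; rewrite ?normrN normr1.
  rewrite mul1r ger0_norm ?divr_ge0 ?ltW// ltr_pdivrMr//.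
  by rewrite ltr_pMr// ltr1n.
Qed.

(** Nonreal points off the roots of [c] are dense and [evalP P z (f z)] is continuous. This is how
    denominators [c] from C[z] are discarded. *)
Lemma annihilates_closure (R : realType) (D : R[i] -> Prop) f P
    (c : {poly R[i]}) :
  (forall z, D z -> ccont f z) -> c != 0 ->
  (forall z, complex.Im z != 0 -> c.[z] != 0 -> evalP P z (f z) = 0) ->
  annihilates D f P.
Proof.
move=> cf c0 H z Dz; apply/eqP/negPn/negP => Pz.
have [d d0 dH] := ccont_neq0 (@evalP_ccont _ P _ _ (cf _ Dz)) Pz.
have [w [w1 w2 w3]] := nonreal_nonroot_near z c0 d0.
by have := dH _ w2; rewrite H// eqxx.
Qed.

(* [u * g + v * h = c%:P] keeps [g] and [h] from vanishing simultaneously, so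
   where [c] has no root the zero set of [g] is open and closed. *)
Lemma segment_transport (R : realType) (D : R[i] -> Prop) f
    (u v g h : {poly {poly R[i]}}) (c : {poly R[i]}) (z w : R[i]) :
  (forall z, D z -> ccont f z) -> u * g + v * h = c%:P ->
  annihilates D f (g * h) ->
  (forall t : R, 0 <= t <= 1 -> D (z + t%:C * w) /\ c.[z + t%:C * w] != 0) ->
  (evalP g z (f z) = 0 <-> evalP g (z + w) (f (z + w)) = 0).
Proof.
move=> cf uv gh H.
pose p (t : R) := evalP g (z + t%:C * w) (f (z + t%:C * w)) = 0.
have -> : evalP g z (f z) = 0 <-> p 0 by rewrite /p mul0r addr0.
have -> : evalP g (z + w) (f (z + w)) = 0 <-> p 1 by rewrite /p mul1r.
apply: locally_constant_itv => // t t01; have [Dt ct] := H t t01.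
have near (q : {poly {poly R[i]}}) :
    evalP q (z + t%:C * w) (f (z + t%:C * w)) != 0 ->
    exists2 d : R, 0 < d & forall s, `|s - t| < d ->
    evalP q (z + s%:C * w) (f (z + s%:C * w)) != 0.
  move=> qt; have [d d0 dH] := ccont_neq0 (@evalP_ccont _ q _ _ (cf _ Dt)) qt.
  have K0 : 0 < cabs w + 1 by have := cabs_ge0 w; lra.
  exists (d / (cabs w + 1)); first by rewrite divr_gt0.
  move=> s; rewrite ltr_pdivlMr// => st; apply: dH.
  rewrite opprD addrACA subrr add0r -mulrBl -rmorphB cabsM cabs_real.
  by apply: le_lt_trans st; rewrite ler_wpM2l//; lra.
have [gt|/eqP gt] := eqVneq (evalP g (z + t%:C * w) (f (z + t%:C * w))) 0.
  have ht : evalP h (z + t%:C * w) (f (z + t%:C * w)) != 0.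
    apply: contra ct => /eqP ht; rewrite -(evalPC c _ (f (z + t%:C * w))) -uv.
    by rewrite evalPD !evalPM gt ht !mulr0 addr0.
  have [d d0 dH] := near _ ht; exists d => // s s01 st.
  split=> // _; have [Ds _] := H s s01; have := gh _ Ds.
  by rewrite evalPM => /eqP; rewrite mulf_eq0 (negPf (dH _ st)) orbF => /eqP.
have /eqP gt' := gt; have [d d0 dH] := near _ gt'; exists d => // s s01 st.
by split => // ps; have := dH _ st; rewrite ps eqxx.
Qed.

(** At a far real point one of the two factors vanishes. From there it is carried along segments to
    every nonreal point that is not a root of [c]; real points beyond [L] belong to the domain and
    link the two half planes. *)
Lemma annihilates_mul (R : realType) (D : R[i] -> Prop) f
    (u v g h : {poly {poly R[i]}}) (c : {poly R[i]}) :
  slit_domain D f -> c != 0 -> u * g + v * h = c%:P ->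
  annihilates D f (g * h) -> annihilates D f g \/ annihilates D f h.
Proof.
move=> [cf oD iD [L LD]] c0 uv gh.
have [rs cE] := closed_field_poly_normal c.
have rsP w : c.[w] = 0 -> w \in rs.
  move=> cw; have : root c w by apply/rootP.
  by rewrite cE rootZ ?lead_coef_eq0// root_prod_XsubC.
(* A sum serves as an upper bound for the moduli of all roots at once. *)
pose x1 : R := `|L| + 1 + \sum_(w <- rs) cabs w.
have S0 : 0 <= \sum_(w <- rs) cabs w by apply: sumr_ge0 => w _; exact: cabs_ge0.
have x1D x : x1 <= x -> D x%:C /\ c.[x%:C] != 0.
  rewrite /x1 => x1x; have L0 := ler_norm L; split.
    by apply: LD; rewrite cabs_real; have := ler_norm x; lra.
  apply/eqP => /rsP xrs; have : cabs x%:C <= \sum_(w <- rs) cabs w.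
    by rewrite (big_rem _ xrs)/= lerDl sumr_ge0// => w _; exact: cabs_ge0.
  by rewrite cabs_real; have := ler_norm x; have := normr_ge0 L; lra.
have main q q' u' v' : u' * q + v' * q' = c%:P -> annihilates D f (q * q') ->
    evalP q x1%:C (f x1%:C) = 0 -> annihilates D f q.
  move=> uv' qq' q1; apply: (annihilates_closure cf c0) => z z0 cz.
  (* The point where the line from [z] through the root [w] meets the real axis. A real endpoint
     [x0] beyond all of them is joined to [z] by a segment free of roots. If the line is horizontal
     the division by zero returns a harmless value, since the parameter t = 0 is treated apart. *)
  pose bad (w : R[i]) := complex.Re z + (complex.Re w - complex.Re z) /
     (1 - complex.Im w / complex.Im z).
  pose x0 := x1 + 1 + \sum_(w <- rs) `|bad w|.
  have S1 : 0 <= \sum_(w <- rs) `|bad w| by apply: sumr_ge0.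
  have x01 : x1 <= x0 by rewrite /x0; lra.
  have q0 : evalP q x0%:C (f x0%:C) = 0.
    have := @segment_transport _ D f _ _ _ _ _ x1%:C (x0 - x1)%:C cf uv' qq'.
    rewrite -rmorphD addrCA subrr addr0 => <- // t /andP[t0 t1].
    rewrite -rmorphM -rmorphD; apply: x1D.
    by rewrite lerDl mulr_ge0// subr_ge0.
  have := @segment_transport _ D f _ _ _ _ _ z (x0%:C - z) cf uv' qq'.
  rewrite addrCA subrr addr0 => -> // t /andP[t0 t1].
  have [->|tn1] := eqVneq t 1.
    by rewrite mul1r addrCA subrr addr0; apply: x1D.
  have [->|tn0] := eqVneq t 0; first by rewrite mul0r addr0; split=> //; exact: iD.
  set w := z + _.
  have wI : complex.Im w = complex.Im z * (1 - t).
    by rewrite /w; case: (z) => a b /=; simpc; rewrite /=; ring.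
  have wR : complex.Re w = complex.Re z + t * (x0 - complex.Re z).
    by rewrite /w; case: (z) => a b /=; simpc; rewrite /=; ring.
  split; first by apply: iD; rewrite wI mulf_neq0// subr_eq0 eq_sym.
  apply/eqP => /rsP wrs; have : x0 = bad w.
    have E : 1 - complex.Im w / complex.Im z = t by rewrite wI; field.
    by rewrite /bad E wR; field.
  have : `|bad w| <= \sum_(w <- rs) `|bad w|.
    by rewrite (big_rem _ wrs)/= lerDl sumr_ge0.
  have : 0 <= x1 by rewrite /x1; have := normr_ge0 L; lra.
  by rewrite /x0; have := ler_norm (bad w); lra.
have [D1 c1] := x1D _ (lexx x1).
have := gh _ D1; rewrite evalPM => /eqP; rewrite mulf_eq0 => /orP[]/eqP E.
  by left; apply: main gh E; exact: uv.
right; apply: (main h g v u _ _ E); first by rewrite addrC.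
by rewrite mulrC.
Qed.

(** * Annihilating polynomials of least degree *)

Lemma gcdp_cofactors (A : idomainType) (P Q : {poly A}) :
  exists c1 c2 P' Q', [/\ c1 != 0, c2 != 0, c1 *: P = P' * gcdp P Q &
    c2 *: Q = Q' * gcdp P Q].
Proof.
have /Pdiv.Idomain.dvdpP[[c1 P'] /= c10 E1] := dvdp_gcdl P Q.
have /Pdiv.Idomain.dvdpP[[c2 Q'] /= c20 E2] := dvdp_gcdr P Q.
by exists c1, c2, P', Q'.
Qed.

(** Bezout over the fraction field of [A], with denominators cleared. For A = C[z] the constant [c]
    is a polynomial in z, and P and Q have no common root w over any z with c(z) nonzero. *)
Lemma bezout_const (A : idomainType) (P Q : {poly A}) :
  P != 0 -> (size (gcdp P Q) <= 1)%N ->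
  exists u v c, c != 0 /\ u * P + v * Q = c%:P.
Proof.
move=> P0 sg; have [u /eqpP[[c1 c2] /= /andP[c10 c20] E]] := Bezoutp P Q.
have gc := size1_polyC sg.
exists (c1%:P * u.1), (c1%:P * u.2), (c2 * (gcdp P Q)`_0); split.
  rewrite mulf_neq0//; apply: contra P0 => /eqP g0.
  have : gcdp P Q == 0 by rewrite gc g0.
  by rewrite gcdp_eq0 => /andP[].
by rewrite -!mulrA -mulrDr mul_polyC E polyCM -gc mul_polyC.
Qed.

Lemma size_cofactor (A : idomainType) (c : A) (P g h : {poly A}) :
  c != 0 -> P != 0 -> c *: P = g * h ->
  [/\ g != 0, h != 0 & ((size g + size h)%N = (size P).+1)%N].
Proof.
move=> c0 P0 E; have : g * h != 0 by rewrite -E -mul_polyC mulf_neq0// polyC_eq0.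
rewrite mulf_eq0 negb_or => /andP[g0 h0]; split=> //.
have := size_mul g0 h0; rewrite -E size_scale// => ->.
by rewrite prednK// addn_gt0 size_poly_gt0 g0.
Qed.

(** Two successive minima: least degree in w yields irreducibility over C(z), and least degree of
    the leading coefficient then excludes nonconstant factors from C[z]. *)
Definition min_annihilator (R : realType) (D : R[i] -> Prop) (f : R[i] -> R[i])
    (P : {poly {poly R[i]}}) :=
  [/\ P != 0, annihilates D f P,
      forall Q, Q != 0 -> annihilates D f Q -> (size P <= size Q)%N &
      forall Q, Q != 0 -> annihilates D f Q -> size Q = size P ->
        (size (lead_coef P) <= size (lead_coef Q))%N].

Lemma min_annihilator_exists (R : realType) (D : R[i] -> Prop) f P :
  P != 0 -> annihilates D f P -> exists Q, min_annihilator D f Q.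
Proof.
move=> P0 Pf.
pose p1 n := `[< exists Q, [/\ Q != 0, annihilates D f Q & size Q = n] >].
have ex1 : exists n, p1 n by exists (size P); apply/asboolP; exists P.
case: (ex_minnP ex1) => n /asboolP[Q [Q0 Qf Qn]] nmin.
pose p2 m := `[< exists Q, [/\ Q != 0, annihilates D f Q, size Q = n &
  size (lead_coef Q) = m] >].
have ex2 : exists m, p2 m by exists (size (lead_coef Q)); apply/asboolP; exists Q.
case: (ex_minnP ex2) => m /asboolP[S [S0 Sf Sn Sm]] mmin.
exists S; split=> // T T0 Tf; first by rewrite Sn; apply: nmin; apply/asboolP; exists T.
by move=> Ts; rewrite Sm; apply: mmin; apply/asboolP; exists T; rewrite Ts.
Qed.

(** If [g] and [h] are coprime over C(z), one of them annihilates [f] by [annihilates_mul].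
    Otherwise the common factor [e] can be struck from [g]: a zero of [e] is already a zero of [h],
    so [g' * h] annihilates [f]. Either way the degree drops below the minimum. *)
Lemma min_annihilator_factor (R : realType) (D : R[i] -> Prop) f P
    (g h : {poly {poly R[i]}}) (c : {poly R[i]}) :
  slit_domain D f -> min_annihilator D f P -> c != 0 -> c *: P = g * h ->
  (size g < size P)%N -> (size h < size P)%N -> False.
Proof.
move=> sD [P0 Pf Pmin _] c0 E sg sh.
have [g0 h0 sgh] := size_cofactor c0 P0 E.
have notann (Q : {poly {poly R[i]}}) : Q != 0 -> (size Q < size P)%N -> ~ annihilates D f Q.
  by move=> Q0 sQ /(Pmin _ Q0); rewrite leqNgt sQ.
have ghf : annihilates D f (g * h).
  by move=> z Dz; rewrite -E evalPZ Pf// mulr0.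
have [sgcd|sgcd] := leqP (size (gcdp g h)) 1.
  have [u [v [d [d0 uv]]]] := bezout_const g0 sgcd.
  by have [] := annihilates_mul sD d0 uv ghf; apply: notann.
have [c1 [c2 [g' [h' [c10 c20 E1 E2]]]]] := gcdp_cofactors g h.
set e := gcdp g h in sgcd E1 E2.
have [g'0 e0 s1] := size_cofactor c10 g0 E1.
have [h'0 _ s2] := size_cofactor c20 h0 E2.
have g'h0 : g' * h != 0 by rewrite mulf_neq0.
apply: (notann _ g'h0).
  rewrite size_mul// -ltnS prednK ?addn_gt0 ?size_poly_gt0 ?g'0//.
  by rewrite -sgh ltn_add2r -ltnS -s1 -addn1 ltn_add2l.
have [cf _ _ _] := sD.
apply: (annihilates_closure cf (mulf_neq0 c10 c20)) => z z0.
rewrite hornerM mulf_eq0 negb_or => /andP[c1z c2z].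
have Dz : D z by case: sD => _ _ + _; exact.
have /eqP := ghf _ Dz; rewrite !evalPM mulf_eq0 => /orP[|/eqP->]; last by rewrite mulr0.
move/eqP => gz; have : evalP (c1 *: g) z (f z) = 0 by rewrite evalPZ gz mulr0.
rewrite E1 evalPM => /eqP; rewrite mulf_eq0 => /orP[/eqP->|/eqP ez].
  by rewrite mul0r.
have : evalP (c2 *: h) z (f z) = 0 by rewrite E2 evalPM ez mulr0.
by rewrite evalPZ => /eqP; rewrite mulf_eq0 (negPf c2z)/= => /eqP->; rewrite mulr0.
Qed.

Lemma min_annihilator_size (R : realType) (D : R[i] -> Prop) f P :
  slit_domain D f -> min_annihilator D f P -> (1 < size P)%N.
Proof.
move=> [_ _ iD _] [P0 Pf _ _]; rewrite ltnNge; apply/negP => sP.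
have PE := size1_polyC sP; set c := P`_0 in PE.
have c0 : c != 0 by move: P0; rewrite PE polyC_eq0.
have [w [w0 _ cw]] := nonreal_nonroot_near 0 c0 (@ltr01 R).
by have := Pf _ (iD _ w0); rewrite PE evalPC => /eqP; apply/negP.
Qed.

(** In characteristic 0 a nonconstant common factor of P and P_w would split P. The roots of the
    resulting [c] include every z over which P(z, .) and P_w(z, .) have a common root. *)
Lemma min_annihilator_separable (R : realType) (D : R[i] -> Prop) f P :
  slit_domain D f -> min_annihilator D f P ->
  exists u v c, c != 0 /\ u * P + v * P^`() = c%:P.
Proof.
move=> sD mP; have sP := min_annihilator_size sD mP.
have [P0 _ _ _] := mP; apply: bezout_const => //.
rewrite leqNgt; apply/negP => sg.
have [c1 [_ [g [_ [c10 _ E _]]]]] := gcdp_cofactors P P^`().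
have [g0 e0 sE] := size_cofactor c10 P0 E.
apply: (min_annihilator_factor sD mP c10 E).
  by rewrite -ltnS -sE -addn1 ltn_add2l.
have P'0 : P^`() != 0.
  apply/eqP => P'0; have := coef_deriv P (size P).-2; rewrite P'0 coef0.
  case sn : (size P) sP => [|[|n]] // _ /= /esym/eqP.
  have -> : P`_n.+1 = lead_coef P by rewrite lead_coefE sn.
  rewrite -mulr_natr mulf_eq0 lead_coef_eq0 (negPf P0)/=.
  by rewrite -polyC_natr polyC_eq0 pnatr_eq0.
by apply: leq_ltn_trans (leq_gcdpr _ P'0) (lt_size_deriv P0).
Qed.

(** Induction on the degree of [c], one linear factor z - a at a time: at z = a the product g h
    vanishes in the domain C[w], so z - a divides all coefficients of [g] or all those of [h] and
    can be cancelled. *)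
Lemma gauss_lemma (R : realType) (c : {poly R[i]}) (P g h : {poly {poly R[i]}}) :
  c != 0 -> c *: P = g * h ->
  exists g' h', [/\ P = g' * h', size g' = size g & size h' = size h].
Proof.
have [n] := ubnP (size c); elim: n => // n IH in c P g h *.
rewrite ltnS => cn c0 E.
have [sc|sc] := leqP (size c) 1.
  have cE := size1_polyC sc; set a := c`_0 in cE.
  have a0 : a != 0 by move: c0; rewrite cE polyC_eq0.
  have a1 : a^-1%:P != 0 :> {poly R[i]} by rewrite polyC_eq0 invr_eq0.
  exists (a^-1%:P *: g), h; split => //; last by rewrite size_scale.
  by rewrite -scalerAl -E scalerA cE -polyCM mulVf// scale1r.
have [a ra] : exists a, root c a by apply/closed_rootP; rewrite neq_ltn sc orbT.
have [c' c'E] := factor_theorem _ _ ra.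
have c'0 : c' != 0 by apply: contraNneq c0 => c'0; rewrite c'E c'0 mul0r.
have Xa0 : ('X - a%:P)%:P != 0 :> {poly {poly R[i]}}.
  by rewrite polyC_eq0 polyXsubC_eq0.
have sc' : (size c' < n)%N.
  move: cn; rewrite c'E size_mul ?polyXsubC_eq0// size_XsubC addn2 /=.
  by apply: leq_trans.
have divides (q : {poly {poly R[i]}}) : map_poly (horner_eval a) q = 0 ->
    exists q', q = ('X - a%:P) *: q'.
  move=> qa; have /all_sig [k kE] i : {d | q`_i = d * ('X - a%:P)}.
    apply: sig_eqW; apply/factor_theorem/rootP.
    by have := congr1 (fun p : {poly R[i]} => p`_i) qa; rewrite coef_map coef0.
  exists (\poly_(i < size q) k i); apply/polyP => i.
  rewrite coefZ coef_poly; case: ltnP => [_|/leq_sizeP->//].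
    by rewrite kE mulrC.
  by rewrite mulr0.
have /eqP : map_poly (horner_eval a) g * map_poly (horner_eval a) h = 0.
  by rewrite -rmorphM -E -mul_polyC rmorphM /= map_polyC /= horner_evalE (rootP ra) mul0r.
rewrite mulf_eq0 => /orP[]/eqP/divides[q qE].
  have [|g' [h' [-> sg sh]]] := IH c' P q h sc' c'0.
    by apply: (mulfI Xa0); rewrite !mul_polyC scalerA mulrC -c'E E qE -scalerAl.
  by exists g', h'; rewrite qE size_scale ?polyXsubC_eq0.
have [|g' [h' [-> sg sh]]] := IH c' P g q sc' c'0.
  by apply: (mulfI Xa0); rewrite !mul_polyC scalerA mulrC -c'E E qE -scalerAr.
by exists g', h'; rewrite qE size_scale ?polyXsubC_eq0.
Qed.

Lemma annihilates_near_infty (R : realType) (D : R[i] -> Prop) f P :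
  slit_domain D f -> annihilates D f P ->
  near_infty (fun z => evalP P z (f z) = 0).
Proof. by move=> [_ _ _ [L DL]] Pf; exists L => z /DL; exact: Pf. Qed.

Lemma poly_size_unit (A : idomainType) (p : {poly A}) :
  p \is a GRing.unit -> size p = 1%N.
Proof. by rewrite poly_unitE => /andP[/eqP]. Qed.

Lemma min_annihilator_defining (R : realType) (D : R[i] -> Prop) f P :
  slit_domain D f -> min_annihilator D f P -> defining_poly P f.
Proof.
move=> sD mP; have sP := min_annihilator_size sD mP.
have [P0 Pf Pmin lmin] := mP; have [cf _ _ _] := sD.
split; last by exact: annihilates_near_infty sD Pf.
  split => //; first by apply/negP => /poly_size_unit sP1; rewrite sP1 in sP.
  (* If [b] has the full degree in w, then [c] is a polynomial [d] in z alone and [b] annihilates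
     [f] as well; the second minimality condition makes [d] a constant. *)
  have unit_factor b c : P = b * c -> (size P <= size b)%N -> c \is a GRing.unit.
    move=> E sPb; have E1 : 1 *: P = b * c by rewrite scale1r.
    have [b0 c0 s] := size_cofactor (oner_neq0 _) P0 E1.
    have sc : (size c <= 1)%N.
      by rewrite -(leq_add2l (size b)) s addn1 ltnS.
    have sbP : size b = size P.
      apply/eqP; rewrite eqn_leq sPb andbT -ltnS -s -addn1 leq_add2l.
      by rewrite size_poly_gt0.
    have cE := size1_polyC sc; set d := c`_0 in cE.
    have d0 : d != 0 by move: c0; rewrite cE polyC_eq0.
    have bf : annihilates D f b.
      apply: (annihilates_closure cf d0) => z z0 dz.
      have Dz : D z by case: sD => _ _ + _; exact.
      have := Pf _ Dz; rewrite E evalPM cE evalPC => /eqP.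
      by rewrite mulf_eq0 (negPf dz) orbF => /eqP.
    have := lmin _ b0 bf sbP; rewrite E lead_coefM cE lead_coefC.
    have lb0 : lead_coef b != 0 by rewrite lead_coef_eq0.
    rewrite size_mul// => sd.
    have sd1 : (size d <= 1)%N.
      rewrite -(leq_add2l (size (lead_coef b))) addn1.
      by move: sd; rewrite -subn1 leq_subLR add1n.
    rewrite poly_unitE size_polyC d0 /= coefC/= poly_unitE.
    have dE := size1_polyC sd1; rewrite eqn_leq sd1 size_poly_gt0 d0/=.
    by rewrite unitfE; apply: contra d0 => /eqP d00; rewrite dE d00.
  move=> b c E; have [sb|sb] := leqP (size P) (size b).
    by right; exact: unit_factor E sb.
  have [sc|sc] := leqP (size P) (size c).
    by left; apply: unit_factor sc; rewrite mulrC.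
  have E1 : 1 *: P = b * c by rewrite scale1r.
  by have := min_annihilator_factor sD mP (oner_neq0 _) E1 sb sc.
by rewrite /degw -subn1 subn_gt0.
Qed.

(** Continuation of the relation [Q] from a neighbourhood of infinity to the whole domain. If P and
    Q were coprime, the Bezout constant would vanish at infinitely many far points of the imaginary
    axis. So they share a factor [e]; minimality of P and, through Gauss, irreducibility of Q make
    both equal to [e] up to factors in C[z]. *)
Lemma defining_annihilates (R : realType) (D : R[i] -> Prop) f P Q :
  slit_domain D f -> min_annihilator D f P -> defining_poly Q f ->
  annihilates D f Q.
Proof.
move=> sD mP [[Q0 _ Qirr] dQ [r Qr]]; have sP := min_annihilator_size sD mP.
have [P0 Pf _ _] := mP; have [cf _ iD _] := sD.
have [sg|sg] := leqP (size (gcdp Q P)) 1.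
  have [u [v [c [c0 uv]]]] := bezout_const Q0 sg.
  pose g (k : nat) : R[i] := 0 +i* (`|r| + k.+1%:R).
  have gi : injective g by move=> j k [] /addrI/eqP; rewrite eqr_nat => /eqP[].
  have [k /eqP[]] := nonroot_seq c0 gi.
  rewrite -(evalPC c _ (f (g k))) -uv evalPD !evalPM Qr ?Pf ?mulr0 ?addr0//.
    by apply: iD; rewrite /g /= gt_eqF// ltr_wpDl.
  rewrite /g cabsE /= expr0n add0r sqrtr_sqr ger0_norm ?addr_ge0//.
  by have := ler_norm r; have : 0 < k.+1%:R :> R by []; lra.
have [c1 [c2 [h1 [h2 [c10 c20 E1 E2]]]]] := gcdp_cofactors Q P.
set e := gcdp Q P in sg E1 E2.
have [h10 e0 s1] := size_cofactor c10 Q0 E1.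
have [h20 _ s2] := size_cofactor c20 P0 E2.
have sh2 : (size h2 <= 1)%N.
  rewrite leqNgt; apply/negP => h21.
  apply: (min_annihilator_factor sD mP c20 E2).
    by rewrite -ltnS -s2 -addn1 ltn_add2l.
  by rewrite -ltnS -s2 addnC -addn1 ltn_add2l.
have [e' [h' [QE se sh]]] : exists e' h' : {poly {poly R[i]}},
    [/\ Q = h' * e', size e' = size e & size h' = size h1].
  by have [a [b [? ? ?]]] := gauss_lemma c10 E1; exists b, a.
have sh1 : (size h1 <= 1)%N.
  have [|] := Qirr _ _ QE; first by rewrite -sh => /poly_size_unit ->.
  by move=> /poly_size_unit e1; move: sg; rewrite -se e1.
have h2E := size1_polyC sh2; set d := h2`_0 in h2E.
have d0 : d != 0 by move: h20; rewrite h2E polyC_eq0.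
apply: (annihilates_closure cf (mulf_neq0 c10 d0)) => z z0.
rewrite hornerM mulf_eq0 negb_or => /andP[c1z dz].
have : evalP (c2 *: P) z (f z) = 0 by rewrite evalPZ Pf ?mulr0//; exact: iD.
rewrite E2 evalPM h2E evalPC => /eqP; rewrite mulf_eq0 (negPf dz)/= => /eqP ez.
have : evalP (c1 *: Q) z (f z) = 0 by rewrite E1 evalPM ez mulr0.
by rewrite evalPZ => /eqP; rewrite mulf_eq0 (negPf c1z) => /eqP.
Qed.

(** * Roots of the relation near a real point *)

Lemma evalP_conj (R : realType) (P : {poly {poly R[i]}}) (z w : R[i]) :
  evalP (map_poly (map_poly (@conjc R)) P) (conjc z) (conjc w) =
  conjc (evalP P z w).
Proof.
elim/poly_ind: P => [|P c IH]; first by rewrite rmorph0 /evalP !horner0 conjc0.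
rewrite rmorphD rmorphM /= map_polyX map_polyC /= !evalPD !evalPM !evalPX !evalPC.
by rewrite IH rmorphD rmorphM /= horner_map.
Qed.

(** The polynomial [Q] with conjugate coefficients annihilates [f] too. In
    [lead_coef Q *: P - lead_coef P *: Q] the leading terms cancel, so minimality makes this
    difference zero: P and Q are proportional over C[z]. *)
Lemma conj_roots (R : realType) (D : R[i] -> Prop) f P (t : R) (w : R[i]) :
  slit_domain D f -> min_annihilator D f P ->
  (forall z, D z -> D (conjc z) /\ f (conjc z) = conjc (f z)) ->
  (lead_coef P).[t%:C] != 0 -> evalP P t%:C w = 0 -> evalP P t%:C (conjc w) = 0.
Proof.
move=> sD mP fJ lt Pw; set Q := map_poly (map_poly (@conjc R)) P.
have [P0 Pf Pmin _] := mP; have sP := min_annihilator_size sD mP.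
have sQ : size Q = size P.
  rewrite size_map_poly_id0// map_poly_eq0 lead_coef_eq0//.
have Qf : annihilates D f Q.
  move=> z Dz; have [Dz' fz'] := fJ _ Dz.
  have := evalP_conj P (conjc z) (conjc (f z)).
  by rewrite -/Q !conjcK -fz' Pf// conjc0.
have E : lead_coef Q *: P = lead_coef P *: Q.
  apply/eqP; rewrite -subr_eq0; apply/negPn/negP => S0.
  set S := _ - _ in S0.
  have Sf : annihilates D f S.
    by move=> z Dz; rewrite evalPB !evalPZ Pf// Qf// !mulr0 subr0.
  have := Pmin _ S0 Sf; apply/negP; rewrite -ltnNge.
  have sS : (size S <= size P)%N.
    rewrite (leq_trans (size_polyD _ _))// geq_max size_polyN.
    by rewrite !(leq_trans (size_scale_leq _ _))// sQ.
  rewrite -(prednK (ltnW sP)) ltnS; apply/leq_sizeP => j.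
  rewrite leq_eqVlt => /orP[/eqP <-|jP].
    by rewrite coefB !coefZ -lead_coefE -sQ -lead_coefE mulrC subrr.
  have : (size P <= j)%N by rewrite -(prednK (ltnW sP)).
  by move=> /(leq_trans sS)/leq_sizeP; apply.
have : evalP (lead_coef Q *: P) t%:C w = 0 by rewrite evalPZ Pw mulr0.
rewrite E evalPZ => /eqP; rewrite mulf_eq0 (negPf lt)/= => /eqP Qw.
have := evalP_conj P t%:C (conjc w); rewrite -/Q conjcK conjc_real Qw.
by move=> /esym/eqP; rewrite conjc_eq0 => /eqP.
Qed.

(** Continuity of roots from the factorization |P(z, r)| = |l(z)| prod |r - u|: if all n roots u at
    z stayed at distance e from r, the value would be at least |l(t0)| / 2 times e^n, whereas it
    tends to 0 as z tends to t0. *)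
Lemma roots_near (R : realType) (P : {poly {poly R[i]}}) (t0 r : R[i]) (e : R) :
  (lead_coef P).[t0] != 0 -> evalP P t0 r = 0 -> 0 < e ->
  exists2 d : R, 0 < d & forall z, cabs (z - t0) < d ->
    exists u, evalP P z u = 0 /\ cabs (u - r) < e.
Proof.
move=> l0 Pr e0; set l := lead_coef P in l0.
set n := (size P).-1.
have l20 : 0 < cabs l.[t0] / 2 by rewrite divr_gt0// cabs_gt0.
have [d1 d10 H1] := @horner_ccont _ l t0 _ l20.
have [d2 d20 H2] := @evalP_ccont _ P _ t0 (@ccont_cst _ r t0) _
  (mulr_gt0 l20 (exprn_gt0 n e0)).
exists (Num.min d1 d2); first by rewrite lt_min d10.
move=> z; rewrite lt_min => /andP[/H1 z1 /H2]; rewrite Pr subr0 => z2.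
have lz : cabs l.[t0] / 2 < cabs l.[z].
  by have := ler_cabsB l.[t0] l.[z]; rewrite cabsB => h; lra.
have lz0 : l.[z] != 0 by rewrite -cabs_gt0; lra.
pose Pz := map_poly (horner_eval z) P.
have sPz : size Pz = size P by rewrite size_map_poly_id0.
have lPz : lead_coef Pz = l.[z] by rewrite lead_coef_map_id0 /horner_eval ?horner0.
have [rs PzE] := closed_field_poly_normal Pz.
have srs : size rs = n.
  have := congr1 (fun p : {poly R[i]} => size p) PzE; rewrite size_scale ?lPz//.
  by rewrite size_prod_XsubC sPz /n => ->.
apply: contrapT => /forallNP H; move: z2; apply/negP; rewrite -leNgt.
rewrite evalPE -/Pz PzE hornerZ horner_prod cabsM lPz.
have far u : u \in rs -> e <= cabs (r - u).
  move=> urs; rewrite leNgt; apply/negP => ue; apply: (H u).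
  rewrite cabsB; split=> //; rewrite evalPE -/Pz; apply/rootP.
  by rewrite PzE rootZ ?lPz// root_prod_XsubC.
apply: ler_pM; [exact: ltW|exact: exprn_ge0 (ltW e0)|exact: ltW|rewrite -srs].
elim: (rs) far => [|u s IH] far; first by rewrite big_nil expr0 cabs1.
rewrite big_cons /= exprS cabsM hornerXsubC; apply: ler_pM; [exact: ltW|exact: exprn_ge0 (ltW e0)| |].
  by apply: far; rewrite mem_head.
by apply: IH => v vs; apply: far; rewrite inE vs orbT.
Qed.

Lemma seq_pos_min (R : realType) (T : eqType) (s : seq T) (Q : T -> R -> Prop) :
  (forall w, w \in s -> exists2 d : R, 0 < d & Q w d) ->
  (forall w d d', d' <= d -> Q w d -> Q w d') ->
  exists2 d : R, 0 < d & forall w, w \in s -> Q w d.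
Proof.
move=> H mono; elim: s => [|w s IH] in H *; first by exists 1.
have [d d0 dH] := H w (mem_head _ _).
have [|d' d'0 d'H] := IH; first by move=> v vs; apply: H; rewrite inE vs orbT.
exists (Num.min d d'); first by rewrite lt_min d0.
move=> v; rewrite inE => /orP[/eqP->|vs]; first by apply: mono dH; rewrite ge_min lexx.
by apply: mono (d'H _ vs); rewrite ge_min lexx orbT.
Qed.

(** The Bezout identity specialized at [t0] and divided by c(t0) makes P(t0, .) coprime to its
    derivative. *)
Lemma simple_roots (R : realType) (P u v : {poly {poly R[i]}}) (c : {poly R[i]})
    (t0 : R[i]) :
  u * P + v * P^`() = c%:P -> c.[t0] != 0 -> (lead_coef P).[t0] != 0 ->
  exists ws : seq R[i], [/\ uniq ws, size ws = (size P).-1 &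
    forall w, evalP P t0 w = 0 <-> w \in ws].
Proof.
move=> E c0 l0; pose Pt := map_poly (horner_eval t0) P.
have lPt : lead_coef Pt = (lead_coef P).[t0].
  by rewrite lead_coef_map_id0 /horner_eval ?horner0.
have [ws PtE] := closed_field_poly_normal Pt.
exists ws; split.
- have cop : coprimep Pt Pt^`().
    apply/Bezout_eq1_coprimepP.
    exists (c.[t0]^-1 *: map_poly (horner_eval t0) u,
            c.[t0]^-1 *: map_poly (horner_eval t0) v) => /=.
    rewrite -!scalerAl -scalerDr /Pt deriv_map -!rmorphM -rmorphD E /=.
    by rewrite map_polyC /= horner_evalE -mul_polyC -polyCM mulVf.
  rewrite -separable_prod_XsubC.
  have : separable_poly Pt by rewrite unlock.
  by apply: dvdp_separable; rewrite PtE dvdpZr ?lPt.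
- have := congr1 (fun p : {poly R[i]} => size p) PtE; rewrite size_scale ?lPt//.
  by rewrite size_prod_XsubC size_map_poly_id0// => ->.
- move=> w; rewrite evalPE -/Pt; split=> [/rootP|ww].
    by rewrite PtE rootZ ?lPt// root_prod_XsubC.
  by apply/rootP; rewrite PtE rootZ ?lPt// root_prod_XsubC.
Qed.

(* Each of the [deg P] disjoint discs around the roots at [t0] catches a root at
   [z], hence exactly one, and no root is left outside. *)
Lemma root_discs (R : realType) (P : {poly {poly R[i]}}) (t0 : R[i]) (ws : seq R[i]) (e : R) :
  (lead_coef P).[t0] != 0 -> uniq ws -> size ws = (size P).-1 ->
  (forall w, evalP P t0 w = 0 <-> w \in ws) -> 0 < e ->
  (forall w w', w \in ws -> w' \in ws -> w != w' -> 2 * e <= cabs (w - w')) ->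
  exists2 d : R, 0 < d & forall z, cabs (z - t0) < d ->
    [/\ (lead_coef P).[z] != 0,
        forall u, evalP P z u = 0 -> exists2 w, w \in ws & cabs (u - w) < e,
        forall w, w \in ws -> exists u, evalP P z u = 0 /\ cabs (u - w) < e &
        forall u u' w, w \in ws -> evalP P z u = 0 -> evalP P z u' = 0 ->
          cabs (u - w) < e -> cabs (u' - w) < e -> u = u'].
Proof.
move=> l0 uws sws wsP e0 sep.
have [d1 d10 H1] := ccont_neq0 (@horner_ccont _ (lead_coef P) t0) l0.
have [d2 d20 H2] : exists2 d : R, 0 < d & forall w, w \in ws ->
    forall z, cabs (z - t0) < d -> exists u, evalP P z u = 0 /\ cabs (u - w) < e.
  apply: (@seq_pos_min _ _ ws (fun w d => forall z, cabs (z - t0) < d ->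
    exists u, evalP P z u = 0 /\ cabs (u - w) < e)).
    by move=> w /wsP Pw; exact: roots_near l0 Pw e0.
  by move=> w d d' dd' H z zd; apply: H; exact: lt_le_trans dd'.
exists (Num.min d1 d2); first by rewrite lt_min d10.
move=> z; rewrite lt_min => /andP[/H1 lz z2].
have /choice [r rP] : forall w, exists u, w \in ws ->
    evalP P z u = 0 /\ cabs (u - w) < e.
  move=> w; have [ww|nw] := boolP (w \in ws); last by exists 0.
  by have [u' ?] := H2 w ww z z2; exists u'.
pose Pz := map_poly (horner_eval z) P.
have sPz : size Pz = size P by rewrite size_map_poly_id0.
have Pz0 : Pz != 0.
  by rewrite -lead_coef_eq0 lead_coef_map_id0 /horner_eval ?horner0.
have far w w' : w \in ws -> w' \in ws -> forall x, cabs (x - w) < e ->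
    cabs (x - w') < e -> w = w'.
  move=> ww ww' x xw xw'; apply/eqP/negPn/negP => /(sep _ _ ww ww').
  apply/negP; rewrite -ltNge; apply: le_lt_trans (cabs_distD x _ _) _.
  by rewrite cabsB; lra.
have rroot u' : evalP P z u' = 0 -> u' \in [seq r w | w <- ws].
  move=> Pu; apply/negPn/negP => nu.
  have := @max_poly_roots _ Pz (u' :: [seq r w | w <- ws]) Pz0.
  rewrite /= size_map sws sPz ltnNge.
  have -> : (size P <= (size P).-1.+1)%N by rewrite leqSpred.
  have -> : root Pz u' by apply/rootP; rewrite -evalPE.
  move=> H; suff : false by []; apply: H.
    by apply/allP => _ /mapP[w ww ->]; apply/rootP; rewrite -evalPE; have [] := rP w ww.
  rewrite nu /= map_inj_in_uniq// => w w' ww ww' rw.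
  by apply: (far w w' ww ww' (r w)); [|rewrite rw]; apply rP.
split=> //.
- by move=> u' /rroot/mapP[w ww ->]; exists w => //; apply rP.
- by move=> w ww; exists (r w); apply: rP.
move=> u1 u2 w ww /rroot/mapP[w1 ww1 ->] /rroot/mapP[w2 ww2 ->] h1 h2.
have -> : w1 = w by apply: (far _ _ ww1 ww (r w1)) => //; apply rP.
by have -> : w2 = w by apply: (far _ _ ww2 ww (r w2)) => //; apply rP.
Qed.

(** The second alternative is stated at every real t near [x0]: to remove [x0] from the support, the
    measure has to vanish on an interval. *)
Lemma branch_dichotomy (R : realType) (D : R[i] -> Prop) f P (c : {poly R[i]})
    (u v : {poly {poly R[i]}}) (x0 : R) :
  slit_domain D f -> min_annihilator D f P ->
  (forall z, D z -> D (conjc z) /\ f (conjc z) = conjc (f z)) ->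
  u * P + v * P^`() = c%:P -> c.[x0%:C] != 0 -> (lead_coef P).[x0%:C] != 0 ->
  exists2 d : R, 0 < d &
    (exists2 k : R, 0 < k & forall z, 0 < complex.Im z -> cabs (z - x0%:C) < d ->
       k <= `|complex.Im (f z)|) \/
    (forall t : R, `|t - x0| < d -> forall e : R, 0 < e -> exists2 d' : R, 0 < d' &
       forall z, 0 < complex.Im z -> cabs (z - t%:C) < d' ->
         `|complex.Im (f z)| < e).
Proof.
move=> sD mP fJ uv c0 l0; have [P0 Pf _ _] := mP; have [cf oD iD _] := sD.
have [ws [uws sws wsP]] := simple_roots uv c0 l0.
(* Discs of radius [e1] around nonreal roots stay away from the real axis; [e2] keeps the discs
   around distinct roots disjoint. *)
have [e1 e10 e1P] : exists2 e : R, 0 < e & forall w, w \in ws ->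
    complex.Im w != 0 -> 2 * e <= `|complex.Im w|.
  apply: (@seq_pos_min _ _ ws (fun w e => complex.Im w != 0 ->
     2 * e <= `|complex.Im w|)).
    move=> w _; have [->|w0] := eqVneq (complex.Im w) 0; first by exists 1.
    by exists (`|complex.Im w| / 2); rewrite ?divr_gt0 ?normr_gt0// mulrC divfK.
  by move=> w d d' dd' H /H; apply: le_trans; rewrite ler_pM2l.
have [e2 e20 e2P] : exists2 e : R, 0 < e & forall w, w \in ws ->
    forall w', w' \in ws -> w != w' -> 2 * e <= cabs (w - w').
  apply: (@seq_pos_min _ _ ws (fun w e => forall w', w' \in ws -> w != w' ->
     2 * e <= cabs (w - w'))).
    move=> w _; apply: (@seq_pos_min _ _ ws (fun w' e => w != w' ->
     2 * e <= cabs (w - w'))).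
      move=> w' _; have [->|w0] := eqVneq w w'; first by exists 1.
      exists (cabs (w - w') / 2); rewrite ?divr_gt0 ?cabs_gt0 ?subr_eq0//.
      by rewrite mulrC divfK.
    by move=> w' d d' dd' H /H; apply: le_trans; rewrite ler_pM2l.
  by move=> w d d' dd' H w' ? /H; move=> h; apply: le_trans (h _) => //; rewrite ler_pM2l.
pose e := Num.min e1 e2.
have e0 : 0 < e by rewrite lt_min e10.
have sep w w' : w \in ws -> w' \in ws -> w != w' -> 2 * e <= cabs (w - w').
  move=> ww ww' n; apply: le_trans (e2P w ww w' ww' n).
  by rewrite ler_pM2l// /e ge_min lexx orbT.
have [d d0 dP] := root_discs l0 uws sws wsP e0 sep.
exists d => //.
(* the half disc is connected, so [f] follows one root *)
have stay w z : w \in ws -> 0 < complex.Im z -> cabs (z - x0%:C) < d ->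
    cabs (f z - w) < e -> forall z', 0 < complex.Im z' -> cabs (z' - x0%:C) < d ->
    cabs (f z' - w) < e.
  move=> ww z0 zd zw z' z'0 z'd.
  pose g (t : R) := z + t%:C * (z' - z).
  have gI t : 0 <= t <= 1 -> 0 < complex.Im (g t).
    move=> /andP[t0 t1]; have -> : complex.Im (g t) =
      (1 - t) * complex.Im z + t * complex.Im z'.
      by rewrite /g; case: (z) (z') => a b [a' b'] /=; simpc; rewrite /=; ring.
    have [->|tn0] := eqVneq t 0; first by rewrite subr0 mul1r mul0r addr0.
    by rewrite ltr_wpDl ?mulr_ge0 ?mulr_gt0// ?(ltW z0) ?lt0r ?tn0//; lra.
  have gd t : 0 <= t <= 1 -> cabs (g t - x0%:C) < d.
    move=> /andP[t0 t1]; have -> : g t - x0%:C =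
        (1 - t)%:C * (z - x0%:C) + t%:C * (z' - x0%:C).
      by rewrite /g rmorphB rmorph1; ring.
    apply: le_lt_trans (cabsD _ _) _; rewrite !cabsM !cabs_real.
    rewrite !ger0_norm ?subr_ge0//.
    have h1 : (1 - t) * cabs (z - x0%:C) <= (1 - t) * Num.max (cabs (z - x0%:C)) (cabs (z' - x0%:C)).
      by rewrite ler_wpM2l ?subr_ge0// le_max lexx.
    have h2 : t * cabs (z' - x0%:C) <= t * Num.max (cabs (z - x0%:C)) (cabs (z' - x0%:C)).
      by rewrite ler_wpM2l// le_max lexx orbT.
    have h3 : Num.max (cabs (z - x0%:C)) (cabs (z' - x0%:C)) < d by rewrite gt_max zd.
    by move: (Num.max _ _) h1 h2 h3 => m; nra.
  pose p (t : R) : Prop := cabs (f (g t) - w) < e.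
  have : p 0 <-> p 1.
    apply: locally_constant_itv => // t t01.
    have Dg : D (g t) by apply: iD; rewrite gt_eqF// gI.
    have [_ rt _ _] := dP _ (gd _ t01); have [w' ww' fw'] := rt _ (Pf _ Dg).
    have e3 : 0 < e - cabs (f (g t) - w') by rewrite subr_gt0.
    have [r r0 rH] := cf _ Dg _ e3.
    have K0 : 0 < cabs (z' - z) + 1 by have := cabs_ge0 (z' - z); lra.
    exists (r / (cabs (z' - z) + 1)); first by rewrite divr_gt0.
    move=> s s01; rewrite ltr_pdivlMr// => st.
    have fs : cabs (f (g s) - w') < e.
      apply: le_lt_trans (cabs_distD (f (g t)) _ _) _; rewrite -ltrBrDr.
      apply: rH; rewrite /g opprD addrACA subrr add0r -mulrBl -rmorphB cabsM cabs_real.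
      by apply: le_lt_trans st; rewrite ler_wpM2l//; lra.
    have same x : cabs (x - w') < e -> cabs (x - w) < e -> w' = w.
      move=> xw' xw; apply/eqP/negPn/negP => n; have := e2P _ ww' _ ww n.
      apply/negP; rewrite -ltNge; apply: le_lt_trans (cabs_distD x _ _) _.
      by have : e <= e2; [by rewrite /e ge_min lexx orbT|rewrite cabsB; lra].
    by split=> [h|h]; rewrite /p -(same _ _ h).
  rewrite /p /g mul0r addr0 mul1r addrCA subrr addr0 => <- //.
pose z1 : R[i] := x0 +i* (d / 2).
have z10 : 0 < complex.Im z1 by rewrite /= divr_gt0.
have z1d : cabs (z1 - x0%:C) < d.
  rewrite /z1 /real_complex_def cabsE /= subr0 subrr expr0n add0r sqrtr_sqr.
  by rewrite ger0_norm; lra.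
have Dz1 : D z1 by apply: iD; rewrite gt_eqF.
have [_ rt _ _] := dP _ z1d; have [w ww fw] := rt _ (Pf _ Dz1).
have inw := stay _ _ ww z10 z1d fw.
have [w0|w0] := eqVneq (complex.Im w) 0; last first.
  left; exists e => // z z0 zd; have := inw _ z0 zd => zw.
  have := e1P _ ww w0; have : e <= e1 by rewrite /e ge_min lexx.
  have := Im_le_cabs (f z - w); rewrite ImB.
  have := ler_normB (complex.Im (f z)) (complex.Im (f z) - complex.Im w).
  by rewrite opprB addrC subrK; lra.
right=> t td e' e'0.
have td' : cabs (t%:C - x0%:C) < d by rewrite -rmorphB cabs_real.
(* The centre [w] is real, so the conjugate of the root [r] at [t] lies in the same disc; since the
   disc holds one root only, [r] is real. *)
have [lt _ /(_ _ ww)[r [Pr rw]] uniqt] := dP _ td'.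
have rJ : conjc r = r.
  apply: (uniqt _ _ w) => //; first exact: (conj_roots sD mP fJ lt Pr).
  by rewrite -(conjcK w) -rmorphB cabsJ; move: rw; case: (w) w0 => a b /= ->; rewrite oppr0.
have e4 : 0 < Num.min e' (e - cabs (r - w)) by rewrite lt_min e'0 subr_gt0.
have [d4 d40 d4H] := roots_near lt Pr e4.
exists (Num.min d4 (d - `|t - x0|)); first by rewrite lt_min d40 subr_gt0.
move=> z z0; rewrite lt_min => /andP[/d4H[r' [Pr' +]] zt].
rewrite lt_min => /andP[r'e' r'e].
have zd : cabs (z - x0%:C) < d.
  apply: le_lt_trans (cabs_distD t%:C _ _) _.
  by rewrite -rmorphB cabs_real; lra.
have [_ _ _ uniqz] := dP _ zd.
have Dz : D z by apply: iD; rewrite gt_eqF.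
have -> : f z = r'.
  apply: (uniqz _ _ w) => //; [exact: Pf|exact: inw|].
  by apply: le_lt_trans (cabs_distD r _ _) _; lra.
have r0 : complex.Im r = 0.
  by move: rJ; case: (r) => a b [] /= /eqP; rewrite eqNr => /eqP.
by apply: le_lt_trans r'e'; apply: le_trans (Im_le_cabs _); rewrite ImB r0 subr0.
Qed.

(** * Harmonicity and a maximum principle with exceptional points *)

Definition second_deriv (R : realType) (g : R -> R) (t c : R) :=
  exists (g1 : R -> R) (d : R), [/\ 0 < d,
    forall s, `|s - t| < d -> is_derive s 1 g (g1 s) & is_derive t 1 g1 c].

Lemma second_derivD (R : realType) (g h : R -> R) t c c' :
  second_deriv g t c -> second_deriv h t c' ->
  second_deriv (fun s => g s + h s) t (c + c').
Proof.
move=> [g1 [d [d0 dg dg1]]] [h1 [d' [d'0 dh dh1]]].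
exists (fun s => g1 s + h1 s), (Num.min d d'); split.
- by rewrite lt_min d0.
- move=> s; rewrite lt_min => /andP[/dg ? /dh ?]; exact: is_deriveD.
- exact: is_deriveD.
Qed.

Lemma second_derivZ (R : realType) (g : R -> R) t c k :
  second_deriv g t c -> second_deriv (fun s => k * g s) t (k * c).
Proof.
move=> [g1 [d [d0 dg dg1]]].
exists (fun s => k * g1 s), d; split => //.
- by move=> s /dg ?; exact: is_deriveZ.
- exact: is_deriveZ.
Qed.

Lemma second_deriv_cst (R : realType) (k t : R) : second_deriv (fun=> k) t 0.
Proof.
by exists (fun=> 0), 1; split => // [s _|]; exact: is_derive_cst.
Qed.

Lemma second_deriv_sqr (R : realType) (t : R) :
  second_deriv (fun s => s ^+ 2) t 2.
Proof.
exists (fun s => 2 * s), 1; split => // [s _|].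
  by apply: is_derive_eq; rewrite /GRing.scale /= !mulr1; ring.
by apply: is_derive_eq; rewrite /GRing.scale /= ; ring.
Qed.

Lemma is_derive_real (R : realType) (g : R -> R) (t c : R) :
  is_derive t 1 g c ->
  forall e : R, 0 < e -> exists2 d : R, 0 < d &
    forall h, `|h| < d -> `|g (t + h) - g t - c * h| <= e * `|h|.
Proof.
move=> dg e e0; have [dg1 dgE] := dg.
have := @cvgr_dist_le R R^o _ _ _ _ ('D_1 g t) dg1 e e0.
rewrite dgE /= => /(_ _) H; have [d /= d0 dH] := (nbhs_ballP _ _).1 H.
exists d => // h hd; have [->|h0] := eqVneq h 0.
  by rewrite addr0 subrr mulr0 subrr normr0 mulr0.
have : ball 0 d h by rewrite -ball_normE /ball_ /= sub0r normrN.
move/dH => /(_ h0); rewrite /GRing.scale /= mulr1 => K.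
have -> : g (t + h) - g t - c * h = - (h * (c - h^-1 * (g (h + t) - g t))).
  by rewrite (addrC t); field.
by rewrite normrN normrM mulrC ler_wpM2r.
Qed.

Lemma mean_value (R : realType) (g g1 : R -> R) (a b : R) : a < b ->
  (forall s, a <= s <= b -> is_derive s 1 g (g1 s)) ->
  exists2 c, a < c < b & g b - g a = g1 c * (b - a).
Proof.
move=> ab dg; have [|| c cab ->] := @MVT _ g g1 a b ab.
- by move=> s; rewrite in_itv /= => /andP[/ltW as_ /ltW sb]; apply: dg; rewrite as_.
- apply: derivable_within_continuous => s; rewrite in_itv /= => /dg ?.
  exact: ex_derive.
- by exists c => //; rewrite in_itv /= in cab.
Qed.

(** If c > 0, the derivative [g1], zero at t, is positive just to the right of t, and the mean value
    theorem gives a value above the maximum. *)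
Lemma second_deriv_max (R : realType) (g : R -> R) (t c d : R) : 0 < d ->
  (forall s, `|s - t| < d -> g s <= g t) -> second_deriv g t c -> c <= 0.
Proof.
move=> d0 gmax [g1 [d' [d'0 dg dg1]]]; rewrite leNgt; apply/negP => c0.
set D := Num.min d d'.
have D0 : 0 < D by rewrite lt_min d0.
have tt : `|t - t| < d' by rewrite subrr normr0.
have near s : s \in `](t - D), (t + D)[ -> `|s - t| < d /\ `|s - t| < d'.
  rewrite in_itv /= => /andP[s1 s2]; apply/andP; rewrite -lt_min -/D.
  by rewrite ltr_norml; apply/andP; split; lra.
have g1t : g1 t = 0.
  have dgt := dg t tt.
  have H : is_derive t 1 g 0.
    apply: (@derive1_at_max _ g (t - D) (t + D)) => [|s sD||s /near[/gmax]//].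
    - lra.
    - by have [_ /dg ?] := near s sD; exact: ex_derive.
    - by rewrite in_itv /=; apply/andP; split; lra.
  by rewrite -(@derive_val _ _ _ _ _ _ _ dgt) (@derive_val _ _ _ _ _ _ _ H).
have [d2 d20 d2H] := is_derive_real dg1 (divr_gt0 c0 (@ltr0Sn R 1)).
set D2 := Num.min D d2.
have D20 : 0 < D2 by rewrite lt_min D0.
have D2D : D2 <= D by rewrite /D2 ge_min lexx.
have D2d2 : D2 <= d2 by rewrite /D2 ge_min lexx orbT.
have [|s|s /andP[ts st] E] := @mean_value _ g g1 t (t + D2 / 2); first lra.
  move=> /andP[ts st]; apply: dg; have [] := near s => //.
  by rewrite in_itv /=; apply/andP; split; lra.
have : g (t + D2 / 2) <= g t.
  apply: gmax; have [] := near (t + D2 / 2) => //.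
  by rewrite in_itv /=; apply/andP; split; lra.
have := d2H (s - t); rewrite [t + _]addrC subrK g1t subr0 gtr0_norm ?subr_gt0//.
have sd : s - t < d2 by lra.
move=> /(_ sd); rewrite ler_norml => /andP[H _].
have : 0 < g1 s * (t + D2 / 2 - t) by apply: mulr_gt0; nra.
by rewrite -E; lra.
Qed.

(** Only the two pure second derivatives at the point, with sum zero: this is all that the maximum
    principle looks at. *)
Definition harmonic_at (R : realType) (h : R -> R -> R) (x y : R) :=
  exists2 c, second_deriv (fun s => h s y) x c & second_deriv (h x) y (- c).

Lemma harmonicD (R : realType) (g h : R -> R -> R) x y :
  harmonic_at g x y -> harmonic_at h x y ->
  harmonic_at (fun x y => g x y + h x y) x y.
Proof.
move=> [c gx gy] [c' hx hy]; exists (c + c'); first exact: second_derivD.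
by rewrite opprD; exact: second_derivD.
Qed.

Lemma harmonicZ (R : realType) (g : R -> R -> R) x y k :
  harmonic_at g x y -> harmonic_at (fun x y => k * g x y) x y.
Proof.
move=> [c gx gy]; exists (k * c); first exact: second_derivZ.
by rewrite -mulrN; exact: second_derivZ.
Qed.

Lemma harmonic_cst (R : realType) (k x y : R) : harmonic_at (fun _ _ => k) x y.
Proof. by exists 0; rewrite ?oppr0; exact: second_deriv_cst. Qed.

Lemma harmonic_sum (R : realType) (I : eqType) (s : seq I) (g : I -> R -> R -> R) x y :
  (forall i, i \in s -> harmonic_at (g i) x y) ->
  harmonic_at (fun x y => \sum_(i <- s) g i x y) x y.
Proof.
elim: s => [|i s IH] gh.
  by under eq2_fun do rewrite big_nil; exact: harmonic_cst.
under eq2_fun do rewrite big_cons; apply: harmonicD; first exact: gh (mem_head _ _).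
by apply: IH => j js; apply: gh; rewrite inE js orbT.
Qed.

Lemma continuous_sum (R : realType) (T : topologicalType) (I : Type) (s : seq I)
    (F : I -> T -> R) (p : T) :
  (forall i, {for p, continuous (F i)}) ->
  {for p, continuous (fun x => \sum_(i <- s) F i x)}.
Proof.
move=> Fc; elim: s => [|i s IH].
  have -> : (fun x => \sum_(i <- [::]) F i x) = fun=> 0.
    by apply/funext => x; rewrite big_nil.
  exact: cst_continuous.
have -> : (fun x => \sum_(j <- i :: s) F j x) =
    (fun x => F i x + \sum_(j <- s) F j x).
  by apply/funext => x; rewrite big_cons.
exact: continuousD.
Qed.

(** The angle at (x, y) between the downward vertical and the direction of (a, 0): an argument
    function up to sign and constant. *)
Lemma harmonic_atan (R : realType) (a x y : R) : 0 < y ->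
  harmonic_at (fun x y => atan ((a - x) / y)) x y.
Proof.
move=> y0.
have q0 (s t : R) : 0 < t -> 0 < t ^+ 2 + (a - s) ^+ 2.
  by move=> t0; rewrite ltr_wpDr ?sqr_ge0// exprn_gt0.
have h0 (s t : R) : 0 < t -> 1 + ((a - s) / t) ^+ 2 = (t ^+ 2 + (a - s) ^+ 2) / t ^+ 2.
  by move=> t0; field; rewrite gt_eqF.
exists (- 2 * y * (a - x) / (y ^+ 2 + (a - x) ^+ 2) ^+ 2).
  exists (fun s => - y / (y ^+ 2 + (a - s) ^+ 2)), 1; split; first exact: ltr01.
    move=> s _; have dl : is_derive s 1 (fun s => (a - s) / y) (- y^-1).
      by apply: is_derive_eq; rewrite /GRing.scale /=; ring.
    have := @is_derive1_comp _ (@atan R) _ _ _ _ (is_derive1_atan _) dl.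
    move/is_derive_eq; apply; rewrite h0// .
    by have := q0 s y y0 => /lt0r_neq0 q; field; rewrite q gt_eqF.
  have dl : is_derive x 1 (fun s => y ^+ 2 + (a - s) ^+ 2) (- 2 * (a - x)).
    by apply: is_derive_eq; rewrite /GRing.scale /=; ring.
  have qn := lt0r_neq0 (q0 x y y0).
  have dV := @is_deriveV _ (fun s => y ^+ 2 + (a - s) ^+ 2) _ _ _ qn dl.
  have := @is_deriveZ _ _ _ _ (- y) _ _ _ dV.
  move/is_derive_eq; apply; rewrite /GRing.scale /=; by field.
exists (fun t => - (a - x) / (t ^+ 2 + (a - x) ^+ 2)), y; split; first exact: y0.
  move=> t ty; have t0 : 0 < t by move: ty; rewrite ltr_norml => /andP[]; lra.
  have dl : is_derive t 1 (fun t => (a - x) / t) (- (a - x) / t ^+ 2).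
    have dV := @is_deriveV R id t 1 1 (lt0r_neq0 t0) (is_derive_id _ _).
    have := @is_deriveZ _ _ _ _ (a - x) _ _ _ dV.
    by move/is_derive_eq; apply; rewrite /GRing.scale /=; field; rewrite gt_eqF.
  have := @is_derive1_comp _ (@atan R) _ _ _ _ (is_derive1_atan _) dl.
  move/is_derive_eq; apply; rewrite h0//.
  by have := q0 x t t0 => /lt0r_neq0 q; field; rewrite q gt_eqF.
have dl : is_derive y 1 (fun t => t ^+ 2 + (a - x) ^+ 2) (2 * y).
  by apply: is_derive_eq; rewrite /GRing.scale /=; ring.
have qn := lt0r_neq0 (q0 x y y0).
have dV := @is_deriveV _ (fun t => t ^+ 2 + (a - x) ^+ 2) _ _ _ qn dl.
have := @is_deriveZ _ _ _ _ (- (a - x)) _ _ _ dV.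
by move/is_derive_eq; apply; rewrite /GRing.scale /=; field.
Qed.

Lemma harmonic_ln (R : realType) (a b x y : R) : (x, y) != (a, b) ->
  harmonic_at (fun x y => ln ((x - a) ^+ 2 + (y - b) ^+ 2)) x y.
Proof.
move=> xyab; pose q (s t : R) := (s - a) ^+ 2 + (t - b) ^+ 2.
have q0 : 0 < q x y.
  rewrite lt0r addr_ge0 ?sqr_ge0// andbT paddr_eq0 ?sqr_ge0// !sqrf_eq0 !subr_eq0.
  by apply: contra xyab => /andP[/eqP -> /eqP ->].
have dx (s t : R) : is_derive s 1 (fun s => q s t) (2 * (s - a)).
  by apply: is_derive_eq; rewrite /GRing.scale /=; ring.
have dy (s t : R) : is_derive t 1 (fun t => q s t) (2 * (t - b)).
  by apply: is_derive_eq; rewrite /GRing.scale /=; ring.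
have pos (g : R -> R) (t dg : R) : is_derive t 1 g dg -> 0 < g t ->
    exists2 d : R, 0 < d & forall s, `|s - t| < d -> 0 < g s.
  move=> hg gt0; have K0 : 0 < `|dg| + 1 by have := normr_ge0 dg; lra.
  have [d d0 dH] := is_derive_real hg ltr01.
  exists (Num.min d (g t / (`|dg| + 1))); first by rewrite lt_min d0 divr_gt0.
  move=> s; rewrite lt_min ltr_pdivlMr// => /andP[/dH H1 H2].
  move: H1; rewrite [t + _]addrC subrK mul1r ler_norml => /andP[H1 _].
  have : `|dg * (s - t)| = `|dg| * `|s - t| by rewrite normrM.
  have := ler_norm (- (dg * (s - t))); rewrite normrN; nra.
have qn := lt0r_neq0 q0.
have second (g g1 : R -> R) (t c : R) : (forall s : R, is_derive s 1 g (g1 s)) ->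
    0 < g t -> is_derive t 1 g1 c ->
    second_deriv (fun s => ln (g s)) t (c / g t - (g1 t) ^+ 2 / g t ^+ 2).
  move=> dg gt0 dg1; have [d d0 dH] := pos _ _ _ (dg t) gt0.
  exists (fun s => (g s)^-1 * g1 s), d; split; first exact: d0.
    move=> s /dH gs0.
    exact: (@is_derive1_comp _ (@ln R) g _ _ _ (is_derive1_ln gs0) (dg s)).
  have dV := @is_deriveV _ g _ _ _ (lt0r_neq0 gt0) (dg t).
  have := @is_deriveM _ _ _ _ _ _ _ _ dV dg1.
  move/is_derive_eq; apply; rewrite /GRing.scale /=.
  by field; rewrite gt_eqF.
have d2 (s t : R) : is_derive s 1 (fun s => 2 * (s - t)) 2.
  by apply: is_derive_eq; rewrite /GRing.scale /=; ring.
exists (2 / q x y - (2 * (x - a)) ^+ 2 / q x y ^+ 2).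
  exact: (second (fun s => q s y) (fun s => 2 * (s - a))).
have := second (fun t => q x t) (fun s => 2 * (s - b)) y 2 (dy x) q0 (d2 _ _).
congr second_deriv; apply/eqP; rewrite -subr_eq0 opprK; apply/eqP.
by move: qn; rewrite /q => qn; field.
Qed.

Lemma continuous_dist_sqr (R : realType) (s p : R * R) :
  {for p, continuous (fun p : R * R => (p.1 - s.1) ^+ 2 + (p.2 - s.2) ^+ 2)}.
Proof.
have c1 : {for p, continuous (fun p : R * R => p.1 - s.1)}.
  by apply: cvgB; [exact: cvg_fst|exact: cvg_cst].
have c2 : {for p, continuous (fun p : R * R => p.2 - s.2)}.
  by apply: cvgB; [exact: cvg_snd|exact: cvg_cst].
exact: (continuousD (continuousM c1 c1) (continuousM c2 c2)).
Qed.

(* Near the points of [X], [h] is only continuous: logarithmic penalties keep the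
   maximum away from them, and [k * x ^+ 2] makes the Laplacian positive. *)
Lemma max_principle (R : realType) (h : R -> R -> R) (X : seq (R * R))
    (m L a b : R) :
  (forall p : R * R, -L <= p.1 <= L -> a <= p.2 <= b ->
     {for p, continuous (fun p : R * R => h p.1 p.2)}) ->
  (forall x y, -L < x < L -> a < y < b -> (x, y) \notin X -> harmonic_at h x y) ->
  (forall x y, -L <= x <= L -> a <= y <= b ->
     (x == - L) || (x == L) || (y == a) || (y == b) -> h x y <= m) ->
  forall x y, -L <= x <= L -> a <= y <= b -> (x, y) \notin X -> h x y <= m.
Proof.
move=> hc hh hb x0 y0 x0L y0ab xyX; rewrite leNgt; apply/negP => hm.
set e := h x0 y0 - m; have e0 : 0 < e by rewrite subr_gt0.
have L0 : 0 <= L by move: x0L => /andP[? ?]; lra.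
(* Budget: the quadratic term adds at most e / 4 on the box, and by the choice of [l] the penalties
   cost at most e / 4 at (x0, y0). A maximum of [G] then has [h] at least m + e / 2, so it lies off
   the boundary. *)
pose k := e / 4 / (L ^+ 2 + 1).
have L20 : 0 < L ^+ 2 + 1 by have := sqr_ge0 L; lra.
have k0 : 0 < k by rewrite /k !divr_gt0.
have kL x : -L <= x <= L -> k * x ^+ 2 <= e / 4.
  move=> xL; rewrite /k -mulrA ler_piMr ?divr_ge0 ?(ltW e0)// mulrC ler_pdivrMr// mul1r.
  have : x ^+ 2 <= L ^+ 2 by rewrite -[x ^+ 2]real_normK ?num_real// lerXn2r ?nnegrE// ler_norml.
  by lra.
pose q (p : R * R) x y := (x - p.1) ^+ 2 + (y - p.2) ^+ 2.
have q0 p x y : (x, y) \notin X -> p \in X -> 0 < q p x y.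
  move=> nX pX; rewrite lt0r addr_ge0 ?sqr_ge0// andbT paddr_eq0 ?sqr_ge0//.
  rewrite !sqrf_eq0 !subr_eq0; apply: contra nX => /andP[/eqP -> /eqP ->].
  by case: (p) pX.
(* [Q p] dominates the squared distance to [p] on the box, so that every penalty is nonpositive. *)
pose Q (p : R * R) := (L + `|p.1|) ^+ 2 + (`|a| + `|b| + `|p.2|) ^+ 2 + 1.
have Q0 p : 0 < Q p.
  by rewrite /Q; have := sqr_ge0 (L + `|p.1|); have := sqr_ge0 (`|a| + `|b| + `|p.2|); lra.
have qQ p x y : -L <= x <= L -> a <= y <= b -> q p x y / Q p <= 1.
  move=> /andP[x1 x2] /andP[y1 y2]; rewrite ler_pdivrMr// mul1r /q /Q.
  have sq (s t : R) : `|s| <= t -> s ^+ 2 <= t ^+ 2.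
    by move=> st; rewrite -[s ^+ 2]real_normK ?num_real// lerXn2r// ?nnegrE// (le_trans _ st).
  have h1 : `|x - p.1| <= L + `|p.1|.
    by rewrite (le_trans (ler_normB _ _))// lerD2r ler_norml x1.
  have h2 : `|y - p.2| <= `|a| + `|b| + `|p.2|.
    rewrite (le_trans (ler_normB _ _))// lerD2r ler_norml.
    have := ler_norm b; have := ler_norm (- a); rewrite normrN; have := normr_ge0 a; have := normr_ge0 b.
    by move=> *; apply/andP; split; lra.
  by have := sq _ _ h1; have := sq _ _ h2; lra.
pose S := \sum_(p <- X) `|ln (q p x0 y0 / Q p)|.
have S0 : 0 <= S by apply: sumr_ge0.
pose l := e / 4 / (S + 1).
have l0 : 0 < l by rewrite /l !divr_gt0//; lra.
have box_comp : compact (`[- L, L]%classic `*` `[a, b]%classic : set (R * R)).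
  by apply: compact_setX; exact: segment_compact.
have box0 : (`[- L, L]%classic `*` `[a, b]%classic : set (R * R)) !=set0.
  by exists (x0, y0); split; rewrite /= in_itv.
have inbox (p : R * R) : p \in (`[- L, L]%classic `*` `[a, b]%classic : set (R * R)) ->
    (-L <= p.1 <= L) /\ (a <= p.2 <= b).
  by rewrite inE => -[] /=; rewrite !in_itv.
have [pM pMbox pMmax] := @compact_EVT_max _ _ (fun p : R * R => h p.1 p.2) _ box0
  box_comp (continuous_in_subspaceT (fun p pb => hc p (inbox p pb).1 (inbox p pb).2)).
set H := h pM.1 pM.2 in pMmax.
have hH x y : -L <= x <= L -> a <= y <= b -> h x y <= H.
  by move=> xL yab; apply: (pMmax (x, y)); rewrite inE; split; rewrite /= in_itv.
have mH : m < H by apply: lt_le_trans hm (hH _ _ x0L y0ab).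
(* Truncating the logarithm at - T keeps [G] continuous on the points of [X]. As l T = H - m, a
   single truncated penalty lowers [G] to m + e / 4 at most, so no truncation occurs at the
   maximum. *)
pose T := (H - m) / l.
have T0 : 0 < T by rewrite divr_gt0// subr_gt0.
pose lt p x y := ln (Num.max (q p x y / Q p) (expR (- T))).
pose G x y := h x y + k * x ^+ 2 + l * \sum_(p <- X) lt p x y.
have lt_le0 p x y : -L <= x <= L -> a <= y <= b -> lt p x y <= 0.
  move=> xL yab; rewrite /lt ln_le0// ge_max qQ//= -[leRHS]expR0 ler_expR; lra.
have qc s (p : R * R) : {for p, continuous (fun p : R * R => q s p.1 p.2 / Q s)}.
  by apply: continuousM; [exact: continuous_dist_sqr|exact: cst_continuous].
have Gc (p : R * R) : -L <= p.1 <= L -> a <= p.2 <= b ->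
    {for p, continuous (fun p : R * R => G p.1 p.2)}.
  move=> pL pab; rewrite /G.
  have c1 : {for p, continuous (fun p : R * R => p.1)} by exact: cvg_fst.
  have c2 : {for p, continuous (fun p : R * R => p.2)} by exact: cvg_snd.
  apply: (@continuousD _ _ _ (fun p : R * R => h p.1 p.2 + k * p.1 ^+ 2)
     (fun p : R * R => l * \sum_(p0 <- X) lt p0 p.1 p.2)).
    apply: (@continuousD _ _ _ (fun p : R * R => h p.1 p.2)); first exact: hc.
    apply: (@continuousM _ _ (fun=> k)); first exact: cst_continuous.
    by apply: (@continuousM _ _ (fun p : R * R => p.1)).
  apply: (@continuousM _ _ (fun=> l)); first exact: cst_continuous.
  apply: (@continuous_sum _ _ _ X (fun s (p : R * R) => lt s p.1 p.2)) => s.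
  rewrite /lt; apply: (@continuous_comp _ _ _ (fun p : R * R =>
     Num.max (q s p.1 p.2 / Q s) (expR (- T))) (@ln R)); last first.
    by apply: continuous_ln; rewrite lt_max expR_gt0 orbT.
  by apply: continuous_max; [exact: qc|exact: cst_continuous].
have [[xc yc] /inbox/= [xcL ycab] Gmax] := @compact_EVT_max _ _ (fun p : R * R => G p.1 p.2) _ box0
  box_comp (continuous_in_subspaceT (fun p pb => Gc p (inbox p pb).1 (inbox p pb).2)).
have sumlt0 x y : -L <= x <= L -> a <= y <= b -> l * \sum_(p <- X) lt p x y <= 0.
  move=> xL yab; rewrite mulr_ge0_le0 ?(ltW l0)//.
  by apply: sumr_le0 => p _; exact: lt_le0.
have G0 : m + e - e / 4 <= G x0 y0.
  rewrite /G; have : - (e / 4) <= l * \sum_(p <- X) lt p x0 y0.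
    rewrite lerNl -mulrN (@le_trans _ _ (l * S))//.
      rewrite ler_pM2l// -sumrN /S big_seq [X in _ <= X]big_seq.
      apply: ler_sum => p pX.
      have : ln (q p x0 y0 / Q p) <= lt p x0 y0.
        by rewrite /lt ler_ln ?posrE ?lt_max ?expR_gt0 ?orbT ?divr_gt0 ?q0// le_max lexx.
      by have := ler_norm (- ln (q p x0 y0 / Q p)); rewrite normrN; clear; lra.
    have S10 : 0 < S + 1 by clear -S0; lra.
    by rewrite /l mulrAC ler_pdivrMr ?ler_pM2l ?divr_gt0//; clear; lra.
  have : 0 <= k * x0 ^+ 2 by rewrite mulr_ge0 ?sqr_ge0// ltW.
  by rewrite /e; clear; lra.
have Gc0 : G x0 y0 <= G xc yc.
  by apply: (Gmax (x0, y0)); rewrite inE; split; rewrite /= in_itv.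
have hc3 : m + e / 2 <= h xc yc.
  have := sumlt0 _ _ xcL ycab; have := kL _ xcL; rewrite /G in G0 Gc0; clear -G0 Gc0; lra.
have nb : ~~ [|| xc == - L, xc == L, yc == a | yc == b].
  by apply/negP; rewrite !orbA => /(hb _ _ xcL ycab); clear -hc3 e0; lra.
have {nb} [xcL' ycab'] : -L < xc < L /\ a < yc < b.
  move: nb; rewrite !negb_or => /and4P[n1 n2 n3 n4].
  move: xcL ycab => /andP[? ?] /andP[? ?].
  by split; apply/andP; split; rewrite lt_neqAle ?n2 ?n4 ?andbT// eq_sym ?n1 ?n3.
have big p : p \in X -> expR (- T) < q p xc yc / Q p.
  move=> pX; rewrite ltNge; apply/negP => qT.
  have : l * \sum_(p <- X) lt p xc yc <= - (H - m).
    rewrite (big_rem _ pX)/= mulrDr.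
    have -> : lt p xc yc = - T by rewrite /lt max_r// expRK.
    have : l * \sum_(y <- rem p X) lt y xc yc <= 0.
      rewrite mulr_ge0_le0 ?(ltW l0)//.
      by apply: sumr_le0 => ? _; exact: lt_le0.
    have : l * - T = - (H - m) by rewrite /T; field; rewrite gt_eqF.
    by clear; lra.
  have := kL _ xcL; have := hH _ _ xcL ycab; rewrite /G in G0 Gc0; clear -G0 Gc0 e0; lra.
have cX : (xc, yc) \notin X.
  apply/negP => /big /=; rewrite /q /= !subrr expr0n /= add0r mul0r.
  by rewrite ltNge expR_ge0.
(* near the maximum the truncation is inactive *)
pose G' x y := h x y + k * x ^+ 2 + \sum_(p <- X) l * (ln (q p x y) - ln (Q p)).
have near : exists2 d : R, 0 < d & forall x y, `|x - xc| < d -> `|y - yc| < d ->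
    [/\ -L <= x <= L, a <= y <= b & G x y = G' x y].
  have : nbhs ((xc, yc) : R * R)
      [set z : R * R | forall p, p \in X -> expR (- T) < q p z.1 z.2 / Q p].
    elim: (X) big => [|p X' IH] big; first by apply: filterE => z p; rewrite in_nil.
    have pX : p \in p :: X' by rewrite mem_head.
    have := cvgr_gt _ (qc p (xc, yc)) _ (big p pX).
    have := IH (fun s sX => big s ltac:(by rewrite inE sX orbT)).
    move=> h1 /(_ (nbhs_filter _)) h2; apply: filterS2 h1 h2 => z h1 h2 s.
    by rewrite inE => /orP[/eqP -> //|]; exact: h1.
  move=> /nbhs_ballP[d /= d0 dH].
  have mpos (s t u v : R) : s < t -> u < v -> 0 < Num.min (t - s) (v - u).
    by move=> st uv; rewrite lt_min !subr_gt0 st uv.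
  move: xcL' ycab' => /andP[x1 x2] /andP[y1 y2].
  exists (Num.min d (Num.min (Num.min (xc - - L) (L - xc)) (Num.min (yc - a) (b - yc)))).
    by rewrite lt_min d0 lt_min !mpos.
  move=> x y; rewrite !lt_min => /andP[xd /andP[/andP[xl1 xl2] _]].
  move=> /andP[yd /andP[_ /andP[yl1 yl2]]].
  split.
  - move: xl1 xl2; rewrite !ltr_norml => /andP[u1 _] /andP[_ u2].
    by apply/andP; split; clear -u1 u2; lra.
  - move: yl1 yl2; rewrite !ltr_norml => /andP[u1 _] /andP[_ u2].
    by apply/andP; split; clear -u1 u2; lra.
  rewrite /G /G' mulr_sumr; congr (_ + _); apply: eq_big_seq => p pX.
  have /(_ p pX) /= qT : forall p, p \in X -> expR (- T) < q p x y / Q p.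
    by apply: (dH (x, y)); split; rewrite -ball_normE /ball_ /= distrC.
  rewrite /lt max_l ?(ltW qT)// ln_div// posrE//.
  by rewrite -[q p x y](divfK (lt0r_neq0 (Q0 p))) mulr_gt0// (lt_trans (expR_gt0 _) qT).
have [d d0 dH] := near.
have [_ _ GcE] : [/\ -L <= xc <= L, a <= yc <= b & G xc yc = G' xc yc].
  by apply: dH; rewrite subrr normr0.
have Gmax' x y : `|x - xc| < d -> `|y - yc| < d -> G' x y <= G' xc yc.
  move=> xd yd; have [xL yab <-] := dH _ _ xd yd.
  by rewrite -GcE; apply: (Gmax (x, y)); rewrite inE; split; rewrite /= in_itv.
have hG : exists c, second_deriv (fun s => G' s yc) xc (c + k * 2) /\
    second_deriv (G' xc) yc (- c).
  have [c cx cy] := hh _ _ xcL' ycab' cX.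
  have [c' cx' cy'] : harmonic_at (fun x y => \sum_(p <- X) l * (ln (q p x y) - ln (Q p))) xc yc.
    apply: (@harmonic_sum _ _ X (fun p x y => l * (ln (q p x y) - ln (Q p)))) => p pX.
    apply: (@harmonicZ _ (fun x y => ln (q p x y) - ln (Q p))).
    apply: (@harmonicD _ (fun x y => ln (q p x y)) (fun _ _ => - ln (Q p))); last exact: harmonic_cst.
    by apply: harmonic_ln; apply: contra cX => /eqP ->; case: (p) pX.
  exists (c + c'); split.
    rewrite addrAC; apply: second_derivD => //; apply: second_derivD => //.
    by apply: second_derivZ; exact: second_deriv_sqr.
  have -> : - (c + c') = - c + 0 + - c' by clear; lra.
  apply: second_derivD => //; apply: second_derivD => //; exact: second_deriv_cst.
have [c [cx cy]] := hG.
(* At an interior maximum both second derivatives are nonpositive, but they add up to 2 k > 0. *)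
have h1 : c + k * 2 <= 0.
  apply: (@second_deriv_max _ (G'^~ yc) xc _ d d0 _ cx) => s sd.
  by apply: Gmax'; rewrite // subrr normr0.
have h2 : - c <= 0.
  apply: (@second_deriv_max _ (G' xc) yc _ d d0 _ cy) => s sd.
  by apply: Gmax'; rewrite // subrr normr0.
by clear -h1 h2 k0; lra.
Qed.

(** * Calculus of complex derivatives, and harmonicity of the imaginary part *)

Lemma cderivD (R : realType) (f g : R[i] -> R[i]) z l l' :
  cderiv f z l -> cderiv g z l' -> cderiv (fun z => f z + g z) z (l + l').
Proof.
move=> /cderiv_is_derive df /cderiv_is_derive dg.
exact: (is_derive_cderiv (@is_deriveD R[i] R[i]^o R[i]^o f g z 1 l l' df dg)).
Qed.

Lemma cderivM (R : realType) (f g : R[i] -> R[i]) z l l' :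
  cderiv f z l -> cderiv g z l' ->
  cderiv (fun z => f z * g z) z (l * g z + f z * l').
Proof.
move=> /cderiv_is_derive df /cderiv_is_derive dg.
have := is_derive_cderiv (@is_deriveM R[i] R[i]^o f g z 1 l l' df dg).
by rewrite /GRing.scale /= addrC [g z * l]mulrC.
Qed.

Lemma cderiv_cst (R : realType) (c z : R[i]) : cderiv (fun=> c) z 0.
Proof.
by move=> e e0; exists 1 => // h _; rewrite subrr mul0r subrr cabs0 mulr_ge0 ?cabs_ge0// ltW.
Qed.

Lemma cderiv_id (R : realType) (z : R[i]) : cderiv (fun z => z) z 1.
Proof.
move=> e e0; exists 1 => // h _.
by rewrite [z + h]addrC addrK mul1r subrr cabs0 mulr_ge0 ?cabs_ge0// ltW.
Qed.

Lemma ccontV (R : realType) (g : R[i] -> R[i]) z :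
  ccont g z -> g z != 0 -> ccont (fun z => (g z)^-1) z.
Proof.
move=> cg g0 e e0; have a0 : 0 < cabs (g z) by rewrite cabs_gt0.
set a := cabs (g z) in a0.
have m0 : 0 < Num.min (a / 2) (e * (a ^+ 2 / 2)).
  by rewrite lt_min !divr_gt0//= mulr_gt0// divr_gt0// exprn_gt0.
have [d d0 dH] := cg _ m0; exists d => // w /dH; rewrite lt_min => /andP[h1 h2].
have wa : a / 2 < cabs (g w).
  by have := ler_cabsB (g z) (g w); rewrite cabsB -/a => h; lra.
have gw0 : g w != 0 by rewrite -cabs_gt0; lra.
have -> : (g w)^-1 - (g z)^-1 = (g z - g w) / (g w * g z) by field; rewrite g0.
rewrite cabsM cabsV cabsM -/a cabsB ltr_pdivrMr ?mulr_gt0 ?cabs_gt0//.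
apply: (lt_le_trans h2); rewrite ler_pM2l//.
have -> : a ^+ 2 / 2 = a / 2 * a by field.
by rewrite ler_pM2r// ltW.
Qed.

Lemma cderivV (R : realType) (g : R[i] -> R[i]) z l :
  cderiv g z l -> g z != 0 ->
  cderiv (fun z => (g z)^-1) z (- l / g z ^+ 2).
Proof.
move=> dg g0 e e0; set u := (g z)^-1.
have u0 : 0 < cabs u by rewrite cabs_gt0 invr_eq0.
set a := cabs u in u0.
have l0 := cabs_ge0 l; set b := cabs l in l0.
have e1 : 0 < e / (4 * a ^+ 2) by rewrite divr_gt0// mulr_gt0// exprn_gt0.
have e2 : 0 < Num.min a (e / (2 * a * (b + 1))).
  by rewrite lt_min u0 divr_gt0// !mulr_gt0//; lra.
have [d1 d10 H1] := dg _ e1.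
have [d2 d20 H2] := ccontV (cderiv_ccont dg) g0 e2.
have [d3 d30 H3] := ccont_neq0 (cderiv_ccont dg) g0.
exists (Num.min d1 (Num.min d2 d3)); first by rewrite !lt_min d10 d20.
move=> h; rewrite !lt_min => /and3P[/H1 h1 hd2 hd3].
have {}hd3 : g (z + h) != 0 by apply: H3; rewrite addrC addKr.
have := H2 (z + h); rewrite [z + h - z]addrC addKr => /(_ hd2).
rewrite -/u lt_min; set k := (g (z + h))^-1 => /andP[ka ke].
have -> : k - u - - l / g z ^+ 2 * h =
    - (u * ((g (z + h) - g z - l * h) * k + l * h * (k - u))).
  by rewrite /k /u; field; rewrite g0.
rewrite cabsN cabsM -/a.
have ka2 : cabs k <= 2 * a.
  by have := cabsD (k - u) u; rewrite subrK -/a => ?; lra.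
have h0 := cabs_ge0 h.
have h2 : cabs ((g (z + h) - g z - l * h) * k) <= e / (4 * a ^+ 2) * cabs h * (2 * a).
  by rewrite cabsM ler_pM ?cabs_ge0.
have h3 : cabs (l * h * (k - u)) <= b * cabs h * (e / (2 * a * (b + 1))).
  by rewrite !cabsM ler_pM ?mulr_ge0 ?cabs_ge0// ltW.
apply: (@le_trans _ _ (a * (e / (4 * a ^+ 2) * cabs h * (2 * a) + b * cabs h * (e / (2 * a * (b + 1)))))).
  by rewrite ler_pM2l//; apply: le_trans (cabsD _ _) _; exact: lerD.
have -> : a * (e / (4 * a ^+ 2) * cabs h * (2 * a) + b * cabs h * (e / (2 * a * (b + 1)))) =
    (e * cabs h / 2) * (1 + b / (b + 1)).
  have b1 : b + 1 != 0 by apply/lt0r_neq0; lra.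
  have a1 : a != 0 by exact: lt0r_neq0.
  by field; rewrite a1 b1.
have bb : b / (b + 1) <= 1 by rewrite ler_pdivrMr; lra.
have : 0 <= e * cabs h / 2 by rewrite divr_ge0// mulr_ge0// ltW.
by move=> p0; rewrite -[leRHS](@divfK _ 2)// ler_wpM2l//; lra.
Qed.

Lemma horner_cderiv (R : realType) (c : {poly R[i]}) (z : R[i]) :
  cderiv (fun z => c.[z]) z c^`().[z].
Proof.
elim/poly_ind: c => [|c a IH].
  under eq_fun do rewrite horner0; rewrite deriv0 horner0; exact: cderiv_cst.
under eq_fun do rewrite !hornerE; rewrite derivMXaddC !hornerE.
have := cderivD (cderivM IH (@cderiv_id _ z)) (@cderiv_cst _ a z).
by rewrite addr0 mulr1 addrC.
Qed.

(** The chain rule for P(z, f(z)); [Q] is the partial derivative of P in z. *)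
Lemma evalP_cderiv (R : realType) (P : {poly {poly R[i]}}) :
  exists Q : {poly {poly R[i]}}, forall f z l, cderiv f z l ->
    cderiv (fun z => evalP P z (f z)) z
      (evalP Q z (f z) + evalP P^`() z (f z) * l).
Proof.
elim/poly_ind: P => [|P c [Q IH]].
  exists 0 => f z l _; under eq_fun do rewrite /evalP !horner0.
  by rewrite deriv0 /evalP !horner0 mul0r addr0; exact: cderiv_cst.
exists (Q * 'X + c^`()%:P) => f z l df.
under eq_fun do rewrite evalPD evalPM evalPX evalPC.
rewrite derivMXaddC !evalPD !evalPM evalPX evalPC.
have -> : evalP Q z (f z) * f z + c^`().[z] +
    (evalP P z (f z) + evalP P^`() z (f z) * f z) * l =
    (evalP Q z (f z) + evalP P^`() z (f z) * l) * f z + evalP P z (f z) * l + c^`().[z].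
  by ring.
exact: (cderivD (cderivM (IH _ _ _ df) df) (@horner_cderiv _ c z)).
Qed.

Lemma cderiv_near (R : realType) (f g : R[i] -> R[i]) (z l : R[i]) (r : R) :
  0 < r -> (forall w, cabs (w - z) < r -> f w = g w) -> cderiv f z l ->
  cderiv g z l.
Proof.
move=> r0 fg df e e0; have [d d0 dH] := df _ e0.
exists (Num.min d r); first by rewrite lt_min d0.
move=> h; rewrite lt_min => /andP[/dH + hr].
rewrite !fg// ?subrr ?cabs0//.
by rewrite [z + h]addrC addrK.
Qed.

Lemma cderiv_unique (R : realType) (f : R[i] -> R[i]) (z l l' : R[i]) :
  cderiv f z l -> cderiv f z l' -> l = l'.
Proof.
move=> /cderiv_is_derive df /cderiv_is_derive df'.
by rewrite -(@derive_val _ _ _ _ _ _ _ df) (@derive_val _ _ _ _ _ _ _ df').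
Qed.

(** Differentiating P(z, f) = 0 gives f' = - P_z(z, f) / P_w(z, f). The denominator is nonzero off
    the roots of [c], and the right-hand side is differentiable because f is. *)
Lemma algebraic_twice_cderiv (R : realType) (D : R[i] -> Prop) f
    (P u v : {poly {poly R[i]}}) (c : {poly R[i]}) z :
  slit_domain D f -> annihilates D f P -> u * P + v * P^`() = c%:P ->
  (forall z, D z -> exists l, cderiv f z l) -> D z -> c.[z] != 0 ->
  exists (f1 : R[i] -> R[i]) (r : R) (l2 : R[i]), [/\ 0 < r,
    forall w, cabs (w - z) < r -> cderiv f w (f1 w) & cderiv f1 z l2].
Proof.
move=> [cf oD _ _] Pf uv df Dz cz.
have [Q QP] := evalP_cderiv P.
have P'0 w : D w -> c.[w] != 0 -> evalP P^`() w (f w) != 0.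
  move=> Dw; apply: contra => /eqP P'w; rewrite -(evalPC c w (f w)) -uv.
  by rewrite evalPD !evalPM Pf// P'w !mulr0 addr0.
have [r1 r10 H1] := oD _ Dz.
have [r2 r20 H2] := ccont_neq0 (@horner_ccont _ c z) cz.
exists (fun w => - evalP Q w (f w) * (evalP P^`() w (f w))^-1), (Num.min r1 r2).
have fE w : cabs (w - z) < Num.min r1 r2 ->
    cderiv f w (- evalP Q w (f w) * (evalP P^`() w (f w))^-1).
  rewrite lt_min => /andP[/H1 Dw /H2 cw]; have [l dl] := df _ Dw.
  suff <- : l = - evalP Q w (f w) * (evalP P^`() w (f w))^-1 by [].
  have [r r0 rH] := oD _ Dw.
  have d0 : cderiv (fun=> 0) w (evalP Q w (f w) + evalP P^`() w (f w) * l).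
    by apply: (cderiv_near r0 _ (QP f w l dl)) => x /rH; exact: Pf.
  have /eqP := cderiv_unique d0 (@cderiv_cst _ 0 w).
  rewrite addr_eq0 => /eqP ->; rewrite opprK mulrC mulKf//; exact: P'0.
have m0 : 0 < Num.min r1 r2 by rewrite lt_min r10.
have dz := fE z; rewrite subrr cabs0 in dz; have {}dz := dz m0.
have [Q1 Q1P] := evalP_cderiv Q; have [Q2 Q2P] := evalP_cderiv P^`().
have dQ := cderivM (@cderiv_cst _ (-1) z) (Q1P _ _ _ dz).
have dV := cderivV (Q2P _ _ _ dz) (P'0 _ Dz cz).
have dM := cderivM dQ dV.
eexists; split; [exact: m0|exact: fE|].
by apply: (cderiv_near m0 _ dM) => w _; rewrite mulN1r.
Qed.

Lemma harmonic_Im (R : realType) (f f1 : R[i] -> R[i]) (x y r : R) (l2 : R[i]) :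
  0 < r -> (forall w, cabs (w - (x +i* y)) < r -> cderiv f w (f1 w)) ->
  cderiv f1 (x +i* y) l2 ->
  harmonic_at (fun x y => complex.Im (f (x +i* y))) x y.
Proof.
move=> r0 df df1; exists (complex.Im l2).
  exists (fun s => complex.Im (f1 (s +i* y))), r; split => //.
    move=> s sr; apply: cderiv_Im_x; apply: df.
    by rewrite cabsE /= subrr expr0n addr0 sqrtr_sqr.
  exact: cderiv_Im_x.
exists (fun t => complex.Re (f1 (x +i* t))), r; split => //.
  move=> s sr; apply: cderiv_Im_y; apply: df.
  by rewrite cabsE /= subrr expr0n add0r sqrtr_sqr.
exact: cderiv_Re_y.
Qed.

Lemma ccont_Im_continuous (R : realType) (f : R[i] -> R[i]) (p : R * R) :
  ccont f (cplx p) ->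
  {for p, continuous (fun p : R * R => complex.Im (f (p.1 +i* p.2)))}.
Proof.
move=> cf; apply/cvgrPdist_lt => e e0; have [d d0 dH] := cf _ e0.
suff : nbhs (p : R * R) [set t : R * R |
  `|complex.Im (f (p.1 +i* p.2)) - complex.Im (f (t.1 +i* t.2))| < e] by [].
apply/nbhs_ballP; exists (d / 2) => /=; first by rewrite divr_gt0.
move=> [x y] [/=]; rewrite -!ball_normE /ball_ /= => xd yd.
rewrite distrC -ImB; apply: le_lt_trans (Im_le_cabs _) _; apply: dH.
apply: le_lt_trans (cabs_le _) _; rewrite /cplx /=.
by rewrite distrC [`|y - _|]distrC; lra.
Qed.

(** * Approximation by Poisson integrals of step functions *)

Lemma box_compact (R : realType) (a b c d : R) :
  compact (`[a, b]%classic `*` `[c, d]%classic : set (R * R)).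
Proof. by apply: compact_setX; exact: segment_compact. Qed.

Lemma in_box (R : realType) (a b c d : R) (p : R * R) :
  (p \in (`[a, b]%classic `*` `[c, d]%classic : set (R * R))) =
  (a <= p.1 <= b) && (c <= p.2 <= d).
Proof.
apply/idP/idP => [|/andP[h1 h2]]; first by rewrite inE => -[] /=; rewrite !in_itv /= => -> ->.
by rewrite inE; split; rewrite /= in_itv.
Qed.

Lemma box_bounded (R : realType) (g : R * R -> R) (a b c d : R) :
  (forall p : R * R, a <= p.1 <= b -> c <= p.2 <= d -> {for p, continuous g}) ->
  exists2 V : R, 0 <= V & forall x y, a <= x <= b -> c <= y <= d -> g (x, y) <= V.
Proof.
move=> gc; have [ab|ab] := leP a b; last first.
  by exists 0 => // x y /andP[h1 h2]; lra.
have [cd|cd] := leP c d; last by exists 0 => // x y _ /andP[h1 h2]; lra.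
have box0 : (`[a, b]%classic `*` `[c, d]%classic : set (R * R)) !=set0.
  by exists (a, c); split; rewrite /= in_itv /= lexx.
have gB p : p \in (`[a, b]%classic `*` `[c, d]%classic : set (R * R)) -> {for p, continuous g}.
  by rewrite in_box => /andP[? ?]; exact: gc.
have [pM _ pMmax] := compact_EVT_max box0 (@box_compact _ a b c d) (continuous_in_subspaceT gB).
exists `|g pM| => // x y xab ycd; apply: le_trans (ler_norm _).
by apply: pMmax; rewrite in_box xab.
Qed.

(** One of the two points may leave the box; the bound is used for pairs with only one end under
    control. *)
Lemma box_unif_cont (R : realType) (g : R * R -> R) (a b c d : R) :
  (forall p : R * R, a <= p.1 <= b -> c <= p.2 <= d -> {for p, continuous g}) ->
  forall e : R, 0 < e -> exists2 r : R, 0 < r &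
    forall x y x' y', a <= x <= b -> c <= y <= d ->
      `|x' - x| < r -> `|y' - y| < r -> `|g (x', y') - g (x, y)| < e.
Proof.
move=> gc e e0.
pose P (r : R) (p : R * R) := forall q : R * R,
  `|q.1 - p.1| < r -> `|q.2 - p.2| < r -> `|g q - g p| < e.
have /compact_near_coveringP K := @box_compact R a b c d.
have : \forall r \near (0 : R)^'+, forall p, (`[a, b]%classic `*` `[c, d]%classic) p -> P r p.
  apply: K => p [/= p1 p2]; rewrite in_itv /= in p1; rewrite in_itv /= in p2.
  have /cvgrPdist_lt/(_ (e / 2)) := gc p p1 p2.
  rewrite divr_gt0// => /(_ isT)/nbhs_ballP[s /= s0 sH].
  exists (ball p (s / 2), [set r : R | r < s / 2]).
    split; first by apply: nbhsx_ballx; rewrite divr_gt0.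
    by apply: nbhs_right_lt; rewrite divr_gt0.
  move=> [p' r] /= [[]]; rewrite -!ball_normE /ball_ /= => pp1 pp2 rs q q1 q2.
  have h1 : `|g p - g p'| < e / 2.
    by apply: sH; split; rewrite -ball_normE /ball_ /=; lra.
  have h2 : `|g p - g q| < e / 2.
    apply: sH; split; rewrite -ball_normE /ball_ /=.
      by rewrite -(subrKA p'.1) (le_lt_trans (ler_normD _ _))// [`|p'.1 - _|]distrC; lra.
    by rewrite -(subrKA p'.2) (le_lt_trans (ler_normD _ _))// [`|p'.2 - _|]distrC; lra.
  by rewrite -(subrKA (g p)) (le_lt_trans (ler_normD _ _))// distrC; lra.
move=> H.
have [r [r0 rH]] : exists r : R, 0 < r /\ forall p, (`[a, b]%classic `*` `[c, d]%classic) p -> P r p.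
  near (0 : R)^'+ => r; exists r; split; first by near: r; exact: nbhs_right_gt.
  by near: r.
exists r => // x y x' y' xab ycd xx yy.
by apply: (rH (x, y)) => //; split; rewrite /= in_itv.
Unshelve. all: by end_near.
Qed.

(* pi times the usual Poisson kernel of the half plane *)
Definition poisson (R : realType) (x y t : R) : R := y / ((x - t) ^+ 2 + y ^+ 2).

Lemma poisson_den (R : realType) (x y t : R) : 0 < y -> 0 < (x - t) ^+ 2 + y ^+ 2.
Proof. by move=> y0; rewrite ltr_wpDl ?sqr_ge0// exprn_gt0. Qed.

Lemma poisson_ge0 (R : realType) (x y t : R) : 0 < y -> 0 <= poisson x y t.
Proof. by move=> y0; rewrite divr_ge0 ?ltW// poisson_den. Qed.

Lemma poisson_le_inv (R : realType) (x y t : R) : 0 < y -> poisson x y t <= y^-1.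
Proof.
move=> y0; rewrite /poisson ler_pdivrMr ?poisson_den//.
rewrite mulrC ler_pdivlMr// -expr2 lerDr sqr_ge0//.
Qed.

Lemma poisson_le_far (R : realType) (x y t r : R) : 0 < y -> 0 < r -> r <= `|x - t| ->
  poisson x y t <= y / r ^+ 2 /\ poisson x y t <= r^-1.
Proof.
move=> y0 r0 rx; have h : r ^+ 2 <= (x - t) ^+ 2.
  by rewrite -[(x - t) ^+ 2]real_normK ?num_real// lerXn2r// nnegrE ltW.
have d0 := poisson_den x t y0; have r20 : 0 < r ^+ 2 by rewrite exprn_gt0.
split.
  by rewrite /poisson ler_pM2l// lef_pV2 ?posrE//; have := sqr_ge0 y; lra.
rewrite /poisson ler_pdivrMr// mulrC ler_pdivlMr//.
by have := sqr_ge0 (y - r); have := sqr_ge0 y; have := sqr_ge0 r; nra.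
Qed.

(** The constant comes from 2 y |A| <= A^2 + y^2 for A = x - s and A = x - t, applied to the
    numerator of the difference. *)
Lemma poisson_lip (R : realType) (x y s t : R) : 0 < y ->
  `|poisson x y s - poisson x y t| <= `|s - t| / y ^+ 2.
Proof.
move=> y0; have ds := poisson_den x s y0; have dt := poisson_den x t y0.
have y20 : 0 < y ^+ 2 by rewrite exprn_gt0.
have -> : poisson x y s - poisson x y t =
    (s - t) * (y * ((x - s) + (x - t)) / (((x - s) ^+ 2 + y ^+ 2) * ((x - t) ^+ 2 + y ^+ 2))).
  by rewrite /poisson; field; rewrite !gt_eqF.
rewrite normrM ler_wpM2l// normrM normrV ?unitfE ?gt_eqF ?mulr_gt0//.
rewrite [X in _ / X]gtr0_norm ?mulr_gt0// ler_pdivrMr ?mulr_gt0//.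
rewrite ler_pdivlMl// normrM gtr0_norm//.
set A := x - s; set B := x - t; rewrite -/A -/B in ds dt.
have h : `|A + B| <= `|A| + `|B| by exact: ler_normD.
have hA : 2 * y * `|A| <= A ^+ 2 + y ^+ 2.
  by rewrite -[A ^+ 2]real_normK ?num_real//; have := sqr_ge0 (y - `|A|); nra.
have hB : 2 * y * `|B| <= B ^+ 2 + y ^+ 2.
  by rewrite -[B ^+ 2]real_normK ?num_real//; have := sqr_ge0 (y - `|B|); nra.
have A2 : y ^+ 2 <= A ^+ 2 + y ^+ 2 by rewrite lerDr sqr_ge0.
have B2 : y ^+ 2 <= B ^+ 2 + y ^+ 2 by rewrite lerDr sqr_ge0.
move: (A ^+ 2 + y ^+ 2) (B ^+ 2 + y ^+ 2) ds dt hA hB A2 B2 => a b a0 b0 hA hB A2 B2.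
have h1 : y * `|A + B| <= (a + b) / 2.
  by have : y * `|A + B| <= y * (`|A| + `|B|); [rewrite ler_pM2l|lra].
have h2 := ler_wpM2l (ltW a0) B2; have h3 := ler_wpM2l (ltW b0) A2.
apply: (@le_trans _ _ (y ^+ 2 * ((a + b) / 2))); first by rewrite ler_pM2l.
by lra.
Qed.

Lemma atan_poisson (R : realType) (x y a b : R) : 0 < y -> a < b ->
  exists2 t, a < t < b &
    atan ((b - x) / y) - atan ((a - x) / y) = (b - a) * poisson x y t.
Proof.
move=> y0 ab; have [|t tab E] := @mean_value _ (fun s => atan ((s - x) / y)) (poisson x y) a b ab.
  move=> s _; have dl : is_derive s 1 (fun s => (s - x) / y) y^-1.
    by apply: is_derive_eq; rewrite /GRing.scale /=; ring.
  have := @is_derive1_comp _ (@atan R) _ _ _ _ (is_derive1_atan _) dl.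
  move/is_derive_eq; apply; rewrite /poisson.
  have := poisson_den x s y0 => /lt0r_neq0 q.
  have -> : 1 + ((s - x) / y) ^+ 2 = ((x - s) ^+ 2 + y ^+ 2) / y ^+ 2.
    by field; rewrite gt_eqF.
  by field; rewrite q gt_eqF.
by exists t => //; rewrite E mulrC.
Qed.

Lemma atan_near_pi2 (R : realType) (e : R) : 0 < e ->
  exists2 U : R, 0 < U & forall u, U <= u -> pi / 2 - atan u <= e.
Proof.
move=> e0; have := @cvgy_atan R => /cvgrPdist_le/(_ e e0)[U [_ UH]].
exists (Num.max 1 (U + 1)); first by rewrite lt_max ltr01.
move=> u; rewrite ge_max => /andP[_ Uu]; have := UH u; rewrite /= => H.
by apply: le_trans (ler_norm _) (H _); lra.
Qed.

(** The harmonic measure of [a, b] in the upper half plane seen from x + i y, that is, the Poisson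
    integral of the indicator of [a, b]. *)
Definition pharm (R : realType) (x y a b : R) : R :=
  (atan ((b - x) / y) - atan ((a - x) / y)) / pi.

Lemma pharm_ge0 (R : realType) (x y a b : R) : 0 < y -> a <= b -> 0 <= pharm x y a b.
Proof.
move=> y0 ab; rewrite divr_ge0 ?pi_ge0// subr_ge0 le_atan//.
by rewrite ler_pM2r ?invr_gt0//; lra.
Qed.

Lemma pharm_sum (R : realType) (x y : R) (t : nat -> R) N :
  \sum_(k < N) pharm x y (t k) (t k.+1) = pharm x y (t 0%N) (t N).
Proof.
elim: N => [|N IH]; first by rewrite big_ord0 /pharm subrr mul0r.
by rewrite big_ord_recr /= IH /pharm -mulrDl; congr (_ / _); ring.
Qed.

Lemma pharm_le1 (R : realType) (x y a b : R) : pharm x y a b <= 1.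
Proof.
rewrite ler_pdivrMr ?pi_gt0// mul1r.
by have := atan_ltpi2 ((b - x) / y); have := atan_gtNpi2 ((a - x) / y); lra.
Qed.

Lemma pharm_complement (R : realType) (x y L : R) :
  1 - pharm x y (- L) L =
  ((pi / 2 - atan ((L - x) / y)) + (pi / 2 - atan ((L + x) / y))) / pi.
Proof.
rewrite /pharm (_ : (- L - x) / y = - ((L + x) / y)) ?atanN; last by ring.
have pin : pi != 0 :> R by rewrite gt_eqF// pi_gt0.
by move: (atan _) (atan _) (pi : R) pin => u w q qn; field.
Qed.

Lemma pharm_poisson (R : realType) (x y a b : R) : 0 < y -> a < b ->
  exists2 t, a < t < b & pharm x y a b = (b - a) / pi * poisson x y t.
Proof.
move=> y0 ab; have [t tab E] := atan_poisson x y0 ab.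
by exists t => //; rewrite /pharm E; ring.
Qed.

Lemma harmonic_pharm (R : realType) (x y a b : R) : 0 < y ->
  harmonic_at (fun x y => pharm x y a b) x y.
Proof.
move=> y0; have h1 := harmonicD (harmonic_atan b x y0) (harmonicZ (-1) (harmonic_atan a x y0)).
have h2 := harmonicZ pi^-1 h1.
suff -> : (fun x y => pharm x y a b) =
  (fun x y => pi^-1 * (atan ((b - x) / y) + -1 * atan ((a - x) / y))) by [].
by apply/funext => s; apply/funext => r; rewrite /pharm mulN1r mulrC.
Qed.

Lemma continuous_pharm (R : realType) (p : R * R) (a b : R) : 0 < p.2 ->
  {for p, continuous (fun p : R * R => pharm p.1 p.2 a b)}.
Proof.
move=> p2; have c1 : {for p, continuous (fun p : R * R => p.1)} by exact: cvg_fst.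
have c2 : {for p, continuous (fun p : R * R => p.2^-1)}.
  by apply: continuousV; [rewrite gt_eqF|exact: cvg_snd].
have c3 (c : R) : {for p, continuous (fun p : R * R => atan ((c - p.1) / p.2))}.
  have cB : {for p, continuous (fun p : R * R => c - p.1)}.
    by apply: continuousB => //; exact: cst_continuous.
  apply: (@continuous_comp _ _ _ (fun p : R * R => (c - p.1) / p.2) (@atan R)).
    exact: continuousM cB c2.
  exact: continuous_atan.
exact: (continuousM (continuousB (c3 b) (c3 a)) (@cst_continuous _ _ pi^-1 p)).
Qed.

Lemma exists_notin (R : realType) (a b : R) (s : seq R) : a < b ->
  exists2 x, a < x < b & x \notin s.
Proof.
move=> ab; pose g (k : nat) := a + (b - a) / k.+2%:R.
have gi : injective g.
  move=> j k /addrI/(mulfI (lt0r_neq0 _)); rewrite subr_gt0 => /(_ ab)/invr_inj/eqP.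
  by rewrite eqr_nat => /eqP[].
apply: contrapT => H.
have : (size [seq g k | k <- iota 0 (size s).+1] <= size s)%N.
  apply: uniq_leq_size; first by rewrite map_inj_uniq ?iota_uniq.
  move=> _ /mapP[k _ ->]; apply/negPn/negP => gs; apply: H; exists (g k) => //.
  have k2 : 0 < k.+2%:R :> R by [].
  have ba : 0 < b - a by rewrite subr_gt0.
  rewrite /g ltrDl divr_gt0//= -ltrBrDl ltr_pdivrMr// ltr_pMr//.
  by rewrite ltr1n.
by rewrite size_map size_iota ltnn.
Qed.

(** An exceptional point is a limit of points on the same horizontal line whose abscissa differs
    from those of [X], and [h] is continuous. *)
Lemma max_principle_all (R : realType) (h : R -> R -> R) (X : seq (R * R))
    (m L a b : R) : 0 < L ->
  (forall p : R * R, -L <= p.1 <= L -> a <= p.2 <= b ->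
     {for p, continuous (fun p : R * R => h p.1 p.2)}) ->
  (forall x y, -L < x < L -> a < y < b -> (x, y) \notin X -> harmonic_at h x y) ->
  (forall x y, -L <= x <= L -> a <= y <= b ->
     (x == - L) || (x == L) || (y == a) || (y == b) -> h x y <= m) ->
  forall x y, -L <= x <= L -> a <= y <= b -> h x y <= m.
Proof.
move=> L0 hc hh hb x y xL yab; rewrite leNgt; apply/negP => hm.
have H := max_principle hc hh hb.
have := hc (x, y) xL yab => /cvgrPdist_lt/(_ (h x y - m)).
rewrite subr_gt0 => /(_ hm)/nbhs_ballP[r /= r0 rH].
have [x' /andP[x1 x2] x'X] : exists2 x', Num.max (- L) (x - r) < x' < Num.min L (x + r) &
    x' \notin [seq p.1 | p <- X].
  apply: exists_notin; rewrite lt_min !gt_max.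
  by move: xL => /andP[? ?]; apply/andP; split; apply/andP; split; lra.
move: x1 x2; rewrite gt_max lt_min => /andP[x1 x2] /andP[x3 x4].
have : h x' y <= m.
  apply: H => //; first by rewrite !ltW.
  by apply: contra x'X => pX; apply/mapP; exists (x', y).
have : `|h x y - h x' y| < h x y - m.
  apply: (rH (x', y)); split; rewrite -ball_normE /ball_ /= ?subrr ?normr0//.
  by rewrite ltr_norml; apply/andP; split; lra.
by rewrite ltr_norml => /andP[]; lra.
Qed.

Lemma second_deriv_shift (R : realType) (g : R -> R) (t e c : R) :
  second_deriv g (t + e) c -> second_deriv (fun s => g (s + e)) t c.
Proof.
have sh (f : R -> R) s l : is_derive (s + e) 1 f l -> is_derive s 1 (fun s => f (s + e)) l.
  move=> df; apply: real_is_derive => eps eps0.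
  have [d d0 dH] := is_derive_real df eps0; exists d => // h /dH.
  by rewrite [s + h + e]addrAC.
move=> [g1 [d [d0 dg dg1]]]; exists (fun s => g1 (s + e)), d; split => //.
  move=> s st; apply: sh; apply: dg.
  by rewrite opprD addrACA subrr addr0.
exact: sh.
Qed.

(** What the construction of the measure uses of v = - Im f. Boundary values are required only on
    the part |x| >= L of the real axis, where v extends continuously by 0. *)
Record nevanlinna (R : realType) (v : R -> R -> R) (L : R) (X : seq (R * R)) : Prop := {
  nev_L : 0 < L ;
  nev_cont : forall p : R * R, 0 < p.2 \/ L <= `|p.1| ->
    {for p, continuous (fun p : R * R => v p.1 p.2)} ;
  nev_pos : forall x y : R, 0 < y -> 0 < v x y ;
  nev_real : forall x, L <= `|x| -> v x 0 = 0 ;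
  nev_decay : forall e : R, 0 < e -> exists R0 : R, forall x y : R, 0 <= y ->
    R0 <= `|x| \/ R0 <= y -> `|v x y| <= e ;
  nev_harm : forall x y : R, 0 < y -> (x, y) \notin X -> harmonic_at v x y }.

(** The approximating step function lives on [-L, L], so v must be small at height e outside. Far
    away this is the decay; for L <= |t| <= R0 it is uniform continuity together with v(t, 0) =
    0. *)
Lemma choose_height (R : realType) (v : R -> R -> R) L X (d : R) :
  nevanlinna v L X -> 0 < d ->
  exists2 e : R, 0 < e <= d & forall t, L <= `|t| -> v t e <= d.
Proof.
move=> nv d0; have L0 := nev_L nv.
have [R0 R0H] := nev_decay nv d0.
have c1 (p : R * R) : L <= p.1 <= R0 -> 0 <= p.2 <= 1 ->
    {for p, continuous (fun p : R * R => v p.1 p.2)}.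
  move=> /andP[p1 _] _; apply: (nev_cont nv); right.
  by rewrite (le_trans p1)// ler_norm.
have c2 (p : R * R) : - R0 <= p.1 <= - L -> 0 <= p.2 <= 1 ->
    {for p, continuous (fun p : R * R => v p.1 p.2)}.
  move=> /andP[_ p1] _; apply: (nev_cont nv); right.
  by rewrite -normrN (le_trans _ (ler_norm _))// lerNr.
have [r1 r10 H1] := box_unif_cont c1 d0.
have [r2 r20 H2] := box_unif_cont c2 d0.
pose e := Num.min d (Num.min r1 r2 / 2).
have e0 : 0 < e by rewrite lt_min d0 divr_gt0// lt_min r10.
have er1 : e < r1.
  have : e <= Num.min r1 r2 / 2 by rewrite /e ge_min lexx orbT.
  have : Num.min r1 r2 <= r1 by rewrite ge_min lexx.
  lra.
have er2 : e < r2.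
  have : e <= Num.min r1 r2 / 2 by rewrite /e ge_min lexx orbT.
  have : Num.min r1 r2 <= r2 by rewrite ge_min lexx orbT.
  lra.
exists e; first by rewrite e0 /e ge_min lexx.
move=> t Lt; have [Rt|tR] := leP R0 `|t|.
  by apply: le_trans (ler_norm _) (R0H _ _ (ltW e0) _); left.
apply: le_trans (ler_norm _) _; rewrite -[v t e]subr0 -(nev_real nv Lt) ltW//.
have [t0|t0] := leP 0 t.
  rewrite ger0_norm// in Lt tR.
  by apply: (H1 t 0 t e); rewrite ?subrr ?normr0 ?subr0 ?gtr0_norm// ?lexx ?ler01 ?Lt ?ltW.
rewrite ltr0_norm// in Lt tR.
apply: (H2 t 0 t e); rewrite ?subrr ?normr0 ?subr0 ?gtr0_norm// ?lexx ?ler01//.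
by apply/andP; split; lra.
Qed.

Lemma continuous_shift_snd (R : realType) (g : R * R -> R) (p : R * R) (e : R) :
  {for (p.1, p.2 + e), continuous g} ->
  {for p, continuous (fun q : R * R => g (q.1, q.2 + e))}.
Proof.
move=> /cvgrPdist_lt gc; apply/cvgrPdist_lt => eps eps0.
have /nbhs_ballP[d /= d0 dH] := gc _ eps0.
suff : nbhs (p : R * R) [set t : R * R | `|g (p.1, p.2 + e) - g (t.1, t.2 + e)| < eps] by [].
apply/nbhs_ballP; exists d => // -[x y] [/= h1 h2]; apply: (dH (x, y + e)).
split => //=; move: h2; rewrite -!ball_normE /ball_ /=.
by rewrite opprD addrACA subrr addr0.
Qed.

(** Cells near x contribute at most d times a total harmonic measure <= 1. A cell farther than rho
    has all its points at distance >= rho / 2, so its share is at most V (D / 2) y / (rho / 2)^2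
    (using pi >= 2); the N cells of total length 2 L add up to the quantity assumed to be <= d. *)
Lemma step_sum_close (R : realType) (N : nat) (t c : nat -> R)
    (x y L D rho d V w : R) :
  0 < y -> 0 < D -> D < rho / 2 -> 0 < d -> 0 < V -> t 0%N = - L -> t N = L ->
  (forall k, t k.+1 = t k + D) -> N%:R * D = 2 * L ->
  (forall k, 0 < c k <= V) -> 0 < w <= V ->
  (forall k : 'I_N, `|x - t k| < rho -> `|w - c k| <= d) ->
  4 * L * V * y / rho ^+ 2 <= d ->
  `|\sum_(k < N) (w - c k) * pharm x y (t k) (t k.+1)| <= 2 * d.
Proof.
move=> y0 D0 Drho d0 V0 t0 tN tS ND cV wV near yd.
have rho0 : 0 < rho by lra.
apply: le_trans (ler_norm_sum _ _ _) _.
have Y0 : 0 <= y / (rho / 2) ^+ 2.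
  by rewrite divr_ge0 ?exprn_ge0 ?divr_ge0 ?ltW.
have q0 : 0 <= D / 2 * V * (y / (rho / 2) ^+ 2).
  by apply: mulr_ge0 => //; apply: mulr_ge0; lra.
apply: (@le_trans _ _ (\sum_(k < N) (d * pharm x y (t k) (t k.+1) +
    D / 2 * V * (y / (rho / 2) ^+ 2)))).
  apply: ler_sum => k _.
  have tlt : t k < t k.+1 by rewrite tS ltrDl.
  have p0 := pharm_ge0 x y0 (ltW tlt).
  rewrite normrM [X in _ * X]ger0_norm//.
  have [xt|xt] := ltP `|x - t k| rho.
    apply: (@le_trans _ _ (d * pharm x y (t k) (t k.+1))); last by rewrite lerDl.
    by rewrite ler_wpM2r// near.
  apply: (@le_trans _ _ (D / 2 * V * (y / (rho / 2) ^+ 2))); last by rewrite lerDr mulr_ge0// ltW.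
  have [s /andP[s1 s2] ->] := pharm_poisson x y0 tlt.
  have xs : rho / 2 <= `|x - s|.
    have h := ler_normD (x - s) (s - t k); rewrite subrKA in h.
    have : `|s - t k| <= D by rewrite gtr0_norm ?subr_gt0//; rewrite tS in s2; lra.
    by move: (`|s - t k|) (`|x - s|) (`|x - t k|) h xt => *; lra.
  have [ps _] := poisson_le_far y0 (divr_gt0 rho0 (ltr0Sn R 1)) xs.
  have -> : t k.+1 - t k = D by rewrite tS addrC addKr.
  have wc : `|w - c k| <= V.
    have /andP[c0 c1] := cV k; move: wV => /andP[w0 w1].
    by rewrite ler_norml; apply/andP; split; lra.
  have -> : D / 2 * V * (y / (rho / 2) ^+ 2) = V * (D / 2 * (y / (rho / 2) ^+ 2)).
    by rewrite [_ * V]mulrC !mulrA.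
  apply: ler_pM => //.
    by apply: mulr_ge0; [apply: divr_ge0; [exact: ltW|exact: pi_ge0]|exact: poisson_ge0].
  apply: ler_pM => //; rewrite ?poisson_ge0//.
    by apply: divr_ge0; [exact: ltW|exact: pi_ge0].
  by rewrite ler_pM2l// lef_pV2 ?posrE ?pi_gt0// pi_ge2.
rewrite big_split/= -mulr_sumr pharm_sum t0 tN sumr_const card_ord.
have h1 : d * pharm x y (- L) L <= d by rewrite ler_piMr ?pharm_le1// ltW.
have -> : D / 2 * V * (y / (rho / 2) ^+ 2) *+ N = (N%:R * D) * V * (y / rho ^+ 2) * 2.
  by rewrite -mulr_natl; field; rewrite gt_eqF.
rewrite ND.
have -> : 2 * L * V * (y / rho ^+ 2) * 2 = 4 * L * V * y / rho ^+ 2.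
  by field; rewrite gt_eqF.
by lra.
Qed.

Lemma pharm_complement_small (R : realType) (x y L rho U e : R) :
  0 < y -> 0 < e -> (forall u, U <= u -> pi / 2 - atan u <= e) ->
  U <= rho / y -> `|x| <= L - rho -> 1 - pharm x y (- L) L <= e.
Proof.
move=> y0 e0 UH Uy; rewrite ler_norml => /andP[x1 x2].
have a1 : pi / 2 - atan ((L - x) / y) <= e.
  by apply/UH/(le_trans Uy); rewrite ler_pM2r ?invr_gt0//; lra.
have a2 : pi / 2 - atan ((L + x) / y) <= e.
  by apply/UH/(le_trans Uy); rewrite ler_pM2r ?invr_gt0//; lra.
rewrite pharm_complement ler_pdivrMr ?pi_gt0//.
have h : e * 2 <= e * pi by rewrite ler_pM2l// pi_ge2.
by lra.
Qed.

Lemma step_sum_far (R : realType) (N : nat) (t c : nat -> R) (x y L D V r : R) :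
  0 < y -> 0 < D -> 0 < V -> 0 < r ->
  (forall k, t k.+1 = t k + D) -> N%:R * D = 2 * L ->
  (forall k, 0 < c k <= V) ->
  (forall k : 'I_N, - L <= t k /\ t k.+1 <= L) ->
  L + r <= `|x| \/ r <= y ->
  0 <= \sum_(k < N) c k * pharm x y (t k) (t k.+1) <= 2 * L * V / r.
Proof.
move=> y0 D0 V0 r0 tS ND cV tL far.
have tlt k : t k < t k.+1 by rewrite tS ltrDl.
apply/andP; split.
  apply: sumr_ge0 => k _; apply: mulr_ge0; first by have /andP[/ltW] := cV k.
  exact: pharm_ge0 (ltW (tlt k)).
apply: (@le_trans _ _ (\sum_(k < N) (V * (D / r)))); last first.
  rewrite sumr_const card_ord -[_ *+ N]mulr_natl.
  have -> : N%:R * (V * (D / r)) = N%:R * D * V / r by ring.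
  by rewrite ND.
apply: ler_sum => k _; have /andP[c0 c1] := cV k.
apply: ler_pM; [exact: ltW|exact: pharm_ge0 (ltW (tlt k))|by []|].
have [s /andP[s1 s2] ->] := pharm_poisson x y0 (tlt k).
have -> : t k.+1 - t k = D by rewrite tS addrC addKr.
have -> : D / pi * poisson x y s = D * (poisson x y s / pi) by rewrite mulrAC mulrA.
rewrite ler_pM2l// ler_pdivrMr ?pi_gt0//.
have rinv : 0 < r^-1 by rewrite invr_gt0.
have h : r^-1 * 2 <= r^-1 * pi by rewrite ler_pM2l// pi_ge2.
suff : poisson x y s <= r^-1 by lra.
case: far => H.
  have [|_ //] := @poisson_le_far _ x y s r y0 r0.
  have h1 := ler_normD (x - s) s; rewrite subrK in h1.
  have sL : `|s| <= L.
    by have [t1 t2] := tL k; rewrite ler_norml; apply/andP; split; lra.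
  by move: (`|s|) (`|x - s|) (`|x|) h1 sL H => *; lra.
by apply: le_trans (poisson_le_inv x s y0) _; rewrite lef_pV2.
Qed.

(** The bound is checked for y <= y1 and outside a large box; inside the rectangle between, the
    maximum principle applies to the difference and to its opposite. Of the 4 d, half pays for the
    cells and half for the mass that escapes [-L, L]. *)
Lemma step_approximation (R : realType) (v : R -> R -> R) L X (d e : R) :
  nevanlinna v L X -> 0 < d -> 0 < e -> (forall t, L <= `|t| -> v t e <= d) ->
  exists N : nat, [/\ (0 < N)%N, 2 * L / N%:R <= d &
    let t k := - L + k%:R * (2 * L / N%:R) in
    forall x y : R, 0 < y ->
      `|v x (y + e) - \sum_(k < N) v (t k) e * pharm x y (t k) (t k.+1)| <= 4 * d].
Proof.
move=> nv d0 e0 vL; have L0 := nev_L nv.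
have [R0 R0L R0H] : exists2 R0 : R, L + 1 <= R0 & forall x y : R, 0 <= y ->
    R0 <= `|x| \/ R0 <= y -> `|v x y| <= d.
  have [R0 R0H] := nev_decay nv d0; exists (Num.max R0 (L + 1)).
    by rewrite le_max lexx orbT.
  move=> x y y0; rewrite !ge_max => H; apply: R0H => //.
  by case: H => /andP[? _]; [left|right].
have cbox (p : R * R) : - R0 <= p.1 <= R0 -> e <= p.2 <= e + 1 ->
    {for p, continuous (fun p : R * R => v p.1 p.2)}.
  by move=> _ /andP[ep _]; apply: (nev_cont nv); left; lra.
have [V0 V00 V0H] := box_bounded cbox.
have [rho rho0 rhoH] := box_unif_cont cbox d0.
pose V := V0 + d.
have V_gt0 : 0 < V by rewrite /V; lra.
have VH (x y : R) : 0 <= y <= 1 -> v x (y + e) <= V.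
  move=> /andP[y0 y1]; have [Rx|xR] := leP R0 `|x|.
    have := R0H x (y + e) ltac:(clear -y0 e0; lra) (or_introl Rx).
    by have := ler_norm (v x (y + e)); rewrite /V; clear -V00 d0; lra.
  apply: (@le_trans _ _ V0); last by rewrite /V; lra.
  apply: (V0H x (y + e)); first by rewrite -ler_norml ltW.
  by apply/andP; split; lra.
clearbody V.
have vpos (x y : R) : 0 <= y -> 0 < v x (y + e) by move=> y0; apply: (nev_pos nv); lra.
have pi2 := @pi_ge2 R.
pose r := Num.min (rho / 2) d.
have r0 : 0 < r by rewrite lt_min divr_gt0.
pose N := (Num.bound (2 * L / r)).+1.
have N0 : 0 < N%:R :> R by [].
pose D := 2 * L / N%:R.
have D0 : 0 < D by rewrite divr_gt0// mulr_gt0.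
have Dr : D < r.
  rewrite ltr_pdivrMr// -ltr_pdivrMl// [_^-1 * _]mulrC.
  apply: (@lt_trans _ _ (Num.bound (2 * L / r))%:R).
    by apply: archi_boundP; rewrite divr_ge0 ?mulr_ge0// ltW.
  by rewrite ltr_nat.
have Drho : D < rho / 2 by apply: lt_le_trans Dr _; rewrite ge_min lexx.
exists N; split => //; first by rewrite ltW// (lt_le_trans Dr)// ge_min lexx orbT.
have ND : N%:R * D = 2 * L by rewrite /D; field; rewrite gt_eqF.
rewrite -/D; clearbody D N; clear Dr; move=> t.
have t0 : t 0%N = - L by rewrite /t mul0r addr0.
have tN : t N = L by rewrite /t ND; ring.
have tS k : t k.+1 = t k + D by rewrite /t -natr1; ring.
have tlt k : t k < t k.+1 by rewrite tS ltrDl.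
have tL (k : 'I_N) : - L <= t k <= L.
  apply/andP; split; first by rewrite /t lerDl mulr_ge0// ltW.
  rewrite -[leRHS]tN /t lerD2l ler_pM2r// ler_nat; exact: ltnW.
have tSL (k : 'I_N) : t k.+1 <= L.
  rewrite -[leRHS]tN /t lerD2l ler_pM2r// ler_nat; exact: ltn_ord.
clearbody t.
pose W x y := \sum_(k < N) v (t k) e * pharm x y (t k) (t k.+1).
have cV k : 0 < v (t k) e <= V.
  by have := vpos (t k) 0 (lexx _); have := VH (t k) 0; rewrite add0r lexx ler01 => /(_ isT) -> ->.
have sumN (c : R) : \sum_(k < N) c = N%:R * c.
  by rewrite sumr_const card_ord -[c *+ N]mulr_natl.
have [U U0 UH] := @atan_near_pi2 R (d / V) (divr_gt0 d0 V_gt0).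
(* In order: y + e stays below e + 1, where [V] bounds v; y stays within the modulus of continuity
   [rho]; the escaping harmonic measure is small at distance [rho] inside [-L, L]; the far cells of
   [step_sum_close] are small. *)
have [y1 y10 [y11 y12 y13 y14]] : exists2 y1 : R, 0 < y1 &
    [/\ y1 <= 1, y1 <= rho / 2, y1 <= rho / U / 2 & y1 <= d * rho ^+ 2 / (8 * L * V)].
  exists (Num.min (Num.min 1 (rho / 2)) (Num.min (rho / U / 2) (d * rho ^+ 2 / (8 * L * V)))).
    by rewrite !lt_min ltr01 !divr_gt0 ?mulr_gt0 ?exprn_gt0.
  by rewrite !ge_min !lexx !orbT.
have omega (x y : R) : 0 < y -> \sum_(k < N) pharm x y (t k) (t k.+1) = pharm x y (- L) L.
  by move=> y0; rewrite pharm_sum t0 tN.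
have bd (x y : R) : 0 < y -> y <= y1 -> `|v x (y + e) - W x y| <= 4 * d.
  move=> y0 yy1; have [yl1 yl2] := (le_trans yy1 y11, le_trans yy1 y12).
  have [yl3 yl4] := (le_trans yy1 y13, le_trans yy1 y14).
  have y01 : 0 <= y <= 1 by rewrite ltW.
  have wV := VH x y y01; have w0 := vpos x y (ltW y0).
  (* The value v(x, y + e) is split by the harmonic measure of [-L, L] and that of its
     complement. *)
  have -> : v x (y + e) - W x y =
      \sum_(k < N) (v x (y + e) - v (t k) e) * pharm x y (t k) (t k.+1) +
      v x (y + e) * (1 - pharm x y (- L) L).
    rewrite -omega// mulrBr mulr1 mulr_sumr /W.
    have -> : \sum_(k < N) (v x (y + e) - v (t k) e) * pharm x y (t k) (t k.+1) =
        \sum_(k < N) v x (y + e) * pharm x y (t k) (t k.+1) -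
        \sum_(k < N) v (t k) e * pharm x y (t k) (t k.+1).
      by rewrite -sumrB; apply: eq_bigr => k _; ring.
    by ring.
  have h1 : `|\sum_(k < N) (v x (y + e) - v (t k) e) * pharm x y (t k) (t k.+1)| <= 2 * d.
    apply: (@step_sum_close _ N t (fun k => v (t k) e) x y L D rho d V) => //.
    - by rewrite w0.
    - move=> k xt; apply: ltW; apply: (rhoH (t k) e x (y + e)) => //.
      + by have /andP[tk1 tk2] := tL k; apply/andP; split; clear -tk1 tk2 R0L; lra.
      + by rewrite lexx/= lerDl.
      + by rewrite addrK gtr0_norm//; clear -yl2 rho0; lra.
    - move: yl4; rewrite ler_pdivlMr ?mulr_gt0// => h.
      rewrite ler_pdivrMr ?exprn_gt0//.
      have : 0 <= L * V * y by rewrite !mulr_ge0// ltW.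
      by clear -h; nra.
  have p1 := pharm_le1 x y (- L) L.
  have p0 : 0 <= pharm x y (- L) L by apply: pharm_ge0 => //; clear -L0; lra.
  have h2 : `|v x (y + e) * (1 - pharm x y (- L) L)| <= 2 * d.
    rewrite ger0_norm ?mulr_ge0 ?subr_ge0 ?(ltW w0)//.
    (* Well inside [-L, L] the complement has harmonic measure at most d / V. Elsewhere v itself is
       at most 2 d: by decay, or by comparison with height e at x or at the nearest endpoint, where
       v <= d. *)
    have [xL|xL] := leP `|x| (L - rho).
      have Uy : U <= rho / y.
        rewrite ler_pdivlMr// mulrC.
        have : y * U <= rho / U / 2 * U by rewrite ler_wpM2r// ltW.
        have -> : rho / U / 2 * U = rho / 2 by field; rewrite gt_eqF.
        by clear -rho0; lra.
      have h := pharm_complement_small y0 (divr_gt0 d0 V_gt0) UH Uy xL.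
      have : v x (y + e) * (1 - pharm x y (- L) L) <= V * (d / V).
        by apply: ler_pM; rewrite ?subr_ge0// ltW.
      have VdV : V * (d / V) = d by field; rewrite gt_eqF.
      by rewrite VdV; clear -d0; lra.
    have : v x (y + e) <= 2 * d.
      have ye : `|y + e - e| < rho by rewrite addrK gtr0_norm//; clear -yl2 rho0; lra.
      have ine : e <= e <= e + 1 by rewrite lexx/= lerDl.
      have [Rx|xR] := leP R0 `|x|.
        have := R0H x (y + e) ltac:(clear -y0 e0; lra) (or_introl Rx).
        by have := ler_norm (v x (y + e)); clear -d0; lra.
      have [Lx|Lx] := leP L `|x|.
        have xRn : - R0 <= x <= R0 by rewrite -ler_norml ltW.
        have xxn : `|x - x| < rho by rewrite subrr normr0.
        have := rhoH x e x (y + e) xRn ine xxn ye.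
        by rewrite /= ltr_norml => /andP[_]; have := vL x Lx; clear -d0; lra.
      have [x0|x0] := leP 0 x.
        rewrite ger0_norm// in xL Lx.
        have LR : - R0 <= L <= R0 by apply/andP; split; clear -R0L L0; lra.
        have xLn : `|x - L| < rho by rewrite ltr_norml; apply/andP; split; clear -xL Lx rho0; lra.
        have := rhoH L e x (y + e) LR ine xLn ye; rewrite /= ltr_norml => /andP[_].
        by have := vL L (ler_norm L); clear -d0; lra.
      rewrite ltr0_norm// in xL Lx.
      have LR : - R0 <= - L <= R0 by apply/andP; split; clear -R0L L0; lra.
      have xLn : `|x - - L| < rho by rewrite ltr_norml; apply/andP; split; clear -xL Lx rho0; lra.
      have := rhoH (- L) e x (y + e) LR ine xLn ye; rewrite /= ltr_norml => /andP[_].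
      have vLm : v (- L) e <= d by apply: vL; rewrite normrN ler_norm.
      by clear -d0 vLm; lra.
    by move=> h; have : v x (y + e) * (1 - pharm x y (- L) L) <= v x (y + e);
      [rewrite ler_piMr ?(ltW w0)//; clear -p0; lra|move: h; clear; lra].
  apply: le_trans (ler_normD _ _) _; move: h1 h2; clear.
  by move: (`|_|) (`|_|) => a b; lra.
(* Chosen so that 2 L V / (R2 - L) <= d, the bound of [step_sum_far]. *)
pose R2 := R0 + L + 2 * L * V / d + 1.
have LV0 : 0 < 2 * L * V / d by rewrite divr_gt0// !mulr_gt0.
have far (x y : R) : 0 < y -> R2 <= `|x| \/ R2 <= y -> `|v x (y + e) - W x y| <= 4 * d.
  move=> y0 H.
  have w1 : `|v x (y + e)| <= d.
    apply: R0H; first by clear -y0 e0; lra.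
    by case: H => H; [left|right]; move: H; rewrite /R2; clear -LV0 L0 e0; lra.
  have R2L : 0 < R2 - L by rewrite /R2; clear -LV0 R0L L0; lra.
  have /andP[W0 W1] : 0 <= W x y <= 2 * L * V / (R2 - L).
    apply: (@step_sum_far _ N t (fun k => v (t k) e) x y L D V (R2 - L)) => //.
    - by move=> k; have /andP[? _] := tL k; split; [|exact: tSL].
    - case: H => H; [left|right]; first by rewrite addrC subrK.
      by clear -H L0; lra.
  have W2 : 2 * L * V / (R2 - L) <= d.
    rewrite ler_pdivrMr//.
    have -> : d * (R2 - L) = d * (R0 + 1) + 2 * L * V by rewrite /R2; field; rewrite gt_eqF.
    have R010 : 0 <= d * (R0 + 1) by apply: mulr_ge0; clear -d0 R0L L0; lra.
    by rewrite lerDr.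
  apply: le_trans (ler_normB _ _) _; rewrite (ger0_norm W0).
  by move: w1 (le_trans W1 W2) d0; clear; move: (`|_|) (W x y) => a b; lra.
move=> x y y0.
have [yy|yy] := leP y y1; first exact: (bd x y y0 yy).
have [xR|xR] := leP R2 `|x|; first exact: far y0 (or_introl xR).
have [yR|yR] := leP R2 y; first exact: far y0 (or_intror yR).
have R20 : 0 < R2 by rewrite /R2; clear -LV0 R0L L0; lra.
clearbody R2.
pose X' := [seq (p.1, p.2 - e) | p <- X].
have hh (x' y' : R) : 0 < y' -> (x', y') \notin X' ->
    harmonic_at (fun x y => v x (y + e)) x' y' /\ harmonic_at W x' y'.
  move=> y'0 nX; split.
    have ye0 : 0 < y' + e by rewrite addr_gt0.
    have nX' : (x', y' + e) \notin X.
      apply: contra nX => nX; apply/mapP; exists (x', y' + e) => //=.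
      by rewrite addrK.
    have [c c1 c2] := nev_harm nv ye0 nX'.
    exists c; first exact: c1.
    exact: (second_deriv_shift c2).
  apply: (@harmonic_sum _ _ _ (fun (k : 'I_N) x y => v (t k) e * pharm x y (t k) (t k.+1))) => k _.
  exact: harmonicZ (harmonic_pharm _ _ _ y'0).
have hcv (p : R * R) : 0 < p.2 -> {for p, continuous (fun p : R * R => v p.1 (p.2 + e))}.
  move=> p2; apply: (@continuous_shift_snd _ (fun p : R * R => v p.1 p.2)).
  by apply: (nev_cont nv); left; rewrite /= addr_gt0.
have hcW (p : R * R) : 0 < p.2 -> {for p, continuous (fun p : R * R => W p.1 p.2)}.
  move=> p2; apply: (@continuous_sum _ _ _ _ (fun (k : 'I_N) (p : R * R) => v (t k) e * pharm p.1 p.2 (t k) (t k.+1))) => k.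
  by apply: continuousM; [exact: cst_continuous|exact: continuous_pharm].
have inR : - R2 <= x <= R2 by rewrite -ler_norml ltW.
have iny : y1 <= y <= R2 by rewrite !ltW.
have edge (x' y' : R) : - R2 <= x' <= R2 -> y1 <= y' <= R2 ->
    (x' == - R2) || (x' == R2) || (y' == y1) || (y' == R2) -> `|v x' (y' + e) - W x' y'| <= 4 * d.
  move=> _ /andP[yl _]; have y'0 : 0 < y' by exact: lt_le_trans yl.
  case/orP => [/orP[/orP[]|]|] /eqP E.
  - by apply: far => //; left; rewrite E normrN gtr0_norm.
  - by apply: far => //; left; rewrite E gtr0_norm.
  - by apply: bd => //; rewrite E.
  - by apply: far => //; right; rewrite E.
rewrite ler_norml lerNl; apply/andP; split.
  rewrite opprB.
  apply: (@max_principle_all _ (fun x y => W x y - v x (y + e)) X' (4 * d) R2 y1 R2) => //.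
  - move=> p _ /andP[p2 _]; have p20 : 0 < p.2 by exact: lt_le_trans p2.
    exact: continuousB (hcW p p20) (hcv p p20).
  - move=> x' y' _ /andP[y'1 _] nX; have [|h1 h2] := hh x' y' _ nX; first exact: lt_trans y'1.
    have := harmonicD h2 (harmonicZ (-1) h1).
    by under [X in harmonic_at X]eq2_fun do rewrite mulN1r.
  - by move=> x' y' h1 h2 /(edge _ _ h1 h2); rewrite distrC; exact: le_trans (ler_norm _).
apply: (@max_principle_all _ (fun x y => v x (y + e) - W x y) X' (4 * d) R2 y1 R2) => //.
- move=> p _ /andP[p2 _]; have p20 : 0 < p.2 by exact: lt_le_trans p2.
  exact: continuousB (hcv p p20) (hcW p p20).
- move=> x' y' _ /andP[y'1 _] nX; have [|h1 h2] := hh x' y' _ nX; first exact: lt_trans y'1.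
  have := harmonicD h1 (harmonicZ (-1) h2).
  by under [X in harmonic_at X]eq2_fun do rewrite mulN1r.
- by move=> x' y' h1 h2 /(edge _ _ h1 h2); exact: le_trans (ler_norm _).
Qed.

(** * The representing measure *)

(** Each cell is replaced by a point mass at its left end. The kernel is 1 / y^2-Lipschitz and cells
    are no longer than d, which accounts for the error M0 d / y^2. *)
Lemma poisson_approximation (R : realType) (v : R -> R -> R) L X :
  nevanlinna v L X ->
  exists2 M0 : R, 0 <= M0 & forall d : R, 0 < d -> d <= 1 ->
    exists (e : R) (N : nat) (t m : nat -> R),
      [/\ 0 < e <= d, forall k : 'I_N, - L <= t k <= L, forall k : 'I_N, 0 <= m k,
          \sum_(k < N) m k <= M0 &
          forall x y : R, 0 < y ->
            `|v x (y + e) - \sum_(k < N) m k * poisson x y (t k)| <= 4 * d + M0 * d / y ^+ 2].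
Proof.
move=> nv; have L0 := nev_L nv.
have [M1 M10 M1H] : exists2 V : R, 0 <= V & forall x y : R, 0 <= x <= 0 -> 1 <= y <= 2 ->
    v x y <= V.
  by apply: (@box_bounded _ (fun p => v p.1 p.2)) => p _ /andP[p2 _]; apply: (nev_cont nv); left; lra.
have L2 : 0 < L ^+ 2 + 1 by rewrite ltr_wpDl// sqr_ge0.
(* Total mass is read off at the point i: the kernel there is at least 1 / (L^2 + 1) on [-L, L], and
   the sum of cells is at most v(0, 1 + e) + 4 d <= M1 + 4. *)
exists ((L ^+ 2 + 1) * (M1 + 4)); first by rewrite mulr_ge0//; lra.
move=> d d0 d1; have [e /andP[e0 ed] eH] := choose_height nv d0.
have [N [N0 Nd NH]] := step_approximation nv d0 e0 eH.
move: NH; set D := 2 * L / N%:R => /=; set t := fun k : nat => - L + k%:R * D => NH.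
have NR : 0 < N%:R :> R by rewrite ltr0n.
have D0 : 0 < D by rewrite divr_gt0// mulr_gt0.
have ND : N%:R * D = 2 * L by rewrite /D mulrC divfK// gt_eqF.
have tS k : t k.+1 = t k + D by rewrite /t -natr1; ring.
have tb (k : nat) : (k <= N)%N -> - L <= t k <= L.
  move=> kN; have h1 : 0 <= k%:R * D by rewrite mulr_ge0 ?ler0n// ltW.
  have h2 : k%:R * D <= N%:R * D by rewrite ler_pM2r// ler_nat.
  by rewrite /t; move: h1 h2; rewrite ND; clear; lra.
have pi0 := pi_gt0 R.
pose c k := v (t k) e; have c0 k : 0 < c k by exact: (nev_pos nv).
have Dpi : 0 < D / pi by rewrite divr_gt0.
pose m k := c k * (D / pi); have m0 k : 0 <= m k by exact: ltW (mulr_gt0 (c0 k) Dpi).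
have mM : \sum_(k < N) m k <= (L ^+ 2 + 1) * (M1 + 4).
  have h := NH 0 1 ltr01.
  have h1 : v 0 (1 + e) <= M1 by apply: M1H; rewrite ?lexx//; lra.
  have h2 : \sum_(k < N) c k * pharm 0 1 (t k) (t k.+1) <= M1 + 4.
    move: h; rewrite -/(\sum_(k < N) c k * pharm 0 1 (t k) (t k.+1)) ler_norml => /andP[h _].
    by move: h1 h d1; clear; lra.
  rewrite mulrC -ler_pdivrMr//; apply: le_trans h2; rewrite mulr_suml.
  apply: ler_sum => k _; have [|s /andP[s1 s2] ->] := pharm_poisson 0 ltr01 (_ : t k < t k.+1).
    by rewrite tS ltrDl.
  rewrite (_ : t k.+1 - t k = D); last by rewrite tS; ring.
  rewrite /m -(mulrA (c k)) (ler_pM2l (c0 k)) (ler_pM2l Dpi) /poisson mul1r lef_pV2 ?posrE//; last first.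
    by rewrite ltr_wpDl// ?sqr_ge0// expr1n.
  have /andP[u1 _] := tb k (ltnW (ltn_ord k)); have /andP[_ u2] := tb k.+1 (ltn_ord k).
  rewrite expr1n lerD2r sub0r sqrrN -[s ^+ 2]real_normK ?num_real// lerXn2r ?nnegrE ?normr_ge0 ?(ltW L0)//.
  by rewrite ler_norml; move: s1 s2 u1 u2; clear; lra.
exists e, N, t, m; split=> //; first by rewrite e0.
  by move=> k; exact: tb (ltnW (ltn_ord k)).
move=> x y y0; have h := NH x y y0; have y20 : 0 < y ^+ 2 by rewrite exprn_gt0.
have h2 : `|\sum_(k < N) c k * pharm x y (t k) (t k.+1) - \sum_(k < N) m k * poisson x y (t k)|
    <= (L ^+ 2 + 1) * (M1 + 4) * d / y ^+ 2.
  rewrite -sumrB; apply: (le_trans (ler_norm_sum _ _ _)).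
  apply: (@le_trans _ _ (\sum_(k < N) m k * (d / y ^+ 2))); last first.
    by rewrite -mulr_suml mulrA ler_pM2r ?invr_gt0// ler_pM2r.
  apply: ler_sum => k _; have [|s /andP[s1 s2] ->] := pharm_poisson x y0 (_ : t k < t k.+1).
    by rewrite tS ltrDl.
  rewrite mulrA (_ : t k.+1 - t k = D); last by rewrite tS; ring.
  rewrite -/(m k) -mulrBr normrM ger0_norm// ler_wpM2l//.
  apply: (le_trans (poisson_lip _ _ _ y0)); rewrite ler_pM2r ?invr_gt0//.
  rewrite gtr0_norm ?subr_gt0//; move: s2 Nd; rewrite tS -/D; clear; lra.
rewrite (_ : v x (y + e) - _ = (v x (y + e) - \sum_(k < N) c k * pharm x y (t k) (t k.+1)) +
  (\sum_(k < N) c k * pharm x y (t k) (t k.+1) - \sum_(k < N) m k * poisson x y (t k))); last by ring.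
by apply: (le_trans (ler_normD _ _)); apply: lerD.
Qed.

(* Abel summation: moving a distribution function within one step changes a
   Riemann sum of a Lipschitz function by at most the mesh. *)
Lemma abel_sum_bound (R : realType) (a g : nat -> R) (J : nat) (B : R) :
  g 0%N = 0 -> g J = 0 -> (forall j, 0 <= g j) ->
  (forall j, `|a j.+1 - a j| <= B) ->
  `|\sum_(j < J) a j * (g j.+1 - g j)| <= B * \sum_(j < J) g j.+1.
Proof.
move=> g0 gJ gp aB.
have -> : \sum_(j < J) a j * (g j.+1 - g j) =
    a J * g J - a 0%N * g 0%N - \sum_(j < J) g j.+1 * (a j.+1 - a j).
  clear; elim: J => [|J IH]; first by rewrite !big_ord0; ring.
  by rewrite !big_ord_recr /= IH; ring.
rewrite g0 gJ !mulr0 subrr sub0r normrN; apply: (le_trans (ler_norm_sum _ _ _)).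
rewrite mulr_sumr; apply: ler_sum => j _.
by rewrite normrM ger0_norm// mulrC ler_wpM2r.
Qed.

(** [I] is any additive function of intervals, so that one estimate covers both the finite sums of
    point masses and the integral against the limit measure. *)
Lemma riemann_sum_close (R : realType) (I : R -> R -> R) (phi G : R -> R) (C h s0 : R) (J : nat) :
  let s j := s0 + j%:R * h in
  0 <= h -> 0 <= C -> (forall a b, a <= b -> G a <= G b) -> (forall a, I a a = 0) ->
  (forall a b c, a <= b -> b <= c -> I a c = I a b + I b c) ->
  (forall a b, a <= b -> `|I a b - phi a * (G b - G a)| <= C * (b - a) * (G b - G a)) ->
  `|I s0 (s J) - \sum_(j < J) phi (s j) * (G (s j.+1) - G (s j))| <= C * h * (G (s J) - G s0).
Proof.
move=> s h0 C0 Gm I0 Ia Ic.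
have sS j : s j.+1 = s j + h by rewrite /s -natr1; ring.
have s0E : s 0%N = s0 by rewrite /s mul0r addr0.
have sge j : s0 <= s j by rewrite lerDl mulr_ge0 ?ler0n.
elim: J => [|J IH]; first by rewrite s0E I0 big_ord0 !subrr normr0 mulr0.
have le : s J <= s J.+1 by rewrite sS lerDl.
rewrite (Ia s0 (s J)) // big_ord_recr /=.
rewrite (_ : _ - _ = (I s0 (s J) - \sum_(j < J) phi (s j) * (G (s j.+1) - G (s j))) +
  (I (s J) (s J.+1) - phi (s J) * (G (s J.+1) - G (s J)))); last by ring.
apply: (le_trans (ler_normD _ _)); have := Ic _ _ le.
rewrite (_ : s J.+1 - s J = h); last by rewrite sS; ring.
move=> {}Ic; apply: (le_trans (lerD IH Ic)).
by rewrite -mulrDr [_ - G s0 + _]addrC addrA subrK.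
Qed.

(** Helly selection without a diagonal subsequence: along an ultrafilter finer than [\oo] each
    bounded sequence converges, hence the limit exists at all real s at once. *)
Lemma ultrafilter_limits (R : realType) (Fn : nat -> R -> R) (M0 : R) :
  (forall n s, 0 <= Fn n s <= M0) ->
  exists (U : set_system nat) (F : R -> R),
    [/\ ProperFilter U, \oo `<=` U & forall s, Fn n s @[n --> U] --> F s].
Proof.
move=> Fb; have [U [UU sU]] := @ultraFilterLemma _ (\oo : set_system nat) _.
have lims s : exists p : R, Fn n s @[n --> U] --> p.
  have := @segment_compact _ 0 M0; rewrite compact_ultra.
  have UF : UltraFilter (Fn n s @[n --> U]).
    split=> [|H HP sH]; first exact: fmap_proper_filter.
    apply/seteqP; split=> // A HA; have [//|nA] := in_ultra_setVsetC [set n | A (Fn n s)] UU.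
    have hn : H (~` A) by apply: sH.
    have H0 : H set0 by rewrite -(setICr A); exact: filterI.
    by have := @filter_not_empty _ H HP; move=> /(_ H0).
  move=> /(_ _ UF) []; last by move=> p [_ ?]; exists p.
  by apply: (@filterE _ U) => n; rewrite /= in_itv /=; exact: Fb.
have [F FH] := choice lims.
by exists U, F; split=> //; case: UU.
Qed.

(** A pointwise limit of distribution functions is monotone but may fail to be right-continuous.
    Taking infima from the right repairs this, and the sandwich between values of [F] controls the
    change. *)
Lemma right_limit_cdf (R : realType) (F : R -> R) :
  (forall a b, a <= b -> F a <= F b) ->
  exists G : R -> R,
    [/\ nondecreasing G, right_continuous G & forall a b, a < b -> F a <= G a <= F b].
Proof.
move=> Fm; pose A s := [set F u | u in `]s, +oo[].
have Alb s : has_lbound (A s).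
  by exists (F s) => _ [u /= us <-]; apply/Fm/ltW; move: us; rewrite in_itv /= andbT.
have A0 s : A s !=set0 by exists (F (s + 1)), (s + 1) => //; rewrite /= in_itv /= andbT ltrDl.
pose G s := inf (A s).
have GF a b : a < b -> F a <= G a <= F b.
  move=> ab; apply/andP; split.
    apply: lb_le_inf => // _ [u /= us <-]; apply/Fm/ltW.
    by move: us; rewrite in_itv /= andbT.
  by apply: ge_inf => //; exists b => //; rewrite /= in_itv /= andbT.
have Gad s (e : R) : 0 < e -> exists2 u, s < u & F u < G s + e.
  move=> e0; have [_ [u /= us <-] ue] := inf_adherent e0 (conj (A0 s) (Alb s)).
  by exists u => //; move: us; rewrite in_itv /= andbT.
have Gm : nondecreasing G.
  move=> a b ab; apply/ler_addgt0Pr => e e0; have [u bu ue] := Gad b e e0.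
  by apply: (le_trans _ (ltW ue)); have /andP[] := GF a u (le_lt_trans ab bu).
exists G; split=> // s; apply/cvgrPdist_lt => e e0.
have [u su ue] := Gad s e e0; near=> x.
have sx : s < x by near: x; exact: nbhs_right_gt.
have xu : x < u by near: x; exact: nbhs_right_lt.
have h1 := Gm _ _ (ltW sx); have /andP[_ h2] := GF x u xu.
by rewrite distrC ger0_norm ?subr_ge0// ltrBlDl (le_lt_trans h2).
Unshelve. all: end_near. Qed.

Lemma finite_measure_of (d : measure_display) (T : measurableType d) (R : realType) (nu : {measure set T -> \bar R}) :
  (nu setT < +oo)%E -> exists mu : {finite_measure set T -> \bar R}, forall A, mu A = nu A.
Proof.
move=> nuT; exists (mfrestr measurableT nuT) => A.
exact: (congr1 nu (setIT A)).
Qed.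

(** The Lebesgue-Stieltjes measure of the right-continuous [G], pushed to the real axis of the
    plane. The margin 1 leaves room for the half-open intervals that exhaust the complement. *)
Lemma stieltjes_line (R : realType) (F : R -> R) (L M : R) :
  (forall a b, a <= b -> F a <= F b) ->
  (forall s, s < - L -> F s = 0) -> (forall s, L <= s -> F s = M) -> 0 < L ->
  exists (mu : {finite_measure set (R * R)%type -> \bar R}) (G : R -> R),
    [/\ mu (~` (`[- L - 1, L + 1] `*` [set 0])) = 0%E,
        forall a b, a <= b -> mu (`]a, b] `*` setT) = (G b - G a)%:E,
        nondecreasing G & forall a b, a < b -> F a <= G a <= F b].
Proof.
move=> Fm F0 FM L0; have [G [Gm Gc GF]] := right_limit_cdf Fm.
pose gm := isCumulative.Build R _ R G Gm Gc.
pose Gp : cumulative R R := HB.pack G gm.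
pose ls := lebesgue_stieltjes_measure Gp.
have lsE a b : a <= b -> ls `]a, b]%classic = (G b - G a)%:E.
  move=> ab; rewrite /ls /lebesgue_stieltjes_measure /measure_extension.
  by rewrite measurable_mu_extE /=; [rewrite wlength_itv_bnd|exact: is_ocitv].
have G0 s : s < - L -> G s = 0.
  move=> sL; have [h1 h2] : s < (s - L) / 2 /\ (s - L) / 2 < - L by split; lra.
  have := GF _ _ h1; rewrite !F0// => /andP[? ?]; by apply/eqP; rewrite eq_le; apply/andP.
have G1 s : L <= s -> G s = M.
  move=> sL; have h1 : s < s + 1 by rewrite ltrDl.
  have := GF _ _ h1; rewrite !FM//; last by rewrite (le_trans sL)// lerDl.
  by move=> /andP[? ?]; apply/eqP; rewrite eq_le; apply/andP.
have ls0 : ls (~` `[- L - 1, L + 1]%classic) = 0%E.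
  apply: measure_negligible; first by apply: measurableC; exact: measurable_itv.
  pose A n : set (measurableTypeR R) := `]- L - 1 - n%:R, - L - 1]%classic `|` `]L + 1, L + 1 + n%:R]%classic.
  have mA n : measurable (A n) by apply: measurableU; exact: measurable_itv.
  have far (a x : R) : exists n : nat, a - n%:R < x /\ x <= a + n%:R.
    exists (Num.bound `|x - a|); have := archi_boundP (normr_ge0 (x - a)).
    by rewrite ltr_norml => /andP[? ?]; split; lra.
  apply: (@negligibleS _ _ _ ls (\bigcup_n A n)).
    move=> x /= /negP; rewrite in_itv /= negb_and -!ltNge => /orP[h|h].
      by have [n [h1 _]] := far (- L - 1) x; exists n => //; left; rewrite /= in_itv /= h1 ltW.
    by have [n [_ h1]] := far (L + 1) x; exists n => //; right; rewrite /= in_itv /= h1 h.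
  apply: negligible_bigcup => n; apply: negligibleU; apply/negligibleP; try exact: measurable_itv.
    have n0 := ler0n R n; apply: (etrans (lsE _ _ _)); first by rewrite gerBl.
    by rewrite !G0 ?subrr//; lra.
  have n0 := ler0n R n; apply: (etrans (lsE _ _ _)); first by rewrite lerDl.
  by rewrite !G1 ?subrr//; lra.
pose g := fun x : measurableTypeR R => (x, 0) : R * R.
have mg : measurable_fun setT g.
  by apply: measurable_fun_pair => //; exact: measurable_id.
pose nu0 : {measure set (R * R) -> \bar R} := pushforward ls g.
pose nu := nu0 mg.
have nuT : (nu setT < +oo)%E.
  rewrite (_ : nu setT = ls setT)//; apply: (@le_lt_trans _ _ (ls `]- L - 2, L + 1]%classic)); last by rewrite lsE ?ltry//; lra.
  rewrite -[leRHS]adde0 -ls0; apply: (le_trans _ (measureU2 _ _ _)) => //.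
  - apply: (le_measure ls); rewrite ?inE.
    + exact: measurableT.
    + by apply: measurableU; [exact: measurable_itv|apply: measurableC; exact: measurable_itv].
    + move=> x _; have [h|h] := pselect (`[- L - 1, L + 1]%classic x); last by right.
      by left; move: h; rewrite /= !in_itv /= => /andP[h1 h2]; rewrite h2 andbT; lra.
  - by apply: measurableC; exact: measurable_itv.
have [mu muE] := finite_measure_of nuT.
exists mu, G; split => //.
  rewrite muE -ls0; congr (ls _); apply/seteqP; split=> x /= h.
    by move=> h2; apply: h; split.
  by move=> [h2 _]; apply: h.
move=> a b ab; rewrite muE -lsE//; congr (ls _); apply/seteqP; split=> x /=.
  by move=> [].
by move=> h; split.
Qed.

Lemma lipschitz_continuous (R : realType) (phi : R -> R) (C : R) : 0 <= C ->
  (forall s t, `|phi s - phi t| <= C * `|s - t|) -> continuous phi.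
Proof.
move=> C0 lip s; apply/cvgrPdist_lt => e e0.
have C1 : 0 < C + 1 by rewrite ltr_wpDl.
near=> t; apply: (le_lt_trans (lip _ _)).
apply: (@le_lt_trans _ _ ((C + 1) * `|s - t|)); first by rewrite ler_wpM2r// lerDl.
rewrite mulrC -ltr_pdivlMr//; near: t.
by apply: cvgr_dist_lt => //; rewrite divr_gt0.
Unshelve. all: end_near. Qed.

Lemma integrable_bounded (R : realType) (mu : {finite_measure set (R * R)%type -> \bar R})
    (A : set (R * R)) (h : R * R -> R) (B : R) :
  measurable A -> measurable_fun A h -> (forall p, A p -> `|h p| <= B) ->
  mu.-integrable A (EFin \o h).
Proof.
move=> mA mh hB; have iB := finite_measure_integrable_cst mu B mA.
apply: (le_integrable mA _ _ iB); first exact/measurable_EFinP.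
by move=> p Ap; rewrite /= lee_fin (le_trans (hB _ Ap))// ler_norm.
Qed.

Lemma le_Rintegral_bounded (R : realType) (mu : {finite_measure set (R * R)%type -> \bar R})
    (A : set (R * R)) (h : R * R -> R) (B : R) :
  measurable A -> measurable_fun A h -> (forall p, A p -> `|h p| <= B) ->
  `|\int[mu]_(p in A) h p| <= B * fine (mu A).
Proof.
move=> mA mh hB; have ih := integrable_bounded mu mA mh hB.
apply: (le_trans (le_normr_Rintegral mA ih)).
rewrite -Rintegral_cst//; apply: le_Rintegral => //.
- exact: integrable_norm.
- by apply: finite_measure_integrable_cst.
Qed.

Lemma sum_itv_split (R : realType) (N : nat) (t g : 'I_N -> R) (a b c : R) :
  a <= b -> b <= c ->
  \sum_(k < N | a < t k <= c) g k =
  \sum_(k < N | a < t k <= b) g k + \sum_(k < N | b < t k <= c) g k.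
Proof.
move=> ab bc; rewrite (bigID (fun k => t k <= b)) /=; congr (_ + _); apply: eq_bigl => k.
  by case: (leP (t k) b) => h; rewrite ?andbF ?andbT// (le_trans h bc) andbT.
rewrite -ltNge; case: (ltP b (t k)) => h; rewrite ?andbF ?andbT//.
by rewrite (le_lt_trans ab h).
Qed.

Lemma sum_le_split (R : realType) (N : nat) (t g : 'I_N -> R) (a b : R) : a <= b ->
  \sum_(k < N | t k <= b) g k = \sum_(k < N | t k <= a) g k + \sum_(k < N | a < t k <= b) g k.
Proof.
move=> ab; rewrite (bigID (fun k => t k <= a)) /=; congr (_ + _); apply: eq_bigl => k.
  by case: (leP (t k) a) => h; rewrite ?andbF ?andbT// (le_trans h ab).
by rewrite -ltNge andbC.
Qed.

Lemma cvg_sum_ord (R : realType) (U : set_system nat) (J : nat) (g : nat -> nat -> R) (l : nat -> R) :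
  Filter U -> (forall j, g j n @[n --> U] --> l j) ->
  (fun n => \sum_(j < J) g j n) @ U --> \sum_(j < J) l j.
Proof.
move=> FU gl; elim: J => [|J IH].
  rewrite big_ord0 (_ : (fun n => _) = (fun=> 0)); first exact: cvg_cst.
  by apply/funext => n; rewrite big_ord0.
rewrite big_ord_recr /= (_ : (fun n => _) = (fun n => \sum_(j < J) g j n + g J n)).
  exact: cvgD.
by apply/funext => n; rewrite big_ord_recr.
Qed.

(** The measure is built from an ultrafilter limit, before any test function is given. A limit along
    [\oo] is also a limit along the finer [U], so it has to agree with the integral. *)
Lemma weak_limit (R : realType) (L M0 : R) (N : nat -> nat) (t m : nat -> nat -> R) :
  0 < L -> (forall n (k : 'I_(N n)), - L <= t n k <= L) ->
  (forall n (k : 'I_(N n)), 0 <= m n k) -> (forall n, \sum_(k < N n) m n k <= M0) ->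
  exists2 mu : {finite_measure set (R * R)%type -> \bar R},
    mu (~` (`[- L - 1, L + 1] `*` [set 0])) = 0%E &
    forall (phi : R -> R) (B C l : R), 0 <= C -> (forall s, `|phi s| <= B) ->
      (forall s t, `|phi s - phi t| <= C * `|s - t|) ->
      (fun n => \sum_(k < N n) m n k * phi (t n k)) @ \oo --> l ->
      \int[mu]_p phi p.1 = l.
Proof.
move=> L0 tb m0 mM; pose Fn n s := \sum_(k < N n | t n k <= s) m n k.
have Fn0 n s : 0 <= Fn n s by apply: sumr_ge0 => k _; exact: m0.
have Fnm n a b : a <= b -> Fn n a <= Fn n b.
  move=> ab; rewrite /Fn (big_mkcond (fun k : 'I_(N n) => t n k <= a)) (big_mkcond (fun k : 'I_(N n) => t n k <= b)) /=.
  apply: ler_sum => k _; case: ifPn => [h|_]; first by rewrite (le_trans h).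
  by case: ifP => // _; exact: m0.
have Fnall n s : L <= s -> Fn n s = \sum_(k < N n) m n k.
  by move=> Ls; apply: eq_bigl => k; have /andP[_ h] := tb n k; rewrite (le_trans h).
have FnM n s : 0 <= Fn n s <= M0.
  rewrite Fn0 /= (le_trans _ (mM n))// -(Fnall n (Num.max s L)) ?le_max ?lexx ?orbT//.
  by apply: Fnm; rewrite le_max lexx.
have [U [F [UF sU FU]]] := ultrafilter_limits FnM.
have Fm a b : a <= b -> F a <= F b.
  by move=> ab; apply: (ler_cvg_to (FU a) (FU b)); apply: (@filterE _ U) => n; exact: Fnm.
have F0 s : s < - L -> F s = 0.
  move=> sL; have E : (fun n => Fn n s) = (fun=> 0).
    by apply/funext => n; apply: big_pred0 => k; have /andP[h _] := tb n k; apply/negbTE; rewrite -ltNge; lra.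
  by have := FU s; rewrite E => h; exact: (cvg_unique _ h (cvg_cst 0)).
have FL s : L <= s -> F s = F L.
  move=> Ls; have E : (fun n => Fn n s) = (fun n => Fn n L).
    by apply/funext => n; rewrite !Fnall.
  by have := FU s; rewrite E => h; exact: (cvg_unique _ h (FU L)).
have FM s : 0 <= F s <= M0.
  apply/andP; split; first by apply: (ler_cvg_to (cvg_cst 0) (FU s)); apply: (@filterE _ U).
  apply: (ler_cvg_to (FU s) (cvg_cst M0)); apply: (@filterE _ U) => n.
  by have /andP[] := FnM n s.
have [mu [G [mu0 muG Gm FG]]] := stieltjes_line Fm F0 FL L0.
exists mu => // phi B C l C0 phiB lip lim.
(* Three comparisons, each costing C h M0 on a grid of J steps over [-L - 2, L + 1]: [l] with the
   Riemann sum of [F], that sum with the one of [G], and the latter with the integral. *)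
have main (J : nat) : (0 < J)%N -> `|l - \int[mu]_p phi p.1| <= 3 * C * ((2 * L + 3) / J%:R) * M0.
  move=> J0; set h := (2 * L + 3) / J%:R; pose s (j : nat) := - L - 2 + j%:R * h.
  have JR : 0 < J%:R :> R by rewrite ltr0n.
  have h0 : 0 < h by rewrite divr_gt0//; lra.
  have sJ : s J = L + 1 by rewrite /s /h mulrC divfK ?gt_eqF//; ring.
  have s0 : s 0%N = - L - 2 by rewrite /s mul0r addr0.
  have sS j : s j.+1 = s j + h by rewrite /s -natr1; ring.
  have sum1 n : `|\sum_(k < N n) m n k * phi (t n k) -
      \sum_(j < J) phi (s j) * (Fn n (s j.+1) - Fn n (s j))| <= C * h * M0.
    pose I a b := \sum_(k < N n | a < t n k <= b) m n k * phi (t n k).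
    have := @riemann_sum_close _ I phi (Fn n) C h (- L - 2) J (ltW h0) C0 (Fnm n).
    rewrite -/(s J) sJ => H; have : `|I (- L - 2) (L + 1) -
        \sum_(j < J) phi (s j) * (Fn n (s j.+1) - Fn n (s j))| <=
        C * h * (Fn n (L + 1) - Fn n (- L - 2)).
      apply: H => [a|a b c ab bc|a b ab].
      - by apply: big_pred0 => k; apply/negbTE/negP => /andP[]; rewrite ltNge => /negbTE ->.
      - exact: (@sum_itv_split _ _ (fun k => t n k) (fun k => m n k * phi (t n k))).
      rewrite /Fn (@sum_le_split _ _ (fun k => t n k) _ a b)// addrAC subrr add0r.
      rewrite /I mulr_sumr -sumrB mulr_sumr; apply: (le_trans (ler_norm_sum _ _ _)).
      apply: ler_sum => k /andP[ak kb]; rewrite [phi a * _]mulrC -mulrBr normrM (ger0_norm (m0 _ _)).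
      rewrite mulrC ler_wpM2r//; apply: (le_trans (lip _ _)); rewrite ler_wpM2l//.
      by rewrite ger0_norm; lra.
    have -> : I (- L - 2) (L + 1) = \sum_(k < N n) m n k * phi (t n k).
      by apply: eq_bigl => k; have /andP[? ?] := tb n k; apply/andP; split; lra.
    move=> /le_trans; apply; rewrite (ler_wpM2l (mulr_ge0 C0 (ltW h0)))//.
    by have := FnM n (L + 1); have := Fn0 n (- L - 2) => ? /andP[? ?]; lra.
  have sum2 : `|l - \sum_(j < J) phi (s j) * (F (s j.+1) - F (s j))| <= C * h * M0.
    have cv : (fun n => `|\sum_(k < N n) m n k * phi (t n k) -
        \sum_(j < J) phi (s j) * (Fn n (s j.+1) - Fn n (s j))|) @ U -->
        `|l - \sum_(j < J) phi (s j) * (F (s j.+1) - F (s j))|; last first.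
      by apply: (ler_cvg_to cv (cvg_cst (C * h * M0))); apply: (@filterE _ U) => n; exact: sum1.
    apply: cvg_norm; apply: cvgB; first exact: cvg_trans (cvg_app _ sU) lim.
    apply: (@cvg_sum_ord _ _ _ (fun j n => phi (s j) * (Fn n (s j.+1) - Fn n (s j)))
      (fun j => phi (s j) * (F (s j.+1) - F (s j)))) => j.
    by apply: cvgM; [exact: cvg_cst|apply: cvgB].
  (* Abel summation on G - F, which is nonnegative, at most the next increment of [F], and zero at
     both ends of the grid because [F] is constant there on both sides. *)
  have sum3 : `|\sum_(j < J) phi (s j) * (F (s j.+1) - F (s j)) -
      \sum_(j < J) phi (s j) * (G (s j.+1) - G (s j))| <= C * h * M0.
    have gb j : 0 <= G (s j) - F (s j) <= F (s j.+1) - F (s j).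
      have lt : s j < s j.+1 by rewrite sS ltrDl.
      by have /andP[? ?] := FG _ _ lt; apply/andP; split; lra.
    rewrite -normrN opprB -sumrB.
    have -> : \sum_(j < J) (phi (s j) * (G (s j.+1) - G (s j)) - phi (s j) * (F (s j.+1) - F (s j))) =
        \sum_(j < J) phi (s j) * ((G (s j.+1) - F (s j.+1)) - (G (s j) - F (s j))).
      by apply: eq_bigr => j _; ring.
    apply: (le_trans (@abel_sum_bound _ (phi \o s) (fun j => G (s j) - F (s j)) J (C * h) _ _ _ _)).
    - have /andP[? ?] : F (s 0%N) <= G (s 0%N) <= F (- L - 1) by apply: FG; rewrite s0; lra.
      have e1 : F (- L - 1) = 0 by apply: F0; lra.
      have e2 : F (s 0%N) = 0 by apply: F0; rewrite s0; lra.
      lra.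
    - have /andP[? ?] : F (s J) <= G (s J) <= F (L + 2) by apply: FG; rewrite sJ; lra.
      have e1 : F (L + 2) = F L by apply: FL; lra.
      have e2 : F (s J) = F L by apply: FL; rewrite sJ; lra.
      lra.
    - by move=> j; have /andP[] := gb j.
    - by move=> j; apply: (le_trans (lip _ _)); rewrite sS addrAC subrr add0r gtr0_norm.
    rewrite (ler_wpM2l (mulr_ge0 C0 (ltW h0)))//.
    apply: (@le_trans _ _ (\sum_(j < J) (F (s j.+2) - F (s j.+1)))).
      by apply: ler_sum => j _; have /andP[] := gb j.+1.
    rewrite -(big_mkord xpredT (fun j => F (s j.+2) - F (s j.+1))) telescope_sumr//.
    by have /andP[? ?] := FM (s J.+1); have /andP[? ?] := FM (s 1%N); lra.
  have sum4 : `|\int[mu]_p phi p.1 - \sum_(j < J) phi (s j) * (G (s j.+1) - G (s j))| <= C * h * M0.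
    have cphi : continuous phi := lipschitz_continuous C0 lip.
    have mphi A : measurable_fun A (fun p : R * R => phi p.1).
      apply: measurable_funTS; apply: (measurableT_comp (continuous_measurable_fun cphi)).
      exact: measurable_fst.
    have mA a b : measurable (`]a, b]%classic `*` setT : set (R * R)) by apply: measurableX.
    pose I a b := \int[mu]_(p in `]a, b] `*` setT) phi p.1.
    have := @riemann_sum_close _ I phi G C h (- L - 2) J (ltW h0) C0 Gm.
    rewrite -/(s J) sJ => H; have : `|I (- L - 2) (L + 1) -
        \sum_(j < J) phi (s j) * (G (s j.+1) - G (s j))| <=
        C * h * (G (L + 1) - G (- L - 2)).
      apply: H => [a|a b c ab bc|a b ab].
      - by rewrite /I set_itvoc0 set0X Rintegral_set0.
      - have E : (`]a, c] `*` setT : set (R * R)) = (`]a, b] `*` setT) `|` (`]b, c] `*` setT).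
          apply/seteqP; split=> p /=; rewrite !in_itv /=.
            by move=> [/andP[h1 h2] _]; case: (leP p.1 b) => h3; [left|right]; split; rewrite // ?h1 ?h3.
          by move=> [] [/andP[h1 h2] _]; split; rewrite // ?h1 ?h2 ?andbT /= ?(le_trans h2 bc) ?(le_lt_trans ab h1).
        rewrite /I E Rintegral_setU//.
          by apply: (@integrable_bounded _ _ _ _ B) => //; exact: measurableU.
        apply/disj_set2P/seteqP; split=> // p [[/= h1 _] [/= h2 _]].
        by move: h1 h2; rewrite !in_itv /= => /andP[_ h1] /andP[h2 _]; lra.
      have gE : G b - G a = fine (mu (`]a, b] `*` setT)) by rewrite muG.
      have -> : I a b - phi a * (G b - G a) = \int[mu]_(p in `]a, b] `*` setT) (phi p.1 - phi a).
        rewrite RintegralB//; last 2 first.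
        - by apply: (@integrable_bounded _ _ _ _ B).
        - exact: finite_measure_integrable_cst.
        by rewrite Rintegral_cst// gE.
      rewrite gE; apply: le_Rintegral_bounded => //.
        by apply: measurable_funB.
      move=> p [/= pab _]; apply: (le_trans (lip _ _)); rewrite ler_wpM2l//.
      by move: pab; rewrite in_itv /= => /andP[? ?]; rewrite ger0_norm; lra.
    have -> : I (- L - 2) (L + 1) = \int[mu]_p phi p.1.
      set A : set (R * R) := `]- L - 2, L + 1] `*` setT.
      have mAA : measurable A by exact: mA.
      rewrite -(setUv A) Rintegral_setU//; last 3 first.
      - exact: measurableC.
      - by apply: (@integrable_bounded _ _ _ _ B) => //; rewrite setUv.
      - by apply/disj_set2P; exact: setICr.
      suff Z : \int[mu]_(p in ~` A) phi p.1 = 0 by rewrite Z addr0.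
      apply/eqP; rewrite -normr_le0.
      apply: (le_trans (@le_Rintegral_bounded _ mu _ _ B _ _ _)) => //.
      - exact: measurableC.
      rewrite (_ : mu (~` A) = 0%E) ?mulr0//; apply: subset_measure0 mu0.
      - exact: measurableC.
      - by apply: measurableC; apply: measurableX.
      move=> p pA [/= pE _]; apply: pA; split=> //=; move: pE; rewrite !in_itv /= => /andP[? ?].
      by apply/andP; split; lra.
    move=> /le_trans; apply; rewrite (ler_wpM2l (mulr_ge0 C0 (ltW h0)))//.
    have /andP[g1 _] : F (- L - 2) <= G (- L - 2) <= F (- L - 1) by apply: FG; lra.
    have /andP[_ g2] : F (L + 1) <= G (L + 1) <= F (L + 2) by apply: FG; lra.
    by have /andP[? ?] := FM (- L - 2); have /andP[? ?] := FM (L + 2); lra.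
  move: sum2 sum3 sum4; rewrite [`|\int[mu]_p _ - _|]distrC.
  set S1 := \sum_(j < J) _; set S2 := \sum_(j < J) _; set I := \int[mu]_p _.
  move=> sum2 sum3 sum4; rewrite (_ : l - I = (l - S1) + (S1 - S2) + (S2 - I)); last by ring.
  apply: (le_trans (ler_normD _ _)); apply: (le_trans (lerD (ler_normD _ _) (lexx _))).
  by apply: (le_trans (lerD (lerD sum2 sum3) sum4)); rewrite le_eqVlt; apply/orP; left; apply/eqP; ring.
apply/eqP; rewrite eq_sym -subr_eq0 -normr_eq0; apply/negPn/negP => ne.
set e := `|l - _| in ne main; have e0 : 0 < e by rewrite lt_def ne normr_ge0.
have M00 : 0 <= M0 by have /andP[/le_trans] := FM 0; exact.
pose q := 3 * C * (2 * L + 3) * M0 / e.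
have q0 : 0 <= q by rewrite /q !mulr_ge0 ?invr_ge0 ?(ltW e0)//; lra.
have := archi_boundP q0; set J := Num.bound q => Jq.
have J0 : (0 < J)%N by rewrite -(ltr0n R); exact: le_lt_trans Jq.
have := main J J0; rewrite leNgt => /negP; apply.
rewrite (_ : _ * M0 = 3 * C * (2 * L + 3) * M0 / J%:R); last by ring.
by rewrite ltr_pdivrMr ?ltr0n// -ltr_pdivrMl// mulrC.
Qed.

Lemma poisson_cvg (R : realType) (v : R -> R -> R) L X :
  nevanlinna v L X ->
  exists M0 (N : nat -> nat) (t m : nat -> nat -> R),
    [/\ forall n (k : 'I_(N n)), - L <= t n k <= L, forall n (k : 'I_(N n)), 0 <= m n k,
        forall n, \sum_(k < N n) m n k <= M0 &
        forall x y : R, 0 < y ->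
          (fun n => \sum_(k < N n) m n k * poisson x y (t n k)) @ \oo --> v x y].
Proof.
move=> nv; have [M0 M00 M0H] := poisson_approximation nv.
pose d (n : nat) : R := n.+1%:R^-1.
have d0 n : 0 < d n by rewrite invr_gt0.
have d1 n : d n <= 1 by rewrite invf_le1 ?ler1n.
have [e eH] := choice (fun n => M0H (d n) (d0 n) (d1 n)).
have [N NH] := choice eH; have [t tH] := choice NH; have [m mH] := choice tH.
exists M0, N, t, m; split=> [n|n|n|x y y0]; [by case: (mH n)..|].
have y20 : 0 < y ^+ 2 by rewrite exprn_gt0.
have dc : d @ \oo --> (0 : R) by exact: cvg_harmonic.
have ec : e @ \oo --> (0 : R).
  apply: (squeeze_cvgr _ (cvg_cst 0) dc).
  by apply: nearW => n; case: (mH n) => /andP[/ltW -> ->].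
have vc : (fun n => v x (y + e n)) @ \oo --> v x y.
  have c := @nev_cont _ _ _ _ nv (x, y) (or_introl y0).
  have c2 : (fun n => (x, y + e n) : R * R) @ \oo --> ((x, y) : R * R).
    have c3 : (fun n => y + e n) @ \oo --> y.
      by rewrite -[X in _ --> X]addr0; apply: cvgD => //; exact: cvg_cst.
    exact: (cvg_pair (cvg_cst x) c3).
  exact: (cvg_comp _ _ c2 c).
apply/cvgrPdist_lt => eps eps0.
have q0 : 0 < 4 + M0 / y ^+ 2 by rewrite ltr_wpDr// divr_ge0// ltW.
have ee : 0 < eps / 2 / (4 + M0 / y ^+ 2).
  by apply: divr_gt0; [apply: divr_gt0|].
near=> n.
rewrite (_ : v x y - _ = (v x y - v x (y + e n)) + (v x (y + e n) -
  \sum_(k < N n) m n k * poisson x y (t n k))); last by ring.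
apply: (le_lt_trans (ler_normD _ _)).
rewrite (splitr eps); apply: ltrD.
  by near: n; move/cvgrPdist_lt: vc; apply; rewrite divr_gt0.
have [_ _ _ _ /(_ x y y0)/le_lt_trans] := mH n; apply.
rewrite (_ : _ + _ = (4 + M0 / y ^+ 2) * d n); last by ring.
rewrite mulrC -ltr_pdivlMr// -(gtr0_norm (d0 n)) -[d n]subr0 distrC; near: n.
by move/cvgrPdist_lt: dc => /(_ _ ee).
Unshelve. all: end_near. Qed.

Lemma herglotz_measure (R : realType) (v : R -> R -> R) L X :
  nevanlinna v L X ->
  exists2 mu : {finite_measure set (R * R)%type -> \bar R},
    mu (~` (`[- L - 1, L + 1] `*` [set 0])) = 0%E &
    forall x y, 0 < y -> v x y = \int[mu]_p poisson x y p.1.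
Proof.
move=> nv; have [M0 [N [t [m [tb m0 mM cv]]]]] := poisson_cvg nv.
have [mu mu0 muH] := weak_limit (nev_L nv) tb m0 mM.
exists mu => // x y y0; have y20 : 0 < y ^+ 2 by rewrite exprn_gt0.
symmetry; apply: (muH _ y^-1 (y ^+ 2)^-1 _ _ _ _ (cv x y y0)).
- by rewrite invr_ge0 ltW.
- by move=> s; rewrite ger0_norm ?poisson_ge0// ?poisson_le_inv// ltW.
- by move=> s u; rewrite mulrC; exact: poisson_lip.
Qed.

(** * Cauchy transforms of measures *)

(** Written as x (x^2)^-1, inversion needs only a power function on nonnegative numbers; at 0 both
    sides are 0. *)
Lemma measurable_invr (R : realType) : measurable_fun setT (fun x : R => x^-1).
Proof.
rewrite (_ : (fun x => x^-1) = (fun x => x * (x ^+ 2) `^ (-1))); last first.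
  apply/funext => x; rewrite powR_inv1 ?sqr_ge0//; have [->|x0] := eqVneq x 0.
    by rewrite invr0 mul0r.
  by field.
apply: measurable_funM => //.
exact: (measurableT_comp (measurable_powR (-1)) (measurable_funX 2 (@measurable_id _ R setT))).
Qed.

Definition cmeasurable (R : realType) (h : R * R -> R[i]) :=
  measurable_fun setT (fun p => complex.Re (h p)) /\
  measurable_fun setT (fun p => complex.Im (h p)).

Lemma cmeasurable_cst (R : realType) (c : R[i]) : cmeasurable (fun=> c : R[i]).
Proof. by split; exact: measurable_cst. Qed.

Lemma cmeasurable_cplx (R : realType) : cmeasurable (@cplx R).
Proof. by split; [exact: measurable_fst|exact: measurable_snd]. Qed.

Lemma cmeasurableD (R : realType) (g h : R * R -> R[i]) :
  cmeasurable g -> cmeasurable h -> cmeasurable (fun p => g p + h p).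
Proof.
move=> [gr gi] [hr hi]; split.
  by under eq_fun do rewrite ReD; exact: measurable_funD.
by under eq_fun do rewrite ImD; exact: measurable_funD.
Qed.

Lemma cReM (R : realType) (z w : R[i]) :
  complex.Re (z * w) = complex.Re z * complex.Re w - complex.Im z * complex.Im w.
Proof. by case: z w => a b [c d]. Qed.

Lemma cImM (R : realType) (z w : R[i]) :
  complex.Im (z * w) = complex.Re z * complex.Im w + complex.Im z * complex.Re w.
Proof. by case: z w => a b [c d]. Qed.

Lemma cmeasurableM (R : realType) (g h : R * R -> R[i]) :
  cmeasurable g -> cmeasurable h -> cmeasurable (fun p => g p * h p).
Proof.
move=> [gr gi] [hr hi]; split.
  by under eq_fun do rewrite cReM; apply: measurable_funB; exact: measurable_funM.
by under eq_fun do rewrite cImM; apply: measurable_funD; exact: measurable_funM.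
Qed.

Lemma cmeasurableB (R : realType) (g h : R * R -> R[i]) :
  cmeasurable g -> cmeasurable h -> cmeasurable (fun p => g p - h p).
Proof.
move=> gm hm; rewrite (_ : (fun p => _) = (fun p => g p + (-1) * h p)).
  by apply: cmeasurableD => //; apply: cmeasurableM => //; exact: cmeasurable_cst.
by apply/funext => p; rewrite mulN1r.
Qed.

Lemma cmeasurableV (R : realType) (h : R * R -> R[i]) :
  cmeasurable h -> cmeasurable (fun p => (h p)^-1).
Proof.
move=> [hr hi]; have hd : measurable_fun setT (fun p => (cabs (h p) ^+ 2)^-1).
  have m2 : measurable_fun setT (fun p => cabs (h p) ^+ 2).
    by under eq_fun do rewrite cabs_sqr; apply: measurable_funD; exact: measurable_funX.
  exact: (measurableT_comp (@measurable_invr R) m2).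
split.
  rewrite (_ : (fun p => _) = (fun p => complex.Re (h p) * (cabs (h p) ^+ 2)^-1)).
    exact: measurable_funM.
  by apply/funext => p; rewrite ReV.
rewrite (_ : (fun p => _) = (fun p => - complex.Im (h p) * (cabs (h p) ^+ 2)^-1)).
  by apply: measurable_funM => //; exact: measurableT_comp.
by apply/funext => p; rewrite ImV.
Qed.

Definition cint (R : realType) (mu : {finite_measure set (R * R)%type -> \bar R})
  (h : R * R -> R[i]) : R[i] :=
  (\int[mu]_p complex.Re (h p)) +i* (\int[mu]_p complex.Im (h p)).

Definition carried (R : realType) (mu : {finite_measure set (R * R)%type -> \bar R})
  (S : set (R * R)) := measurable S /\ mu (~` S) = 0%E.

Lemma carried_integrable (R : realType) (mu : {finite_measure set (R * R)%type -> \bar R})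
    (S : set (R * R)) (h : R * R -> R) (B : R) :
  carried mu S -> measurable_fun setT h -> (forall p, S p -> `|h p| <= B) ->
  mu.-integrable setT (EFin \o h).
Proof.
move=> [mS S0] mh hB; apply/(negligible_integrable (measurableC mS) measurableT _ S0).
  exact/measurable_EFinP.
rewrite setDE setCK setTI; apply: integrable_bounded hB => //.
exact: measurable_funTS.
Qed.

Lemma carried_Rintegral (R : realType) (mu : {finite_measure set (R * R)%type -> \bar R})
    (S : set (R * R)) (h : R * R -> R) (B : R) :
  carried mu S -> measurable_fun setT h -> (forall p, S p -> `|h p| <= B) ->
  \int[mu]_p h p = \int[mu]_(p in S) h p.
Proof.
move=> cS mh hB; have ih := carried_integrable cS mh hB; case: cS => mS S0.
rewrite /Rintegral (negligible_integral (measurableC mS) measurableT ih S0).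
by rewrite setDE setCK setTI.
Qed.

Lemma le_carried_Rintegral (R : realType) (mu : {finite_measure set (R * R)%type -> \bar R})
    (S : set (R * R)) (h : R * R -> R) (B : R) :
  carried mu S -> measurable_fun setT h -> 0 <= B -> (forall p, S p -> `|h p| <= B) ->
  `|\int[mu]_p h p| <= B * fine (mu setT).
Proof.
move=> cS mh B0 hB; rewrite (carried_Rintegral cS mh hB); case: cS => mS S0.
apply: (le_trans (le_Rintegral_bounded _ mS _ hB)); first exact: measurable_funTS.
rewrite ler_wpM2l// fine_le// ?fin_num_measure//.
by apply: le_measure; rewrite ?inE.
Qed.

Lemma cint_bound (R : realType) (mu : {finite_measure set (R * R)%type -> \bar R})
    (S : set (R * R)) (h : R * R -> R[i]) (B : R) :
  carried mu S -> cmeasurable h -> 0 <= B -> (forall p, S p -> cabs (h p) <= B) ->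
  cabs (cint mu h) <= 2 * B * fine (mu setT).
Proof.
move=> cS [hr hi] B0 hB; apply: (le_trans (cabs_le _)).
rewrite mulr2n !mulrDl mul1r; apply: lerD; apply: (le_carried_Rintegral cS) => // p Sp.
  exact: le_trans (Re_le_cabs _) (hB _ Sp).
exact: le_trans (Im_le_cabs _) (hB _ Sp).
Qed.

Definition cbounded (R : realType) (S : set (R * R)) (h : R * R -> R[i]) :=
  cmeasurable h /\ exists B : R, forall p, S p -> cabs (h p) <= B.

Lemma cbounded_integrable (R : realType) (mu : {finite_measure set (R * R)%type -> \bar R})
    (S : set (R * R)) (h : R * R -> R[i]) :
  carried mu S -> cbounded S h ->
  mu.-integrable setT (EFin \o (fun p => complex.Re (h p))) /\
  mu.-integrable setT (EFin \o (fun p => complex.Im (h p))).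
Proof.
move=> cS [[hr hi] [B hB]]; split; apply: (carried_integrable cS) => // p Sp.
  exact: le_trans (Re_le_cabs _) (hB _ Sp).
exact: le_trans (Im_le_cabs _) (hB _ Sp).
Qed.

Lemma cboundedB (R : realType) (S : set (R * R)) (g h : R * R -> R[i]) :
  cbounded S g -> cbounded S h -> cbounded S (fun p => g p - h p).
Proof.
move=> [gm [A gA]] [hm [B hB]]; split; first exact: cmeasurableB.
exists (A + B) => p Sp; apply: (le_trans (cabsD _ _)); rewrite cabsN.
by apply: lerD; [exact: gA|exact: hB].
Qed.

Lemma cboundedM (R : realType) (S : set (R * R)) (g h : R * R -> R[i]) :
  cbounded S g -> cbounded S h -> cbounded S (fun p => g p * h p).
Proof.
move=> [gm [A gA]] [hm [B hB]]; split; first exact: cmeasurableM.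
exists (A * B) => p Sp; rewrite cabsM; apply: ler_pM; rewrite ?cabs_ge0//; [exact: gA|exact: hB].
Qed.

Lemma cbounded_cst (R : realType) (S : set (R * R)) (c : R[i]) : cbounded S (fun=> c).
Proof. by split; [exact: cmeasurable_cst|exists (cabs c)]. Qed.

Lemma cintB (R : realType) (mu : {finite_measure set (R * R)%type -> \bar R})
    (S : set (R * R)) (g h : R * R -> R[i]) :
  carried mu S -> cbounded S g -> cbounded S h ->
  cint mu (fun p => g p - h p) = cint mu g - cint mu h.
Proof.
move=> cS /(cbounded_integrable cS)[gr gi] /(cbounded_integrable cS)[hr hi].
rewrite /cint; apply/eqP; rewrite eq_complex /= ; apply/andP; split; apply/eqP.
  by rewrite -RintegralB//; apply: eq_Rintegral => p _; rewrite ReB.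
by rewrite -RintegralB//; apply: eq_Rintegral => p _; rewrite ImB.
Qed.

Lemma cintZ (R : realType) (mu : {finite_measure set (R * R)%type -> \bar R})
    (S : set (R * R)) (c : R[i]) (h : R * R -> R[i]) :
  carried mu S -> cbounded S h -> cint mu (fun p => c * h p) = c * cint mu h.
Proof.
move=> cS /(cbounded_integrable cS)[hr hi].
have iZ (a : R) g : mu.-integrable setT (EFin \o g) -> mu.-integrable setT (EFin \o (fun p => a * g p)).
  by move=> ig; exact: (integrableZl measurableT a ig).
rewrite /cint; apply/eqP; rewrite eq_complex cReM cImM /=; apply/andP; split; apply/eqP.
  rewrite -!RintegralZl// -RintegralB//; try exact: iZ.
  by apply: eq_Rintegral => p _; rewrite cReM.
rewrite -!RintegralZl// -RintegralD//; try exact: iZ.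
by apply: eq_Rintegral => p _; rewrite cImM.
Qed.

Lemma cint_cst (R : realType) (mu : {finite_measure set (R * R)%type -> \bar R}) (c : R[i]) :
  cint mu (fun=> c) = c * (fine (mu setT))%:C.
Proof.
by rewrite /cint !Rintegral_cst//; apply/eqP; rewrite eq_complex cReM cImM /= !mulr0 subr0 add0r !eqxx.
Qed.

Lemma cauchy_transform_cint (R : realType) (mu : {finite_measure set (R * R)%type -> \bar R}) z :
  cauchy_transform mu z = cint mu (fun p => (z - cplx p)^-1).
Proof. by []. Qed.

Lemma cbounded_kernel (R : realType) (S : set (R * R)) (z : R[i]) (r : R) :
  0 < r -> (forall p, S p -> r <= cabs (z - cplx p)) ->
  cbounded S (fun p => (z - cplx p)^-1).
Proof.
move=> r0 rS; split.
  by apply/cmeasurableV/cmeasurableB; [exact: cmeasurable_cst|exact: cmeasurable_cplx].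
by exists r^-1 => p /rS h; rewrite cabsV lef_pV2 ?posrE// (lt_le_trans r0).
Qed.

(** The derivative is minus the integral of (z - zeta)^-2. The remainder of the kernel is h^2 / ((z
    + h - zeta) (z - zeta)^2), at most |h|^2 times 2 / r^3 once |h| < r / 2. *)
Lemma cauchy_cderiv (R : realType) (mu : {finite_measure set (R * R)%type -> \bar R})
    (S : set (R * R)) (z : R[i]) (r : R) :
  carried mu S -> 0 < r -> (forall p, S p -> r <= cabs (z - cplx p)) ->
  exists l, cderiv (cauchy_transform mu) z l.
Proof.
move=> cS r0 rS; have k0 := cbounded_kernel r0 rS.
have kk := cboundedM k0 k0.
pose l := cint mu (fun p => (z - cplx p)^-1 * (z - cplx p)^-1).
exists (- l) => e e0; pose m := fine (mu setT).
have m0 : 0 <= m by rewrite fine_ge0.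
have K0 : 0 < 4 * m / r ^+ 3 + 1 by rewrite ltr_wpDl// divr_ge0 ?exprn_ge0 ?mulr_ge0 ?(ltW r0).
exists (Num.min (r / 2) (e / (4 * m / r ^+ 3 + 1))).
  by rewrite lt_min !divr_gt0.
move=> h; rewrite lt_min => /andP[hr he].
have rS2 p : S p -> r / 2 <= cabs (z + h - cplx p).
  move=> Sp; have := ler_cabsB (z - cplx p) (- h); rewrite opprK cabsN => H.
  by have := rS p Sp; rewrite (_ : z + h - cplx p = z - cplx p + h); [lra|ring].
have r20 : 0 < r / 2 by rewrite divr_gt0.
have k1 := cbounded_kernel r20 rS2.
have kh : cbounded S (fun p => - h * ((z - cplx p)^-1 * (z - cplx p)^-1)).
  by apply: cboundedM => //; exact: cbounded_cst.
have -> : cauchy_transform mu (z + h) - cauchy_transform mu z - - l * h =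
    cint mu (fun p => ((z + h - cplx p)^-1 - (z - cplx p)^-1) - - h * ((z - cplx p)^-1 * (z - cplx p)^-1)).
  rewrite (cintB cS (cboundedB k1 k0) kh) (cintB cS k1 k0) (cintZ _ cS kk) -/l !cauchy_transform_cint.
  by rewrite !mulNr [h * l]mulrC.
have hb p : S p -> cabs ((z + h - cplx p)^-1 - (z - cplx p)^-1 -
    - h * ((z - cplx p)^-1 * (z - cplx p)^-1)) <= cabs h * cabs h * (2 / r ^+ 3).
  move=> Sp; have a1 := rS _ Sp; have a2 := rS2 _ Sp.
  have n1 : z - cplx p != 0 by rewrite -cabs_gt0; exact: lt_le_trans a1.
  have n2 : z + h - cplx p != 0 by rewrite -cabs_gt0; exact: lt_le_trans a2.
  have -> : (z + h - cplx p)^-1 - (z - cplx p)^-1 - - h * ((z - cplx p)^-1 * (z - cplx p)^-1) =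
      h * h * ((z + h - cplx p)^-1 * ((z - cplx p)^-1 * (z - cplx p)^-1)).
    have E : z + h - cplx p = z - cplx p + h by ring.
    rewrite E in n2 *; move: (z - cplx p) n1 n2 => w n1 n2; field.
    by rewrite n1 n2.
  rewrite !cabsM !cabsV ler_wpM2l ?mulr_ge0 ?cabs_ge0//.
  have -> : 2 / r ^+ 3 = (r / 2)^-1 * (r^-1 * r^-1).
    by field; rewrite gt_eqF.
  have i1 : (cabs (z + h - cplx p))^-1 <= (r / 2)^-1.
    by rewrite lef_pV2 ?posrE// (lt_le_trans r20).
  have i2 : (cabs (z - cplx p))^-1 <= r^-1 by rewrite lef_pV2 ?posrE// (lt_le_trans r0).
  apply: ler_pM => //; rewrite ?mulr_ge0 ?invr_ge0 ?cabs_ge0//.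
  by apply: ler_pM => //; rewrite invr_ge0 cabs_ge0.
have [[km _] _] := (cboundedB (cboundedB k1 k0) kh, tt).
apply: (le_trans (cint_bound cS km _ hb)).
  by rewrite !mulr_ge0 ?cabs_ge0 ?invr_ge0 ?exprn_ge0 ?(ltW r0).
rewrite -/m (_ : _ * m = cabs h * (cabs h * (4 * m / r ^+ 3))); last by ring.
rewrite [e * _]mulrC ler_wpM2l ?cabs_ge0//; move: he; rewrite ltr_pdivlMr// => he.
apply: (le_trans _ (ltW he)); rewrite ler_wpM2l ?cabs_ge0//; lra.
Qed.

(** * Supports of measures on the plane *)

Definition rat_box (R : realType) (q : rat * rat * rat * rat) : set (R * R) :=
  `]ratr q.1.1.1, ratr q.1.1.2[ `*` `]ratr q.1.2, ratr q.2[.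

Lemma measurable_rat_box (R : realType) q : measurable (@rat_box R q).
Proof. by apply: measurableX. Qed.

Lemma open_rat_box (R : realType) q : open (@rat_box R q).
Proof.
rewrite openE => p [/= p1 p2].
by exists (`]ratr q.1.1.1, ratr q.1.1.2[%classic, `]ratr q.1.2, ratr q.2[%classic) => //;
  split; apply: open_nbhs_nbhs; split=> //; exact: interval_open.
Qed.

Lemma rat_box_in (R : realType) (U : set (R * R)) (p : R * R) : open U -> U p ->
  exists2 q, rat_box q p & @rat_box R q `<=` U.
Proof.
move=> oU Up; have [d /= d0 dU] : exists2 d : R, 0 < d & ball p d `<=` U.
  by have /nbhs_ballP := open_nbhs_nbhs (conj oU Up).
have rat_in (a b : R) : a < b -> exists q : rat, a < ratr q < b.
  by move=> ab; have [q] := rat_in_itvoo ab; rewrite in_itv; exists q.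
have [a1 /andP[a1l a1r]] := rat_in (p.1 - d) p.1 ltac:(lra).
have [b1 /andP[b1l b1r]] := rat_in p.1 (p.1 + d) ltac:(lra).
have [a2 /andP[a2l a2r]] := rat_in (p.2 - d) p.2 ltac:(lra).
have [b2 /andP[b2l b2r]] := rat_in p.2 (p.2 + d) ltac:(lra).
exists (a1, b1, a2, b2); first by split; rewrite /= in_itv /= ?a1r ?b1l ?a2r ?b2l.
move=> [x y] [/=]; rewrite !in_itv /= => /andP[x1 x2] /andP[y1 y2]; apply: dU.
by split; rewrite /ball /= ltr_norml; apply/andP; split; lra.
Qed.

Lemma bigcup_rat_box (R : realType) (A : set (R * R)) (Q : set (rat * rat * rat * rat)) :
  (forall p, A p -> exists2 q, rat_box q p & Q q) ->
  (forall q, Q q -> @rat_box R q `<=` A) ->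
  A = \bigcup_n (if unpickle n is Some q then if `[< Q q >] then @rat_box R q else set0 else set0).
Proof.
move=> AQ QA; apply/seteqP; split=> p.
  move=> /AQ[q qp Qq]; have := pickleK q; move: (pickle q) => n En.
  by exists n => //; rewrite En; case: asboolP.
move=> [n _]; case: (unpickle n) => [q|//]; case: asboolP => [Qq|//]; exact: QA.
Qed.

Lemma measurable_open_plane (R : realType) (U : set (R * R)) : open U -> measurable U.
Proof.
move=> oU; rewrite (@bigcup_rat_box _ U [set q | @rat_box R q `<=` U]).
- apply: bigcupT_measurable => n; case: (unpickle n) => [q|]; last exact: measurable0.
  by case: ifP => _; [exact: measurable_rat_box|exact: measurable0].
- by move=> p Up; have [q qp qU] := rat_box_in oU Up; exists q.
- by [].
Qed.

Lemma msupport_closed (R : realType) (mu : {finite_measure set (R * R)%type -> \bar R}) :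
  closed (msupport mu).
Proof.
rewrite -openC openE => p /= /existsNP[U] /not_implyP[oU] /not_implyP[Up nU].
apply: (filterS _ (open_nbhs_nbhs (conj oU Up))) => q Uq sq.
by apply: nU; exact: sq.
Qed.

Lemma not_msupport (R : realType) (mu : {finite_measure set (R * R)%type -> \bar R}) (p : R * R) :
  ~ msupport mu p -> exists U, [/\ open U, U p & mu U = 0%E].
Proof.
move=> /existsNP[U] /not_implyP[oU] /not_implyP[Up nU]; exists U; split=> //.
by apply/eqP; rewrite eq_le measure_ge0 andbT leNgt; exact/negP.
Qed.

(** Every point off the support has a null neighbourhood containing a rational box around it, and
    there are countably many rational boxes. *)
Lemma msupport_carried (R : realType) (mu : {finite_measure set (R * R)%type -> \bar R}) :
  carried mu (msupport mu).
Proof.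
have oS : open (~` msupport mu) by rewrite openC; exact: msupport_closed.
have mS := measurable_open_plane oS.
split; first by rewrite -[msupport mu]setCK; exact: measurableC.
rewrite (@bigcup_rat_box _ (~` msupport mu) [set q | mu (rat_box q) = 0%E]).
- apply: measure_negligible.
    apply: bigcupT_measurable => n; case: (unpickle n) => [q|]; last exact: measurable0.
    by case: ifP => _; [exact: measurable_rat_box|exact: measurable0].
  apply: negligible_bigcup => n; case: (unpickle n) => [q|]; last exact: negligible_set0.
  case: asboolP => [q0|_]; last exact: negligible_set0.
  by apply/negligibleP => //; exact: measurable_rat_box.
- move=> p /not_msupport[U [oU Up U0]]; have [q qp qU] := rat_box_in oU Up; exists q => //.
  by apply: (subset_measure0 _ _ qU U0); [exact: measurable_rat_box|exact: measurable_open_plane].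
- move=> q /= q0 p qp sp; have := sp (rat_box q) _ qp; rewrite q0 ltxx => H.
  by have := H (@open_rat_box R q).
Qed.

Lemma carried_sub (R : realType) (mu : {finite_measure set (R * R)%type -> \bar R}) (S T : set (R * R)) :
  carried mu S -> S `<=` T -> measurable T -> carried mu T.
Proof.
move=> [mS S0] ST mT; split=> //; apply: subset_measure0 S0; try exact: measurableC.
exact: subsetC.
Qed.

Lemma carried_msupport (R : realType) (mu : {finite_measure set (R * R)%type -> \bar R}) (S : set (R * R)) :
  carried mu S -> closed S -> msupport mu `<=` S.
Proof.
move=> [mS S0] cS p sp; apply: contrapT => nS.
by have := sp (~` S); rewrite openC S0 ltxx => /(_ cS nS).
Qed.

Lemma cauchy_cderiv_off (R : realType) (mu : {finite_measure set (R * R)%type -> \bar R}) (p : R * R) :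
  ~ msupport mu p -> exists l, cderiv (cauchy_transform mu) (cplx p) l.
Proof.
move=> np; have oS : open (~` msupport mu) by rewrite openC; exact: msupport_closed.
have [d /= d0 dU] : exists2 d : R, 0 < d & ball p d `<=` ~` msupport mu.
  by have /nbhs_ballP := open_nbhs_nbhs (conj oS np).
apply: (cauchy_cderiv (msupport_carried mu) d0) => q sq.
rewrite leNgt; apply/negP => h; apply: (dU q _ sq); split; rewrite /ball /=.
  by apply: (le_lt_trans _ h); have := Re_le_cabs (cplx p - cplx q); rewrite ReB.
by apply: (le_lt_trans _ h); have := Im_le_cabs (cplx p - cplx q); rewrite ImB.
Qed.

Definition real_line (R : realType) : set (R * R) := setT `*` [set 0].

Lemma carried_real (R : realType) (mu : {finite_measure set (R * R)%type -> \bar R}) (S : set (R * R)) :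
  carried mu S -> S `<=` @real_line R -> carried mu (@real_line R).
Proof.
move=> cS Sr; apply: (carried_sub cS Sr); exact: measurableX.
Qed.

Lemma eq_carried_cint (R : realType) (mu : {finite_measure set (R * R)%type -> \bar R})
    (S : set (R * R)) (g h : R * R -> R[i]) :
  carried mu S -> cmeasurable g -> cmeasurable h -> (forall p, S p -> g p = h p) ->
  cint mu g = cint mu h.
Proof.
move=> [mS S0] [gr gi] [hr hi] gh.
have ae (u v : R * R -> R) : measurable_fun setT u -> measurable_fun setT v ->
    (forall p, S p -> u p = v p) -> \int[mu]_p u p = \int[mu]_p v p.
  move=> mu' mv uv; rewrite /Rintegral; congr fine; apply: ae_eq_integral => //;
    try exact/measurable_EFinP.
  exists (~` S); split => //; first exact: measurableC.
  by move=> p /= H Sp; apply: H => _; rewrite uv.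
by rewrite /cint; congr (_ +i* _); apply: ae => // p Sp; rewrite gh.
Qed.

Lemma cmeasurable_kernel (R : realType) (z : R[i]) : cmeasurable (fun p : R * R => (z - cplx p)^-1).
Proof. by apply/cmeasurableV/cmeasurableB; [exact: cmeasurable_cst|exact: cmeasurable_cplx]. Qed.

Lemma cRe_conj (R : realType) (z : R[i]) : complex.Re (conjc z) = complex.Re z.
Proof. by case: z. Qed.

Lemma cIm_conj (R : realType) (z : R[i]) : complex.Im (conjc z) = - complex.Im z.
Proof. by case: z. Qed.

Lemma cauchy_conj (R : realType) (mu : {finite_measure set (R * R)%type -> \bar R}) (S : set (R * R)) z :
  carried mu S -> S `<=` @real_line R -> cbounded S (fun p => (z - cplx p)^-1) ->
  cauchy_transform mu (conjc z) = conjc (cauchy_transform mu z).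
Proof.
move=> cS Sr k0; have cR := carried_real cS Sr.
have kJ p : @real_line R p -> (conjc z - cplx p)^-1 = conjc ((z - cplx p)^-1).
  move=> [_ /= p2]; rewrite conjc_inv; congr (_^-1).
  by clear k0; case: z => a b; case: p p2 => x y /= ->; apply/eqP; rewrite eq_complex /= !subr0 eqxx eqxx.
have cm : cmeasurable (fun p : R * R => conjc ((z - cplx p)^-1)).
  have [k1 k2] := cmeasurable_kernel z.
  split; first by under eq_fun do rewrite cRe_conj; exact: k1.
  by under eq_fun do rewrite cIm_conj; exact: measurableT_comp k2.
rewrite cauchy_transform_cint (eq_carried_cint cR (cmeasurable_kernel (conjc z)) cm kJ).
have [_ ii] := cbounded_integrable cS k0.
rewrite cauchy_transform_cint /cint; apply/eqP; rewrite eq_complex cRe_conj cIm_conj /=; apply/andP; split; apply/eqP.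
  by apply: eq_Rintegral => p _; rewrite cRe_conj.
rewrite -mulN1r -RintegralZl//.
by apply: eq_Rintegral => p _; rewrite cIm_conj mulN1r.
Qed.

(** For |z| > 2 L the kernel differs from 1 / z by zeta / (z (z - zeta)), where |z - zeta| >= |z| /
    2. The remaining factor 2 comes from estimating real and imaginary parts separately. *)
Lemma cauchy_infty (R : realType) (mu : {finite_measure set (R * R)%type -> \bar R}) (S : set (R * R)) (L : R) :
  carried mu S -> 0 < L -> (forall p, S p -> cabs (cplx p) <= L) ->
  forall z, 2 * L < cabs z ->
  cabs (cauchy_transform mu z - (fine (mu setT))%:C / z) <= 4 * L * fine (mu setT) / cabs z ^+ 2.
Proof.
move=> cS L0 SL z zL; have z0 : 0 < cabs z by rewrite (lt_trans _ zL)// mulr_gt0.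
have rS p : S p -> cabs z / 2 <= cabs (z - cplx p).
  by move=> Sp; have := ler_cabsB z (cplx p); have := SL _ Sp; lra.
have zn : z != 0 by rewrite -cabs_gt0.
have k0 := cbounded_kernel (divr_gt0 z0 (ltr0Sn R 1)) rS.
have -> : cauchy_transform mu z - (fine (mu setT))%:C / z =
    cint mu (fun p => (z - cplx p)^-1 - z^-1).
  by rewrite (cintB cS k0 (cbounded_cst _ _)) cint_cst cauchy_transform_cint [_%:C / z]mulrC.
have hb p : S p -> cabs ((z - cplx p)^-1 - z^-1) <= 2 * L / cabs z ^+ 2.
  move=> Sp; have n1 : z - cplx p != 0.
    by rewrite -cabs_gt0; apply: lt_le_trans (rS _ Sp); rewrite divr_gt0.
  have -> : (z - cplx p)^-1 - z^-1 = cplx p * (z^-1 * (z - cplx p)^-1).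
    by field; rewrite zn n1.
  rewrite !cabsM !cabsV.
  have -> : 2 * L / cabs z ^+ 2 = L * ((cabs z)^-1 * (cabs z / 2)^-1).
    by field; rewrite gt_eqF.
  apply: ler_pM; rewrite ?mulr_ge0 ?invr_ge0 ?cabs_ge0//; first exact: SL.
  rewrite ler_wpM2l ?invr_ge0 ?cabs_ge0// lef_pV2 ?posrE//; first exact: rS.
    by apply: lt_le_trans (rS _ Sp); rewrite divr_gt0.
  by rewrite divr_gt0.
have [km _] := cboundedB k0 (cbounded_cst S z^-1).
apply: (le_trans (cint_bound cS km _ hb)).
  by rewrite divr_ge0 ?exprn_ge0 ?mulr_ge0 ?(ltW L0) ?(ltW z0).
by rewrite le_eqVlt; apply/orP; left; apply/eqP; ring.
Qed.

Lemma kernel_upper (R : realType) (S : set (R * R)) (x y : R) : S `<=` @real_line R -> 0 < y ->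
  cbounded S (fun p => (x +i* y - cplx p)^-1).
Proof.
move=> Sr y0; apply: (cbounded_kernel y0) => p /Sr[_ /= p2].
apply: le_trans (Im_le_cabs _); rewrite ImB /= p2 subr0; exact: ler_norm.
Qed.

Lemma neg_Im_cauchy (R : realType) (mu : {finite_measure set (R * R)%type -> \bar R}) (S : set (R * R)) (x y : R) :
  carried mu S -> S `<=` @real_line R -> 0 < y ->
  - complex.Im (cauchy_transform mu (x +i* y)) = \int[mu]_p poisson x y p.1.
Proof.
move=> cS Sr y0; have k0 := kernel_upper x Sr y0.
have [_ ii] := cbounded_integrable cS k0.
rewrite cauchy_transform_cint /= -mulN1r -RintegralZl//.
have pE p : S p -> -1 * complex.Im (x +i* y - cplx p)^-1 = poisson x y p.1.
  move=> /Sr[_ p2]; rewrite ImV cabs_sqr ImB ReB /=; rewrite /= in p2; rewrite p2 subr0 /poisson; ring.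
have [km [B kB]] := k0.
have mI : measurable_fun setT (fun p : R * R => -1 * complex.Im (x +i* y - cplx p)^-1).
  by apply: measurable_funM => //; exact: km.2.
have bI p : S p -> `|-1 * complex.Im (x +i* y - cplx p)^-1| <= B.
  by move=> Sp; rewrite normrM normrN1 mul1r; exact: le_trans (Im_le_cabs _) (kB _ Sp).
have mP : measurable_fun setT (fun p : R * R => poisson x y p.1).
  apply: measurable_funM => //; apply: (measurableT_comp (@measurable_invr R)).
  apply: measurable_funD => //; apply: measurable_funX; apply: measurable_funB => //.
rewrite (carried_Rintegral cS mI bI) (carried_Rintegral (B := B) cS mP); last first.
  by move=> p Sp; rewrite -pE//; exact: bI.
by apply: eq_Rintegral => p; rewrite inE; exact: pE.
Qed.

(** The difference has zero imaginary part, so its derivative, computed horizontally, has zero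
    imaginary part, which is minus the vertical derivative of the real part. The real part is thus
    constant on vertical half-lines and tends to 0. *)
Lemma upper_determined (R : realType) (f g : R[i] -> R[i]) (A r : R) :
  (forall z, 0 < complex.Im z -> exists l, cderiv f z l) ->
  (forall z, 0 < complex.Im z -> exists l, cderiv g z l) ->
  (forall z, 0 < complex.Im z -> complex.Im (f z) = complex.Im (g z)) ->
  (forall z, r < cabs z -> cabs (f z - g z) <= A / cabs z) ->
  forall z, 0 < complex.Im z -> f z = g z.
Proof.
move=> df dg Ifg fg z z0; pose h w := f w + -1 * g w.
have dh w : 0 < complex.Im w -> exists l, cderiv h w l.
  move=> w0; have [l dl] := df _ w0; have [l' dl'] := dg _ w0.
  by exists (l + (0 * g w + -1 * l')); apply: (cderivD dl (cderivM (cderiv_cst (-1) w) dl')).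
have hE w : h w = f w - g w by rewrite /h mulN1r.
have Ih w : 0 < complex.Im w -> complex.Im (h w) = 0.
  by move=> w0; rewrite hE ImB Ifg// subrr.
case: z z0 => x y /= y0.
have dR (t : R) : 0 < t -> is_derive t 1 (fun t : R => complex.Re (h (x +i* t))) 0.
  move=> t0; have [l dl] := dh (x +i* t) t0.
  have Il : complex.Im l = 0.
    have := cderiv_Im_x dl; rewrite (_ : (fun t0 : R => _) = (fun=> 0)).
      by move=> d1; rewrite -(@derive_val _ _ _ _ _ _ _ d1) derive_cst.
    by apply/funext => s; rewrite Ih.
  by have := cderiv_Re_y dl; rewrite Il oppr0.
have hc (t : R) : y < t -> complex.Re (h (x +i* t)) = complex.Re (h (x +i* y)).
  move=> yt; have [s /andP[ys _]|c _ E] := @mean_value R (fun t : R => complex.Re (h (x +i* t))) (fun=> 0) y t yt.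
    exact: dR (lt_le_trans y0 ys).
  by apply/eqP; rewrite -subr_eq0 E mul0r.
suff R0 : complex.Re (h (x +i* y)) = 0.
  apply/eqP; by rewrite -subr_eq0 -hE eq_complex R0 Ih// !eqxx.
apply/eqP/negPn/negP => ne; have n0 : 0 < `|complex.Re (h (x +i* y))| by rewrite normr_gt0.
set q := `|_| in n0; pose t := Num.max (Num.max (y + 1) (r + 1)) (`|A| / q + 1).
have ty : y < t by rewrite /t !lt_max; apply/orP; left; apply/orP; left; lra.
have tr : r < t by rewrite /t !lt_max; apply/orP; left; apply/orP; right; lra.
have tA : `|A| / q < t by rewrite /t !lt_max; apply/orP; right; lra.
have t0 := lt_trans y0 ty.
have tz : t <= cabs (x +i* t) by apply: le_trans (Im_le_cabs _); exact: ler_norm.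
have := fg (x +i* t) (lt_le_trans tr tz); rewrite -hE => hA.
have h1 := le_trans (Re_le_cabs _) hA; rewrite (hc _ ty) -/q in h1.
move: tA; rewrite ltr_pdivrMr// => tA.
have z0 := lt_le_trans t0 tz; move: h1; rewrite ler_pdivlMr// => h1.
have := ler_norm A; have : t * q <= q * cabs (x +i* t) by rewrite mulrC ler_wpM2l// ltW.
by move: tA h1; clear; lra.
Qed.

Lemma mass_determined (R : realType) (a b A B r s : R) (f : R[i] -> R[i]) :
  (forall z, complex.Im z != 0 -> r < cabs z -> cabs (f z - a%:C / z) <= A / cabs z ^+ 2) ->
  (forall z, complex.Im z != 0 -> s < cabs z -> cabs (f z - b%:C / z) <= B / cabs z ^+ 2) -> a = b.
Proof.
move=> fa fb; apply/eqP; rewrite -subr_eq0; apply/negPn/negP => ne.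
have q0 : 0 < `|a - b| by rewrite normr_gt0.
pose t := Num.max (Num.max (`|r| + 1) (`|s| + 1)) ((`|A| + `|B|) / `|a - b| + 1).
have tr : `|r| < t by rewrite /t !lt_max; apply/orP; left; apply/orP; left; lra.
have ts : `|s| < t by rewrite /t !lt_max; apply/orP; left; apply/orP; right; lra.
have tA : (`|A| + `|B|) / `|a - b| < t by rewrite /t !lt_max; apply/orP; right; lra.
have t0 : 0 < t := le_lt_trans (normr_ge0 _) tr.
pose w : R[i] := 0 +i* t.
have ct : cabs w = t by rewrite cabsE /= expr0n add0r sqrtr_sqr gtr0_norm.
have wI : complex.Im w != 0 by rewrite /= gt_eqF.
have h1 := fa w wI; rewrite ct in h1; have {}h1 := h1 (le_lt_trans (ler_norm _) tr).
have h2 := fb w wI; rewrite ct in h2; have {}h2 := h2 (le_lt_trans (ler_norm _) ts).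
have tn : w != 0 :> R[i] by rewrite -cabs_gt0 ct.
have h3 : cabs ((a - b)%:C / w) <= A / t ^+ 2 + B / t ^+ 2.
  have -> : (a - b)%:C / w = (f w - b%:C / w) - (f w - a%:C / w).
    by rewrite rmorphB /=; field.
  apply: (le_trans (cabsD _ _)); rewrite cabsN addrC; exact: lerD.
move: h3; rewrite cabsM cabsV ct cabs_real -mulrDl ler_pdivrMr// => h3.
have h4 : `|a - b| * t <= A + B.
  move: h3; rewrite (_ : (A + B) / t ^+ 2 * t = (A + B) / t); last by field; rewrite gt_eqF.
  by rewrite ler_pdivlMr.
move: tA; rewrite ltr_pdivrMr// => tA.
by have := ler_norm A; have := ler_norm B; move: tA h4; clear; lra.
Qed.

(** * Integrals along horizontal lines, and uniqueness of the measure *)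

Lemma is_derive_atan_line (R : realType) (x u t : R) :
  is_derive t 1 (fun t => atan ((t - x) / u)) (poisson t u x).
Proof.
have dl : is_derive t 1 (fun s : R => (s - x) / u) u^-1.
  by apply: is_derive_eq; rewrite /GRing.scale /=; ring.
have d := @is_derive1_comp _ (@atan R) (fun s => (s - x) / u) t _ _ (is_derive1_atan ((t - x) / u)) dl.
apply: (is_derive_eq d); rewrite /GRing.scale /= /poisson.
have [->|u0] := eqVneq u 0; first by rewrite invr0 mulr0 mul0r.
have d0 : 0 < (t - x) ^+ 2 + u ^+ 2.
  by rewrite ltr_wpDl ?sqr_ge0// lt_def sqrf_eq0 u0 sqr_ge0.
have d1 : 0 < 1 + ((t - x) / u) ^+ 2 by rewrite ltr_wpDr// sqr_ge0.
by field; rewrite u0 gt_eqF// addrC gt_eqF.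
Qed.

(** The height difference [u] may be negative or 0. For u = 0 the convention x / 0 = 0 makes both
    sides vanish, which covers mass lying on the line of integration itself. *)
Lemma integral_poisson (R : realType) (x u a b : R) : a < b ->
  (\int[@lebesgue_measure R]_(t in `[a, b]) (poisson t u x)%:E =
   (atan ((b - x) / u) - atan ((a - x) / u))%:E)%E.
Proof.
move=> ab; pose F t := atan ((t - x) / u).
have dF (t : R) : is_derive t 1 F (poisson t u x) := is_derive_atan_line x u t.
have cF : continuous F.
  by move=> t; apply/differentiable_continuous/derivable1_diffP; exact: ex_derive.
rewrite EFinB; apply: (@continuous_FTC2 R (fun t => poisson t u x) F a b ab).
- have [->|u0] := eqVneq u 0.
    rewrite (_ : (fun t => _) = (fun=> 0)); last by apply/funext => t; rewrite /poisson mul0r.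
    by apply: continuous_subspaceT => t; exact: cvg_cst.
  apply: continuous_subspaceT => t; rewrite /poisson.
  have d0 : (t - x) ^+ 2 + u ^+ 2 != 0.
    by rewrite gt_eqF// ltr_wpDl ?sqr_ge0// lt_def sqrf_eq0 u0 sqr_ge0.
  apply: cvgM; first exact: cvg_cst.
  apply: cvgV => //; apply: cvgD; last exact: cvg_cst.
  by rewrite expr2; apply: cvgM; apply: cvgB => //; exact: cvg_cst.
- split.
  + by move=> t _; exact: ex_derive.
  + exact/cvg_at_right_filter/cF.
  + exact/cvg_at_left_filter/cF.
- by move=> t _; rewrite derive1E derive_val.
Qed.

(** A bound uniform in the position of the pole, however close to the line: it gives absolute
    integrability on the product, hence Fubini. *)
Lemma integral_abs_poisson (R : realType) (x u a b : R) : a < b ->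
  (\int[@lebesgue_measure R]_(t in `[a, b]) `|(poisson t u x)%:E| <= pi%:E)%E.
Proof.
move=> ab; have pos v : 0 <= v ->
    (\int[@lebesgue_measure R]_(t in `[a, b]) (poisson t v x)%:E <= pi%:E)%E.
  move=> v0; rewrite integral_poisson// lee_fin.
  by have := atan_ltpi2 ((b - x) / v); have := atan_gtNpi2 ((a - x) / v); lra.
have pn v t : 0 <= v -> 0 <= poisson t v x.
  by move=> v0; rewrite /poisson divr_ge0// addr_ge0 ?sqr_ge0.
have [u0|u0] := leP 0 u.
  by under eq_integral => t _ do rewrite gee0_abs ?lee_fin ?pn//; exact: pos.
have u1 : 0 <= - u by rewrite oppr_ge0 ltW.
have E t : poisson t u x = - poisson t (- u) x by rewrite /poisson sqrrN mulNr opprK.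
by under eq_integral => t _ do rewrite E EFinN abseN gee0_abs ?lee_fin ?pn//; exact: pos.
Qed.

(** A case analysis on the positive and negative parts; [fine] sends both infinities to 0, so the
    identity survives divergence. *)
Lemma RintegralN (d : measure_display) (T : measurableType d) (R : realType)
    (mu : {measure set T -> \bar R}) (g : T -> R) :
  \int[mu]_x (- g x) = - \int[mu]_x g x.
Proof.
have E : (fun x => (- g x)%:E) = (\- (fun x => (g x)%:E))%E by apply/funext => x; rewrite EFinN.
rewrite /Rintegral [in LHS]integralE [in RHS]integralE E funeposN funenegN.
have A0 : (0 <= \int[mu]_x ((fun x => (g x)%:E)^\+ x))%E by exact: integral_ge0.
have B0 : (0 <= \int[mu]_x ((fun x => (g x)%:E)^\- x))%E by exact: integral_ge0.
move: (integral _ _ _) (integral _ _ _) A0 B0 => A B.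
by case: A => [a| |]; case: B => [b| |] //= _ _; rewrite ?opprB ?oppr0.
Qed.

Lemma fubini_line (R : realType) (nu : {finite_measure set (R * R)%type -> \bar R}) (s a b : R) :
  a < b ->
  (\int[@lebesgue_measure R]_(t in `[a, b]) (- complex.Im (cauchy_transform nu (t +i* s)))%:E =
   \int[nu]_p (atan ((b - p.1) / (s - p.2)) - atan ((a - p.1) / (s - p.2)))%:E)%E.
Proof.
move=> ab; pose m1 := @lebesgue_measure R.
pose g (q : R * (R * R)) := \1_(`[a, b]%classic) q.1 * poisson q.1 (s - q.2.2) q.2.1.
pose f q := (g q)%:E.
have mg : measurable_fun setT g.
  have m1' : measurable_fun setT (fun q : R * (R * R) => q.1) by exact: measurable_fst.
  have m2 : measurable_fun setT (fun q : R * (R * R) => q.2.1).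
    exact: (measurableT_comp measurable_fst measurable_snd).
  have m3 : measurable_fun setT (fun q : R * (R * R) => s - q.2.2).
    apply: measurable_funB => //.
    exact: (measurableT_comp measurable_snd measurable_snd).
  apply: measurable_funM.
    exact: (measurableT_comp (measurable_indic (measurable_itv `[a, b])) m1').
  apply: measurable_funM => //.
  have m4 : measurable_fun setT (fun q : R * (R * R) => (q.1 - q.2.1) ^+ 2 + (s - q.2.2) ^+ 2).
    by apply: measurable_funD; apply: measurable_funX => //; exact: measurable_funB.
  exact: (measurableT_comp (@measurable_invr R) m4).
have mf : measurable_fun setT f by exact/measurable_EFinP.
have mf' : measurable_fun (setT : set (measurableTypeR R * (R * R))) f := mf.
have restr (h : R -> \bar R) : (\int[m1]_(t in `[a, b]) h t =
    \int[m1]_t ((\1_(`[a, b]%classic) t)%:E * h t))%E.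
  rewrite integral_mkcond; apply: eq_integral => t _.
  by rewrite patchE indicE; case: ifPn => _; rewrite ?mul1e ?mul0e.
have inner p : (\int[m1]_t f (t, p) =
    (atan ((b - p.1) / (s - p.2)) - atan ((a - p.1) / (s - p.2)))%:E)%E.
  by rewrite -integral_poisson// restr.
have fub : (m1 \x nu)%E.-integrable setT f.
  apply/(integrable21ltyP _ _ mf'); apply: (@le_lt_trans _ _ (\int[nu]_p (pi%:E))%E).
    apply: ge0_le_integral => //.
    - by move=> p _; exact: integral_ge0.
    - have ma : measurable_fun (setT : set (measurableTypeR R * (R * R))) (abse \o f).
        by apply: measurableT_comp => //; exact: mf'.
      by have := @measurable_fun_fubini_tonelli_G _ _ _ _ _ m1 (abse \o f) ma (fun q => abse_ge0 _).
    move=> p _; apply: le_trans (integral_abs_poisson p.1 (s - p.2) ab).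
    rewrite restr le_eqVlt; apply/orP; left; apply/eqP; apply: eq_integral => t _.
    rewrite /f /g /= normrM EFinM; congr (_ * _)%E.
    by rewrite ger0_norm// indicE ler0n.
  exact: (integrable_lty measurableT (finite_measure_integrable_cst nu pi measurableT)).
have := Fubini fub; rewrite (eq_integral _ _ (fun p _ => inner p)) => <-.
pose F := fubini_F nu f.
have mF : measurable_fun (setT : set (measurableTypeR R)) F := measurable_fubini_F fub.
(* The Cauchy transform is a real part of an extended integral, taken with [fine]. It agrees with
   the inner integral of Fubini where that is finite, which is almost every t. *)
have hE t : ((\1_(`[a, b]%classic) t)%:E * (- complex.Im (cauchy_transform nu (t +i* s)))%:E)%E =
    (fine (F t))%:E.
  rewrite -EFinM; congr (_%:E); rewrite /F /fubini_F /f /g /= indicE.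
  case: (t \in _) => /=; last first.
    rewrite mul0r; have -> : (fun y : R * R => (0 * poisson t (s - y.2) y.1)%:E) = cst 0%E.
      by apply/funext => y; rewrite mul0r.
    by rewrite integral_cst// mul0e.
  rewrite mul1r -RintegralN; apply: eq_Rintegral => p _.
  by rewrite opprK mul1r.
rewrite restr; transitivity (\int[m1]_t (fine (F t))%:E)%E.
  by apply: eq_integral => t _; exact: hE.
apply: ae_eq_integral => //.
  by apply/measurable_EFinP; exact: measurableT_comp.
have := ae_integrable1 fub; apply: filterS => t it _.
by rewrite fineK//; exact: integrable_fin_num it.
Qed.

(** The signed angle under which [a, b] is seen at distance [u] from a point above or below x; it is
    odd in [u], so its sign tells the side. *)
Definition akern (R : realType) (a b u x : R) : R := atan ((b - x) / u) - atan ((a - x) / u).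

Lemma akern_pharm (R : realType) (a b u x : R) : akern a b u x = pi * pharm x u a b.
Proof. by rewrite /pharm mulrC divfK// gt_eqF// pi_gt0. Qed.

Lemma akern_ge0 (R : realType) (a b u x : R) : a <= b -> 0 <= u -> 0 <= akern a b u x.
Proof.
move=> ab u0; rewrite subr_ge0 le_atan// ler_wpM2r ?invr_ge0//; lra.
Qed.

Lemma akern_lepi (R : realType) (a b u x : R) : akern a b u x <= pi.
Proof. by rewrite /akern; have := atan_ltpi2 ((b - x) / u); have := atan_gtNpi2 ((a - x) / u); lra. Qed.

Lemma akernN (R : realType) (a b u x : R) : akern a b (- u) x = - akern a b u x.
Proof. by rewrite /akern invrN !mulrN !atanN; ring. Qed.

Lemma measurable_atan (R : realType) : measurable_fun setT (@atan R).
Proof. by apply: continuous_measurable_fun => x; exact: continuous_atan. Qed.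

Lemma measurable_akern (R : realType) (a b : R) (u : R * R -> R) :
  measurable_fun setT u -> measurable_fun setT (fun p : R * R => akern a b (u p) p.1).
Proof.
move=> mu; have mc (c : R) : measurable_fun setT (fun p : R * R => atan ((c - p.1) / u p)).
  apply: (measurableT_comp (@measurable_atan R)); apply: measurable_funM; first exact: measurable_funB.
  exact: (measurableT_comp (@measurable_invr R) mu).
exact: measurable_funB.
Qed.

Lemma fubini_real_line (R : realType) (mu : {finite_measure set (R * R)%type -> \bar R})
    (s a b : R) : carried mu (@real_line R) -> a < b ->
  (\int[@lebesgue_measure R]_(t in `[a, b]) (- complex.Im (cauchy_transform mu (t +i* s)))%:E =
   \int[mu]_p (akern a b s p.1)%:E)%E.
Proof.
move=> [mS S0] ab; rewrite fubini_line//.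
have mu' (u : R * R -> R) : measurable_fun setT u -> measurable_fun setT (fun p : R * R => (akern a b (u p) p.1)%:E).
  by move=> ?; apply/measurable_EFinP; exact: measurable_akern.
apply: ae_eq_integral => //.
- by apply: (mu' (fun p => s - p.2)); exact: measurable_funB.
- exact: (mu' (fun=> s)).
exists (~` @real_line R); split=> //; first exact: measurableC.
by move=> p /= H [_ /= p2]; apply: H => _; rewrite p2 subr0.
Qed.

(** Stieltjes inversion in one direction: on a low line over [a, b] the integral of - Im is at most
    e (b - a), while every point of [a', b'] sees [a, b] under an angle of at least pi / 2. *)
Lemma local_vanish (R : realType) (mu : {finite_measure set (R * R)%type -> \bar R}) (a b a' b' : R) :
  carried mu (@real_line R) -> a < a' -> b' < b -> a < b ->
  (forall t, a <= t <= b -> forall e : R, 0 < e -> exists2 d : R, 0 < d &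
     forall z, 0 < complex.Im z -> cabs (z - t%:C) < d ->
       `|complex.Im (cauchy_transform mu z)| < e) ->
  mu (`[a', b'] `*` setT) = 0%E.
Proof.
move=> cR aa bb ab H.
(* Extended by 0 to the closed lower half plane, the imaginary part is continuous at each point of
   the segment, and compactness turns the pointwise hypothesis into one height [s] for all t. *)
pose g (q : R * R) := if 0 < q.2 then complex.Im (cauchy_transform mu (q.1 +i* q.2)) else 0.
have gc (q : R * R) : a <= q.1 <= b -> 0 <= q.2 <= 0 -> {for q, continuous g}.
  case: q => t y' /= tab /le_anti y0; rewrite -{}y0 {y'}; apply/cvgrPdist_lt => e e0.
  have [d d0 dH] := H t tab e e0.
  suff : nbhs ((t, 0) : R * R) [set q : R * R | `|g (t, 0) - g q| < e] by [].
  apply/nbhs_ballP; exists (d / 2) => /=; first by rewrite divr_gt0.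
  move=> [x y] [/=]; rewrite -!ball_normE /ball_ /= /g ltxx /= => xd yd.
  have key : cabs (x +i* y - t%:C) < d.
    apply: (le_lt_trans (cabs_le _)); rewrite ReB ImB /=.
    by move: xd yd; rewrite distrC sub0r subr0 normrN; clear; lra.
  rewrite sub0r normrN.
  case: ifPn => [y0|_]; last by rewrite normr0.
  exact: (dH (x +i* y) y0 key).
have small (e : R) : 0 < e -> (mu (`[a', b'] `*` setT) <= (2 / pi * (e * (b - a)))%:E)%E.
  move=> e0; have [r r0 rH] := box_unif_cont gc e0.
  pose s := Num.min (r / 2) (Num.min (a' - a) (b - b')).
  have s0 : 0 < s by rewrite /s !lt_min divr_gt0// !subr_gt0 aa.
  have [sr sa sb] : [/\ s < r, s <= a' - a & s <= b - b'].
    split; last 2 first.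
    - by rewrite /s !ge_min lexx orbT.
    - by rewrite /s !ge_min lexx !orbT.
    by rewrite /s gt_min; apply/orP; left; lra.
  have up : (\int[@lebesgue_measure R]_(t in `[a, b]) (- complex.Im (cauchy_transform mu (t +i* s)))%:E
      <= (e * (b - a))%:E)%E.
    have -> : ((e * (b - a))%:E = \int[@lebesgue_measure R]_(t in `[a, b]) (cst e%:E) t)%E.
      rewrite integral_cst//.
      have lm : @lebesgue_measure R `[a, b]%classic = (b - a)%:E.
        by rewrite lebesgue_measure_itv /= lte_fin ab EFinB.
      by rewrite EFinM; congr (_ * _)%E; rewrite -lm.
    have cI (t : R) : {for t, continuous (fun t : R => - complex.Im (cauchy_transform mu (t +i* s)))}.
      have [l dl] : exists l, cderiv (cauchy_transform mu) (t +i* s) l.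
        apply: (cauchy_cderiv cR s0) => p [_ /= p2]; apply: le_trans (Im_le_cabs _).
        by rewrite ImB /= p2 subr0 gtr0_norm.
      have ex : derivable (fun t : R => complex.Im (cauchy_transform mu (t +i* s))) t 1.
        by have := cderiv_Im_x dl => ?; exact: ex_derive.
      by apply: cvgN; apply/differentiable_continuous/derivable1_diffP.
    apply: ge0_le_integral => //.
    - by move=> t _; rewrite lee_fin (neg_Im_cauchy t cR (@subset_refl _ _) s0); apply: Rintegral_ge0 => p _; exact: poisson_ge0.
    - by apply: measurable_funTS; apply/measurable_EFinP; exact: continuous_measurable_fun.
    move=> t /=; rewrite in_itv /= => tab; rewrite lee_fin.
    have := rH t 0 t s tab; rewrite lexx subrr normr0 subr0 gtr0_norm// => /(_ isT r0 sr).
    by rewrite /g /= ltxx s0 subr0 ltr_norml => /andP[+ _]; lra.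
  move: up; rewrite fubini_real_line// => up.
  (* Since [s] is at most a' - a and b - b', the angle is at least atan 1 - atan (- 1). *)
  have low : ((pi / 2)%:E * mu (`[a', b'] `*` setT) <= \int[mu]_p (akern a b s p.1)%:E)%E.
    have mA : measurable (`[a', b'] `*` setT : set (R * R)) by apply: measurableX.
    have mk A : measurable_fun A (fun p : R * R => (akern a b s p.1)%:E).
      by apply: measurable_funTS; apply/measurable_EFinP; exact: (@measurable_akern _ _ _ (fun=> s)).
    rewrite -integral_cst//; apply: (@le_trans _ _ (\int[mu]_(p in `[a', b'] `*` setT) (akern a b s p.1)%:E)%E).
      apply: ge0_le_integral => //.
      - by move=> p _; rewrite lee_fin divr_ge0// pi_ge0.
      move=> p [/=]; rewrite in_itv /= => /andP[p1 p2] _; rewrite lee_fin.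
      have a1 : atan 1 <= atan ((b - p.1) / s) by rewrite le_atan// ler_pdivlMr// mul1r; lra.
      have a2 : atan ((a - p.1) / s) <= atan (- 1) by rewrite le_atan// ler_pdivrMr// mulN1r; lra.
      by rewrite /akern; move: a1 a2; rewrite atanN atan1; lra.
    apply: ge0_subset_integral => // p _; rewrite lee_fin; apply: akern_ge0; exact: ltW.
  have := le_trans low up.
  have mf : mu (`[a', b'] `*` setT) \is a fin_num by apply: fin_num_measure; apply: measurableX.
  rewrite -(fineK mf) -EFinM !lee_fin => h.
  have p0 := pi_gt0 R.
  by rewrite -invf_div ler_pdivlMl ?divr_gt0.
apply/eqP; rewrite eq_le measure_ge0 andbT; apply/lee_addgt0Pr => e e0; rewrite add0e.
have p0 := pi_gt0 R; have ba : 0 < b - a by rewrite subr_gt0.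
apply: (le_trans (small (e * (pi / 2) / (b - a)) _)).
  by rewrite divr_gt0// mulr_gt0// divr_gt0.
rewrite lee_fin le_eqVlt; apply/orP; left; apply/eqP.
by move: (pi : R) p0 => q p0; field; rewrite !gt_eqF.
Qed.

Lemma abs_akern (R : realType) (a b u x : R) : `|akern a b u x| <= pi.
Proof.
rewrite ler_norml akern_lepi andbT.
rewrite -[- pi]opprK -[leRHS]opprK lerN2 opprK -akernN; exact: akern_lepi.
Qed.

Lemma le_carried (R : realType) (mu : {finite_measure set (R * R)%type -> \bar R})
    (S : set (R * R)) (g h : R * R -> R) (B : R) :
  carried mu S -> measurable_fun setT g -> measurable_fun setT h ->
  (forall p, S p -> `|g p| <= B) -> (forall p, S p -> `|h p| <= B) ->
  (forall p, S p -> g p <= h p) -> \int[mu]_p g p <= \int[mu]_p h p.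
Proof.
move=> cS mg mh gB hB gh; rewrite (carried_Rintegral cS mg gB) (carried_Rintegral cS mh hB).
have [mS _] := cS; apply: le_Rintegral => //; apply: integrable_bounded => //; try eassumption.
  exact: measurable_funTS.
exact: measurable_funTS.
Qed.

Lemma Rintegral_indic (R : realType) (mu : {finite_measure set (R * R)%type -> \bar R})
    (A : set (R * R)) (c : R) :
  measurable A -> \int[mu]_p (c * \1_A p) = c * fine (mu A).
Proof.
move=> mA; have iA : mu.-integrable setT (EFin \o \1_A).
  apply: (@integrable_bounded _ mu setT \1_A 1) => // p _.
  by rewrite indicE; case: (p \in A); rewrite ?normr1 ?normr0.
rewrite RintegralZl// /Rintegral; congr (c * fine _).
by rewrite integral_indic// setIT.
Qed.

Lemma cabs_indic (R : realType) (A : set (R * R)) (c : R) p : `|c * \1_A p| <= `|c|.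
Proof. by rewrite indicE; case: (p \in A); rewrite ?mulr1 ?mulr0 ?normr0. Qed.

(* The integral of [- Im] of the Cauchy transform along a horizontal line is pi
   times the mass below the line minus the mass above it. *)
Lemma mass_side (R : realType) (mu nu : {finite_measure set (R * R)%type -> \bar R}) (L s sg : R) :
  0 < s -> sg = 1 \/ sg = - 1 -> carried mu (`[- L, L] `*` [set 0]) ->
  (forall t, complex.Im (cauchy_transform nu (t +i* (sg * s))) = complex.Im (cauchy_transform mu (t +i* (sg * s)))) ->
  (mu setT <= nu [set p | sg * p.2 < s]%R)%E.
Proof.
move=> s0 sgE cmu E; have p0 := pi_gt0 R.
have mg : measurable_fun setT (fun p : R * R => sg * p.2) by exact: measurable_funM.
have mB : measurable [set p : R * R | sg * p.2 < s].
  rewrite (_ : [set p : R * R | sg * p.2 < s] = setT `&` (fun p => sg * p.2) @^-1` `]-oo, s[%classic).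
    by apply: mg => //.
  by apply/seteqP; split=> p /=; rewrite in_itv /=; [move=> ?; split|move=> []].
have cmuR : carried mu (@real_line R).
  by apply: (carried_real cmu) => p [].
have mufin : mu setT \is a fin_num by exact: fin_num_measure.
have nufin : nu [set p | sg * p.2 < s] \is a fin_num by exact: fin_num_measure.
rewrite -(fineK mufin) -(fineK nufin) lee_fin; apply/ler_addgt0Pr => e e0.
set m := fine (mu setT); have m0 : 0 <= m by rewrite fine_ge0.
pose eta := e / (m + 1); have m1 : 0 < m + 1 by rewrite ltr_wpDl.
have eta0 : 0 < eta by rewrite divr_gt0.
have [U U0 UH] := atan_near_pi2 eta0.
(* From every point of [-L, L], both ends of [-T, T] are at least U s away, so the angle at height s
   is at least pi - 2 [eta]. *)
pose T : R := `|L| + U * s; have T0 : 0 < T by rewrite ltr_wpDl// mulr_gt0.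
have TT : - T < T by lra.
have ms : measurable_fun setT (fun p : R * R => s - sg * p.2) by exact: measurable_funB.
have mk := measurable_akern (- T) T ms.
have mk' := measurable_akern (- T) T (@measurable_cst _ _ (R * R)%type _ setT s).
have eqf : \int[nu]_p (akern (- T) T (s - sg * p.2) p.1) = \int[mu]_p (akern (- T) T s p.1).
  have eqs : \int[nu]_p (akern (- T) T (sg * s - p.2) p.1) = \int[mu]_p (akern (- T) T (sg * s) p.1).
    rewrite /Rintegral; congr fine; rewrite -(fubini_real_line _ cmuR TT) -(fubini_line nu _ TT).
    by apply: eq_integral => t _; rewrite E.
  case: sgE eqs => ->.
    by rewrite mul1r => <-; apply: eq_Rintegral => p _; rewrite mul1r.
  move=> eqs; rewrite -[LHS]opprK -RintegralN.
  have -> : \int[nu]_p (- akern (- T) T (s - -1 * p.2) p.1) = \int[nu]_p (akern (- T) T (-1 * s - p.2) p.1).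
    by apply: eq_Rintegral => p _; rewrite -akernN; congr akern; ring.
  rewrite eqs -RintegralN; apply: eq_Rintegral => p _.
  by rewrite -akernN; congr akern; ring.
have low : (pi - 2 * eta) * m <= \int[mu]_p (akern (- T) T s p.1).
  rewrite -Rintegral_cst//; apply: (@le_carried _ mu _ _ _ (pi + `|pi - 2 * eta|) cmu) => //.
  - by move=> p _; rewrite lerDr// ltW.
  - by move=> p _; apply: (le_trans (abs_akern _ _ _ _)); rewrite lerDl.
  move=> p [/=]; rewrite in_itv /= => /andP[p1 p2] _; have := ler_norm L => LL.
  have a1 : U <= (T - p.1) / s by rewrite ler_pdivlMr// /T; lra.
  have a2 : U <= (T + p.1) / s by rewrite ler_pdivlMr// /T; have := ler_norm (- L); rewrite normrN; lra.
  rewrite /akern (_ : (- T - p.1) / s = - ((T + p.1) / s)) ?atanN; last by ring.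
  by have := UH _ a1; have := UH _ a2; lra.
(* Mass of [nu] on or beyond the line sees the segment under a nonpositive angle; the rest
   contributes at most pi per unit mass. *)
have up : \int[nu]_p (akern (- T) T (s - sg * p.2) p.1) <= pi * fine (nu [set p | sg * p.2 < s]).
  rewrite -Rintegral_indic//; apply: (@le_carried _ nu setT _ _ pi) => //.
  - by split => //; rewrite setCT measure0.
  - by apply: measurable_funM => //; exact: measurable_indic.
  - by move=> p _; exact: abs_akern.
  - by move=> p _; apply: (le_trans (cabs_indic _ _ _)); rewrite gtr0_norm.
  move=> p _; rewrite indicE; case: (boolP (p \in _)) => h; first by rewrite mulr1 akern_lepi.
  rewrite mulr0 -[_ - _]opprK akernN oppr_le0; apply: akern_ge0; first exact: ltW.
  by move: h; rewrite notin_setE /= => /negP; rewrite -leNgt; lra.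
rewrite eqf in up; have := le_trans low up; set n := fine (nu _) => h.
have em : eta * m <= e by rewrite /eta mulrAC ler_pdivrMr// (ler_wpM2l (ltW e0))// lerDl.
have pi2 : 2 <= pi :> R by exact: pi_ge2.
have k1 : pi * m <= pi * (n + e).
  have : 2 * e <= pi * e by rewrite ler_pM2r.
  by rewrite [pi * (n + e)]mulrDr; move: h em; rewrite mulrBl; clear; lra.
by rewrite -(ler_pM2l p0).
Qed.

(** With equal total masses, [mass_side] leaves no mass of [nu] at or above height 1 / (n + 1), nor
    at or below its opposite, for any n. *)
Lemma carried_of_cauchy (R : realType) (mu nu : {finite_measure set (R * R)%type -> \bar R}) (L : R) :
  carried mu (`[- L, L] `*` [set 0]) -> nu setT = mu setT ->
  (forall z, complex.Im z != 0 ->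
     complex.Im (cauchy_transform nu z) = complex.Im (cauchy_transform mu z)) ->
  carried nu (@real_line R).
Proof.
move=> cmu munu E; pose B (sg : R) (n : nat) := [set p : R * R | sg * p.2 < n.+1%:R^-1].
have mB sg n : measurable (B sg n).
  have mg : measurable_fun setT (fun p : R * R => sg * p.2) by exact: measurable_funM.
  rewrite (_ : B sg n = setT `&` (fun p => sg * p.2) @^-1` `]-oo, n.+1%:R^-1[%classic).
    by apply: mg.
  by apply/seteqP; split=> p /=; rewrite in_itv /=; [move=> ?; split|move=> []].
have B0 sg n : sg = 1 \/ sg = - 1 -> nu (~` B sg n) = 0%E.
  move=> sgE; have n0 : 0 < n.+1%:R^-1 :> R by rewrite invr_gt0.
  have := mass_side n0 sgE cmu (fun t => E (t +i* (sg * n.+1%:R^-1)) _).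
  have sn : sg * n.+1%:R^-1 != 0.
    by rewrite mulf_neq0 ?invr_neq0 ?pnatr_eq0//; case: sgE => ->; rewrite ?oppr_eq0 oner_eq0.
  move=> /(_ (fun=> sn)); rewrite -munu -/(B sg n) => h.
  have : nu setT = (nu (B sg n) + nu (~` B sg n))%E.
    by rewrite -measureU ?setUv ?setICr//; exact: measurableC.
  have f1 : nu (B sg n) \is a fin_num by exact: fin_num_measure.
  have f2 : nu (~` B sg n) \is a fin_num by apply: fin_num_measure; exact: measurableC.
  move: h; rewrite -(fineK f1) -(fineK f2) => h e; move: h; rewrite e -EFinD !lee_fin => h.
  have g : 0 <= fine (nu (~` B sg n)) by rewrite fine_ge0.
  by congr (_%:E); apply/eqP; rewrite eq_le g andbT; move: h; clear; lra.
split; first exact: measurableX.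
apply: measure_negligible; first by apply: measurableC; exact: measurableX.
apply: (@negligibleS _ _ _ nu (\bigcup_n (~` B 1 n `|` ~` B (-1) n))).
  move=> p /= np; have p2 : p.2 != 0.
    by apply/eqP => p20; apply: np; split.
  have q0 : 0 <= `|p.2|^-1 by rewrite invr_ge0.
  have n0 := archi_boundP q0.
  have hn : (Num.bound (`|p.2|^-1)).+1%:R^-1 <= `|p.2|.
    rewrite -[leRHS]invrK lef_pV2 ?posrE ?invr_gt0 ?normr_gt0 ?ltr0n//.
    by rewrite (le_trans (ltW n0))// ler_nat.
  move: (Num.bound _) hn => N hn; exists N => //; have [pp|pn] := leP 0 p.2.
    by left; rewrite /B /= mul1r => h; move: hn; rewrite ger0_norm// leNgt h.
  by right; rewrite /B /= mulN1r => h; move: hn; rewrite ltr0_norm// leNgt h.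
apply: negligible_bigcup => n; apply: negligibleU; apply/negligibleP; try exact: measurableC.
  by apply: B0; left.
by apply: B0; right.
Qed.

Lemma pharm_sandwich (R : realType) (a b d e : R) : 0 < d -> 0 < e ->
  exists2 s : R, 0 < s & forall x,
    (a <= x <= b -> 1 - e <= pharm x s (a - d) (b + d)) /\
    (x <= a - 2 * d \/ b + 2 * d <= x -> pharm x s (a - d) (b + d) <= e).
Proof.
move=> d0 e0; have [U U0 UH] := atan_near_pi2 e0.
have p0 := pi_gt0 R; have p2 : 2 <= pi :> R := pi_ge2 R.
pose s := d / U; have s0 : 0 < s by rewrite divr_gt0.
have sU y : d <= y -> U <= y / s by move=> dy; rewrite ler_pdivlMr// /s mulrC divfK ?gt_eqF.
have h1 y : d <= y -> pi / 2 - e <= atan (y / s) by move=> /sU/UH; lra.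
have h2 y : d <= y -> atan (- y / s) <= e - pi / 2.
  by move=> /h1; rewrite mulNr atanN; lra.
exists s => // x; rewrite /pharm; split=> [/andP[ax xb]|xo].
  rewrite ler_pdivlMr//.
  have := h1 (b + d - x) ltac:(lra); have := h2 (x - (a - d)) ltac:(lra); rewrite opprB.
  have : e * 2 <= e * pi by rewrite ler_pM2l.
  by rewrite (_ : (1 - e) * pi = pi - e * pi); [lra|ring].
rewrite ler_pdivrMr//; have : e * 2 <= e * pi by rewrite ler_pM2l.
case: xo => xo.
  have := h1 (a - d - x) ltac:(lra); have := atan_ltpi2 ((b + d - x) / s); lra.
have := h2 (x - (b + d)) ltac:(lra); rewrite opprB.
have := atan_gtNpi2 ((a - d - x) / s); lra.
Qed.

(** Both measures integrate the angle of a slightly larger segment at a small height to the same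
    value. This kernel is nearly pi on [a, b], at most pi everywhere, and nearly 0 on the left of c,
    because d = (a - c) / 3 leaves c <= a - 2 d. *)
Lemma sandwich_le (R : realType) (mu nu : {finite_measure set (R * R)%type -> \bar R}) (c a b : R) :
  carried mu (@real_line R) -> carried nu (@real_line R) ->
  (forall z, complex.Im z != 0 ->
     complex.Im (cauchy_transform nu z) = complex.Im (cauchy_transform mu z)) ->
  c < a -> a <= b ->
  (nu (`[a, b] `*` setT) <= mu (`]c, +oo[ `*` setT))%E.
Proof.
move=> cmu cnu E ca ab.
have mA : measurable (`[a, b] `*` setT : set (R * R)) by apply: measurableX.
have mB : measurable (`]c, +oo[ `*` setT : set (R * R)) by apply: measurableX.
have f1 : nu (`[a, b] `*` setT) \is a fin_num by exact: fin_num_measure.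
have f2 : mu (`]c, +oo[ `*` setT) \is a fin_num by exact: fin_num_measure.
rewrite -(fineK f1) -(fineK f2) lee_fin; apply/ler_addgt0Pr => eps eps0.
set A := `[a, b] `*` setT in mA f1 *; set B := `]c, +oo[ `*` setT in mB f2 *.
set n := fine (nu A); set m := fine (mu B).
have n0 : 0 <= n by rewrite fine_ge0.
set M := fine (mu setT); have M0 : 0 <= M by rewrite fine_ge0.
have d0 : 0 < (a - c) / 3 by rewrite divr_gt0// subr_gt0.
pose e := eps / (n + M + 1); have k0 : 0 < n + M + 1 by lra.
have e0 : 0 < e by rewrite divr_gt0.
have [s s0 sH] := pharm_sandwich a b d0 e0.
set d := (a - c) / 3 in d0 sH; pose k x := akern (a - d) (b + d) s x.
have kE x : k x = pi * pharm x s (a - d) (b + d) by exact: akern_pharm.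
have p0 := pi_gt0 R.
have dd : a - d < b + d by lra.
have mk : measurable_fun setT (fun p : R * R => k p.1).
  exact: (@measurable_akern _ _ _ (fun=> s)).
have cT (rho : {finite_measure set (R * R)%type -> \bar R}) : carried rho setT.
  by split=> //; rewrite setCT measure0.
have eqk : \int[nu]_p k p.1 = \int[mu]_p k p.1.
  rewrite /Rintegral; congr fine; rewrite -(fubini_real_line s cmu dd) -(fubini_real_line s cnu dd).
  by apply: eq_integral => t _; rewrite E//= gt_eqF.
have low : pi * (1 - e) * n <= \int[nu]_p k p.1.
  rewrite -Rintegral_indic//; apply: (@le_carried _ nu setT _ _ (`|pi * (1 - e)| + pi)) => //.
  - by apply: measurable_funM => //; exact: measurable_indic.
  - by move=> p _; apply: (le_trans (cabs_indic _ _ _)); rewrite lerDl ltW.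
  - by move=> p _; apply: (le_trans (abs_akern _ _ _ _)); rewrite lerDr.
  move=> p _; rewrite indicE; case: (boolP (p \in A)) => h; last first.
    by rewrite mulr0; apply: akern_ge0; exact: ltW.
  rewrite mulr1 kE ler_pM2l//; have [+ _] := sH p.1; apply.
  by move: h; rewrite inE => -[]; rewrite /= in_itv.
have up : \int[mu]_p k p.1 <= pi * m + pi * e * M.
  have -> : pi * m + pi * e * M = \int[mu]_p (pi * \1_B p + pi * e).
    rewrite RintegralD//; last 2 first.
    - apply: (@integrable_bounded _ mu setT (fun p => pi * \1_B p) `|pi|) => //.
        by apply: measurable_funM => //; exact: measurable_indic.
      by move=> p _; exact: cabs_indic.
    - exact: finite_measure_integrable_cst.
    by rewrite Rintegral_indic// Rintegral_cst.
  apply: (@le_carried _ mu setT _ _ (`|pi| + `|pi * e|)) => //.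
  - by apply: measurable_funD => //; apply: measurable_funM => //; exact: measurable_indic.
  - move=> p _; apply: (le_trans (abs_akern _ _ _ _)).
    by rewrite (le_trans (ler_norm pi))// lerDl.
  - by move=> p _; apply: (le_trans (ler_normD _ _)); rewrite lerD2r; exact: cabs_indic.
  move=> p _; rewrite indicE; case: (boolP (p \in B)) => h.
    by rewrite mulr1; apply: (le_trans (akern_lepi _ _ _ _)); rewrite lerDl mulr_ge0// ltW.
  rewrite mulr0 add0r kE ler_pM2l//; have [_] := sH p.1; apply; left.
  move: h; rewrite notin_setE /B /= in_itv /= andbT => h.
  have : p.1 <= c by rewrite leNgt; apply/negP => h'; apply: h.
  by rewrite /d; lra.
rewrite eqk in low; have h := le_trans low up.
have h2 : (1 - e) * n <= m + e * M.
  by rewrite -(ler_pM2l p0) mulrA [leRHS]mulrDr (mulrA pi e).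
have h3 : e * (n + M) <= eps.
  by rewrite /e mulrAC ler_pdivrMr// (ler_wpM2l (ltW eps0))// lerDl.
by move: h2 h3; clear; rewrite mulrBl mulrDr mul1r; lra.
Qed.

Lemma cauchy_unique (R : realType) (mu nu : {finite_measure set (R * R)%type -> \bar R}) (L : R) :
  carried mu (`[- L, L] `*` [set 0]) -> nu setT = mu setT ->
  (forall z, complex.Im z != 0 ->
     complex.Im (cauchy_transform nu z) = complex.Im (cauchy_transform mu z)) ->
  forall A, measurable A -> nu A = mu A.
Proof.
move=> cmu munu E; have cnu := carried_of_cauchy cmu munu E.
have cmu' : carried mu (@real_line R) by apply: (carried_real cmu) => p [].
have E' z : complex.Im z != 0 ->
    complex.Im (cauchy_transform mu z) = complex.Im (cauchy_transform nu z) by move/E.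
(* An open ray is the increasing union of closed intervals to which [sandwich_le] applies;
   exchanging the measures gives equality on rays. *)
have ray_le (rho1 rho2 : {finite_measure set (R * R)%type -> \bar R}) c :
    carried rho1 (@real_line R) -> carried rho2 (@real_line R) ->
    (forall z, complex.Im z != 0 ->
      complex.Im (cauchy_transform rho2 z) = complex.Im (cauchy_transform rho1 z)) ->
    (rho2 (`]c, +oo[ `*` setT) <= rho1 (`]c, +oo[ `*` setT))%E.
  move=> c1 c2 E12; pose I n : set (R * R) := `[c + n.+1%:R^-1, c + n.+1%:R] `*` setT.
  have cv : (rho2 \o I) n @[n --> \oo] --> rho2 (\bigcup_n I n).
    apply: nondecreasing_cvg_mu.
    - by move=> n; apply: measurableX.
    - by apply: bigcup_measurable => n _; apply: measurableX.
    move=> i j ij; apply/subsetPset => p [/=]; rewrite !in_itv /= => /andP[p1 p2] _.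
    split=> //=; rewrite in_itv /=; apply/andP; split.
      by apply: le_trans p1; rewrite lerD2l lef_pV2 ?posrE// ler_nat.
    by apply: (le_trans p2); rewrite lerD2l ler_nat.
  have UE : `]c, +oo[ `*` setT = \bigcup_n I n.
    apply/seteqP; split=> [p [/=]|p [n _ [/=]]]; rewrite !in_itv /= ?andbT.
      move=> cp _; have q0 : 0 < p.1 - c by rewrite subr_gt0.
      have b1 := archi_boundP (ltW q0); have q1 : 0 <= (p.1 - c)^-1 by rewrite invr_ge0 ltW.
      have b2 := archi_boundP q1.
      exists (maxn (Num.bound (p.1 - c)) (Num.bound (p.1 - c)^-1)) => //; split=> //=.
      rewrite in_itv /=; apply/andP; split.
        rewrite -lerBrDl -[leRHS]invrK lef_pV2 ?posrE ?invr_gt0 ?ltr0n//.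
        by apply: (le_trans (ltW b2)); rewrite ler_nat ltnW// ltnS leq_maxr.
      rewrite -lerBlDl; apply: (le_trans (ltW b1)).
      by rewrite ler_nat ltnW// ltnS leq_maxl.
    move=> /andP[p1 _] _; split=> //.
    by apply: lt_le_trans p1; rewrite ltrDl.
  rewrite [X in (X <= _)%E](_ : _ = rho2 (\bigcup_n I n)); last by rewrite UE.
  rewrite -(cvg_lim _ cv)//; apply: lime_le; first by apply/cvg_ex; eexists; exact: cv.
  apply: nearW => n; apply: (sandwich_le c1 c2 E12); first by rewrite ltrDl.
  rewrite lerD2l (@le_trans _ _ 1)//; last by rewrite ler1n.
  by rewrite invf_le1 ?ler1n.
have ray c : nu (`]c, +oo[ `*` setT) = mu (`]c, +oo[ `*` setT).
  by apply/eqP; rewrite eq_le !ray_le.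
have mfst : measurable_fun setT (fun p : R * R => p.1) by exact: measurable_fst.
(* Open rays form a generating system stable under intersection, so the projections to the first
   coordinate coincide; both measures sit on the real line and are recovered from them. *)
pose nu0 : {measure set R -> \bar R} := pushforward nu (fun p : R * R => p.1).
pose mu0 : {measure set R -> \bar R} := pushforward mu (fun p : R * R => p.1).
have eq0 B : measurable B -> nu0 mfst B = mu0 mfst B.
  move: B; apply: (@measure_unique _ R R (@RGenOInfty.G R) (fun n => `](- n%:R), +oo[%classic) _ _ _ _ (nu0 mfst) (mu0 mfst)).
  - exact: RGenOInfty.measurableE.
  - move=> _ _ [x ->] [y ->]; exists (Num.max x y).
    apply/seteqP; split=> z /=; rewrite !in_itv /= !andbT gt_max; first by move=> [-> ->].
    by move=> /andP[].
  - by move=> n; exists (- n%:R).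
  - rewrite -subTset => z _; exists (Num.bound `|z|) => //=; rewrite in_itv /= andbT.
    have := archi_boundP (normr_ge0 z); have := ler_norm (- z); rewrite normrN.
    by move: (Num.bound _)%:R => q; lra.
  - move=> _ [x ->]; have pE : (fun p : R * R => p.1) @^-1` `]x, +oo[ = `]x, +oo[ `*` setT.
      by apply/seteqP; split=> p /=; [move=> ?; split|move=> []].
    by rewrite /nu0 /mu0 /= /pushforward pE ray.
  - move=> k; rewrite ltey_eq; apply/orP; left; apply: fin_num_measure.
    by rewrite -[X in measurable X]setTI; apply: mfst => //; exact: measurable_itv.
have onl (rho : {finite_measure set (R * R)%type -> \bar R}) A : carried rho (@real_line R) ->
    measurable A -> rho A = rho (A `&` @real_line R).
  move=> [ml rl0] mA; rewrite -[in LHS](setIT A) -(setUv (@real_line R)) setIUr measureU.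
  - rewrite [X in (_ + X)%E](_ : _ = 0%E) ?adde0//; apply: subset_measure0 rl0.
    + by apply: measurableI => //; exact: measurableC.
    + exact: measurableC.
    + exact: subIsetr.
  - exact: measurableI.
  - by apply: measurableI => //; exact: measurableC.
  - by rewrite setIACA setICr setI0.
move=> A mA; pose B := [set x : R | A (x, 0)].
have mB : measurable B.
  have mp : measurable_fun setT (fun x : R => (x, 0) : R * R) by apply: measurable_fun_pair.
  by rewrite -[B]setTI; exact: mp.
have AB : A `&` @real_line R = (fun p : R * R => p.1) @^-1` B `&` @real_line R.
  apply/seteqP; split=> p [/= h [_ /= p2]]; split=> //; rewrite /B /=.
    by rewrite -p2; case: p h p2.
  by move: h; rewrite /B /= -{1}p2; case: p p2.
have mfB : measurable ((fun p : R * R => p.1) @^-1` B).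
  by rewrite -[X in measurable X]setTI; apply: measurable_fst.
rewrite (onl nu A cnu mA) (onl mu A cmu' mA) AB -(onl nu) // -(onl mu) //.
exact: eq0.
Qed.

(** * The structure of the support *)

Lemma finite_union_compact (R : realType) (E : set R) : finite_union_itv_pts E ->
  compact E /\ exists2 L : R, 0 < L & forall x, E x -> - L <= x <= L.
Proof.
move=> [I [F [_ ->]]].
have cE : compact ((\bigcup_(ab in [set` I]) [set` `[ab.1, ab.2]]) `|` [set` F]).
  apply: compactU; last exact/finite_compact/finite_seq.
  elim: I => [|ab I IH].
    by rewrite set_nil bigcup_set0; exact: compact0.
  rewrite (_ : [set` ab :: I] = [set ab] `|` [set` I]); last first.
    apply/seteqP; split=> x /=; rewrite inE; first by move=> /orP[/eqP ->|]; [left|right].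
    by move=> [->|->]; rewrite ?eqxx ?orbT.
  by rewrite bigcup_setU bigcup_set1; apply: compactU => //; exact: segment_compact.
split=> //; have [L [_ LH]] := compact_bounded cE.
exists (Num.max 1 (L + 1)); first by rewrite lt_max ltr01.
move=> x Ex; rewrite -ler_norml; apply: LH => //.
by rewrite lt_max ltrDl ltr01 orbT.
Qed.

Lemma nearest_below (R : realType) (Z : seq R) (x z0 : R) : z0 \in Z -> z0 < x ->
  exists a, [/\ a \in Z, a < x & forall z, z \in Z -> z < x -> z <= a].
Proof.
move=> z0Z z0x; suff : forall Z : seq R, (exists a, [/\ a \in Z, a < x & forall z, z \in Z -> z < x -> z <= a]) \/
    (forall z, z \in Z -> x <= z).
  by move=> /(_ Z)[//|/(_ _ z0Z)]; rewrite leNgt z0x.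
move=> {z0Z}; elim => [|w {}Z [[b [bZ bx bH]]|H]]; first by right.
  left; have [wx|xw] := ltP w x; last first.
    exists b; split=> //; first by rewrite inE bZ orbT.
    by move=> z; rewrite inE => /orP[/eqP ->|/bH //]; rewrite ltNge xw.
  have [wb|bw] := leP w b.
    exists b; split=> //; first by rewrite inE bZ orbT.
    by move=> z; rewrite inE => /orP[/eqP ->|/bH //].
  exists w; split=> //; first by rewrite inE eqxx.
  by move=> z; rewrite inE => /orP[/eqP ->//|zZ zx]; exact: le_trans (bH _ zZ zx) (ltW bw).
have [wx|xw] := ltP w x; last first.
  by right=> z; rewrite inE => /orP[/eqP ->|/H].
left; exists w; split=> //; first by rewrite inE eqxx.
by move=> z; rewrite inE => /orP[/eqP ->//|/H]; rewrite leNgt => /negP zx /zx.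
Qed.

Lemma nearest_above (R : realType) (Z : seq R) (x z0 : R) : z0 \in Z -> x < z0 ->
  exists b, [/\ b \in Z, x < b & forall z, z \in Z -> x < z -> b <= z].
Proof.
move=> z0Z xz0; have [||a [aZ ax aH]] := @nearest_below _ [seq - z | z <- Z] (- x) (- z0).
- exact: map_f.
- by rewrite ltrN2.
move/mapP: aZ ax aH => [b bZ ->]; rewrite ltrN2 => xb bH; exists b; split=> // z zZ xz.
by rewrite -lerN2; apply: bH; [exact: map_f|rewrite ltrN2].
Qed.

Lemma locally_constant_oo (R : realType) (S : set R) (a b : R) :
  (forall t, a < t < b -> exists2 d : R, 0 < d & forall s, `|s - t| < d -> (S s <-> S t)) ->
  forall s t, a < s < b -> a < t < b -> S s -> S t.
Proof.
move=> H; have main s t : a < s < b -> a < t < b -> s <= t -> (S s <-> S t).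
  move=> /andP[as_ _] /andP[_ tb] st; apply: locally_constant_itv => // u /andP[su ut].
  have [|d d0 dH] := H u; first by rewrite (lt_le_trans as_) ?(le_lt_trans ut).
  by exists d => // w _; exact: dH.
move=> s t hs ht; have [st|/ltW ts] := leP s t; first by rewrite (main _ _ hs ht st).
by rewrite (main _ _ ht hs ts).
Qed.

(** Between neighbouring points of a finite set, S is all or nothing by connectedness, and if it is
    all then closedness adds the two endpoints. What remains are isolated points among the finite
    set. *)
Lemma real_set_structure (R : realType) (S : set R) (L : R) (Z : seq R) :
  closed S -> (forall x, S x -> - L <= x <= L) ->
  (forall x, x \notin Z -> exists2 d : R, 0 < d & forall t, `|t - x| < d -> (S t <-> S x)) ->
  exists (I : seq (R * R)) (F : seq R),
    [/\ {in I, forall ab, ab.1 < ab.2},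
        S = (\bigcup_(ab in [set` I]) [set` `[ab.1, ab.2]]) `|` [set` F] &
        {in F, forall x, exists a b, a < x < b /\ forall t, a < t < b -> S t -> t = x}].
Proof.
(* The two added points lie outside S, so each point of S has a neighbour from [W] on either
   side. *)
move=> cS SL lc; pose W := [:: - L - 1, L + 1 & Z].
have lcW x : x \notin W -> exists2 d : R, 0 < d & forall t, `|t - x| < d -> (S t <-> S x).
  by rewrite !inE !negb_or => /and3P[_ _ /lc].
have gap a b : a < b -> (forall z, z \in W -> ~~ (a < z < b)) ->
    forall s t, a < s < b -> a < t < b -> S s -> S t.
  move=> ab nW; apply: locally_constant_oo => t tab; apply: lcW.
  by apply/negP => /nW; rewrite tab.
have closed_gap a b s : a < s < b -> (forall z, z \in W -> ~~ (a < z < b)) -> S s ->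
    [set` `[a, b]] `<=` S.
  move=> /andP[as_ sb] nW Ss t /=; rewrite in_itv /= => /andP[at_ tb].
  have ab := lt_trans as_ sb.
  have inner u : a < u < b -> S u by move=> ub; apply: (gap _ _ ab nW s) => //; rewrite as_.
  apply: contrapT => nt; have oS : open (~` S) by rewrite openC.
  have /nbhs_ballP[d /= d0 dH] := open_nbhs_nbhs (conj oS nt).
  pose m := (a + b) / 2; pose lam := Num.min (d / (2 * (b - a))) 1.
  have ba : 0 < b - a by rewrite subr_gt0.
  have l0 : 0 < lam by rewrite /lam lt_min ltr01 divr_gt0// mulr_gt0.
  have l1 : lam <= 1 by rewrite /lam ge_min lexx orbT.
  have l2 : lam * (b - a) <= d / 2.
    have : lam <= d / (2 * (b - a)) by rewrite /lam ge_min lexx.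
    move=> h; apply: (le_trans (ler_wpM2r (ltW ba) h)).
    by rewrite le_eqVlt; apply/orP; left; apply/eqP; field; rewrite gt_eqF.
  (* The point [t], possibly an endpoint, moved slightly towards the midpoint: inside the open gap,
     yet within [d] of [t]. *)
  pose u := t + lam * (m - t).
  have um : a < u < b by rewrite /u /m; apply/andP; split; nra.
  apply: (dH u _ (inner u um)); rewrite /ball /= /u opprD addrA subrr sub0r normrN normrM gtr0_norm//.
  apply: (@le_lt_trans _ _ (lam * (b - a))); last lra.
  by rewrite ler_pM2l// ler_norml /m; apply/andP; split; lra.
have LW : - L - 1 \in W by rewrite inE eqxx.
have LW' : L + 1 \in W by rewrite !inE eqxx orbT.
have around x : S x -> exists a b, [/\ a \in W, b \in W, a < x < b &
    forall z, z \in W -> z != x -> ~~ (a < z < b)].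
  move=> /SL/andP[x1 x2].
  have [a [aW ax aH]] := nearest_below LW (ltac:(lra) : - L - 1 < x).
  have [b [bW xb bH]] := nearest_above LW' (ltac:(lra) : x < L + 1).
  exists a, b; split=> //; first by rewrite ax.
  move=> z zW; rewrite neq_lt => /orP[zx|xz]; rewrite negb_and -!leNgt.
    by rewrite aH.
  by rewrite bH ?orbT.
(* All pairs from [W] whose segment lies in S, not just neighbours: overlaps do not matter, and no
   sorting is required. *)
pose I := [seq ab <- [seq (a, b) | a <- W, b <- W] | (ab.1 < ab.2) && `[< [set` `[ab.1, ab.2]] `<=` S >]].
have IP a b : a \in W -> b \in W -> a < b -> [set` `[a, b]] `<=` S -> (a, b) \in I.
  move=> aW bW ab sub; rewrite mem_filter; apply/andP; split; last exact: allpairs_f.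
  by rewrite /= ab; exact/asboolP.
have IS ab : ab \in I -> ab.1 < ab.2 /\ [set` `[ab.1, ab.2]] `<=` S.
  by rewrite mem_filter => /andP[/andP[-> /asboolP]].
pose F := [seq x <- W | `[< S x /\ forall ab, ab \in I -> ~~ (ab.1 <= x <= ab.2) >]].
exists I, F; split.
- by move=> ab /IS[].
- apply/seteqP; split=> x.
    move=> Sx; have [a [b [aW bW axb nW]]] := around x Sx.
    have [xW|xW] := boolP (x \in W).
      have [[ab abI xab]|H] := pselect (exists2 ab, ab \in I & ab.1 <= x <= ab.2).
        by left; exists ab => //=; rewrite in_itv.
      right; rewrite /= mem_filter xW andbT; apply/asboolP; split=> // ab abI.
      by apply/negP => h; apply: H; exists ab.
    left; exists (a, b) => /=; last by rewrite in_itv /=; case/andP: axb => /ltW -> /ltW ->.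
    apply: IP => //; first by case/andP: axb => /lt_trans h /h.
    apply: closed_gap axb _ Sx => z zW; apply: nW => //; apply: contraNneq xW => <-.
    exact: zW.
  move=> [[ab /= /IS[_ sub] xab]|/=]; first exact: sub.
  by rewrite mem_filter => /andP[/asboolP[]].
- move=> x; rewrite mem_filter => /andP[/asboolP[Sx nI] xW].
  have [a [b [aW bW /andP[ax xb] nW]]] := around x Sx.
  exists a, b; split; first by rewrite ax.
  move=> t /andP[at_ tb] St; apply/eqP; rewrite eq_le; apply/andP; split; rewrite leNgt; apply/negP => h.
    have : (x, b) \in I.
      apply: IP => //; apply: (closed_gap _ _ t) => //; first by rewrite h.
      move=> z zW; have [->|zx] := eqVneq z x; first by rewrite ltxx.
      by apply: contraNN (nW z zW zx) => /andP[/(lt_trans ax) -> ->].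
    by move=> /nI /=; rewrite lexx (ltW xb).
  have : (a, x) \in I.
    apply: IP => //; apply: (closed_gap _ _ t) => //; first by rewrite at_.
    move=> z zW; have [->|zx] := eqVneq z x; first by rewrite ltxx andbF.
    by apply: contraNN (nW z zW zx) => /andP[-> /= /lt_trans]; apply.
  by move=> /nI /=; rewrite lexx (ltW ax).
Qed.

Lemma affine_analytic (R : realType) (u v w : R) (p : R * R) :
  analytic_at (fun q : R * R => u * q.1 + v * q.2 + w) p.
Proof.
pose c (i j : nat) : R := match i, j with
  | 0%N, 0%N => u * p.1 + v * p.2 + w | 1%N, 0%N => u | 0%N, 1%N => v | _, _ => 0 end.
exists 1, (`|u * p.1 + v * p.2 + w| + `|u| + `|v|), c; split=> // [i j|x y _ _].
  have [h1 h2 h3] : [/\ 0 <= `|u * p.1 + v * p.2 + w|, 0 <= `|u| & 0 <= `|v|] by split.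
  by rewrite expr1n mulr1 /c; case: i => [|[|i]]; case: j => [|[|j]]; rewrite ?normr0; lra.
apply: cvg_near_cst; exists 2%N => // -[|[|n]]//= _.
rewrite big_ord_recl [X in _ + X]big_ord_recl /= [X in _ + (_ + X)]big1 => [|i _]; last first.
  by apply: big1 => j _; rewrite /c /= !mul0r.
rewrite !big_ord_recl /= !big1 => [|i _|i _]; try by rewrite /c /= !mul0r.
by rewrite /c /= !expr0 !expr1 !mulr1 !mul0r !addr0; ring.
Qed.

Lemma segment_arc (R : realType) (a b : R) : a < b ->
  compact_semianalytic_arc (realset [set` `[a, b]]).
Proof.
move=> ab; split.
  move=> p; exists setT; split=> //; first exact: openT.
  (* Only conditions g = 0 and g > 0 are available, so the closed segment is described as the open
     segment (i = 0) together with its endpoints a (i = 1) and b (i = 2), each list padded to three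
     conditions. *)
  pose g (i j : 'I_3) (q : R * R) : R := if j == 0 :> nat then q.2 else
    if i == 0 :> nat then (if j == 1 :> nat then q.1 - a else b - q.1)
    else if i == 1 :> nat then q.1 - a else b - q.1.
  exists 3, 3, g, (fun i j => (i == 0 :> nat) && (j != 0 :> nat)); split.
    move=> i j q _.
    have [u [v [w E]]] : exists u v w, g i j = (fun q : R * R => u * q.1 + v * q.2 + w).
      rewrite /g; case: (j == 0 :> nat); first by exists 0, 1, 0; apply/funext => q'; ring.
      case: (i == 0 :> nat); [case: (j == 1 :> nat)|case: (i == 1 :> nat)];
        by [exists 1, 0, (- a); apply/funext => q'; ring|exists (-1), 0, b; apply/funext => q'; ring].
    by rewrite E; exact: affine_analytic.
  pose j0 : 'I_3 := Ordinal (isT : 0 < 3)%N.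
  pose j1 : 'I_3 := Ordinal (isT : 1 < 3)%N.
  pose j2 : 'I_3 := Ordinal (isT : 2 < 3)%N.
  move=> [x y] _; split.
    move=> [/= xab y0]; move: xab; rewrite in_itv /= => /andP[]; rewrite le_eqVlt => /orP[/eqP xa _|ax].
      exists j1 => j; rewrite /g /= xa; case: ifP => _ //; exact: subrr.
    rewrite le_eqVlt => /orP[/eqP xb|xb].
      exists j2 => j; rewrite /g /= xb; case: ifP => _ //; exact: subrr.
    exists j0 => j; rewrite /g /=; case: (j == 0 :> nat) => //=.
    by case: (j == 1 :> nat); rewrite subr_gt0.
  move=> [i H]; have y0 := H j0; have h1 := H j1; have h2 := H j2.
  move: y0 h1 h2; rewrite /g /= andbF => y0; case: i {H} => -[|[|[|//]]] _ /= h1 h2.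
  - by split=> //=; rewrite in_itv /=; apply/andP; split; lra.
  - by split=> //=; rewrite in_itv /=; apply/andP; split; lra.
  - by split=> //=; rewrite in_itv /=; apply/andP; split; lra.
have ba : 0 < b - a by rewrite subr_gt0.
exists (fun t => (a + (b - a) * t, 0)); split.
- apply: continuous_subspaceT => t.
  have c1 : (fun t : R => a + (b - a) * t) @ t --> a + (b - a) * t.
    by apply: cvgD; [exact: cvg_cst|apply: cvgM; [exact: cvg_cst|exact: cvg_id]].
  exact: (cvg_pair c1 (cvg_cst (0 : R))).
- by move=> s t _ _ [] /addrI/(mulfI (lt0r_neq0 ba)).
- apply/seteqP; split=> [[x y] [/=]|_ [t /= + <-]].
    rewrite in_itv /= => /andP[ax xb] ->; exists ((x - a) / (b - a)).
      rewrite /= in_itv /= ler_pdivlMr// mul0r ler_pdivrMr// mul1r.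
      by apply/andP; split; lra.
    by rewrite mulrC divfK ?gt_eqF// addrC subrK.
  rewrite in_itv /= => /andP[t0 t1]; split=> //=; rewrite in_itv /=.
  have h1 : 0 <= (b - a) * t by rewrite mulr_ge0// ltW.
  have h2 : (b - a) * t <= b - a by rewrite ler_piMr// ltW.
  by apply/andP; split; lra.
Qed.

Lemma arcs_of_structure (R : realType) (S : set R) (I : seq (R * R)) (F : seq R) :
  {in I, forall ab, ab.1 < ab.2} ->
  S = (\bigcup_(ab in [set` I]) [set` `[ab.1, ab.2]]) `|` [set` F] ->
  {in F, forall x, exists a b, a < x < b /\ forall t, a < t < b -> S t -> t = x} ->
  finite_union_arcs_isolated (realset S).
Proof.
move=> hI SE hF; exists (size I), (fun i => realset [set` `[(tnth (in_tuple I) i).1, (tnth (in_tuple I) i).2]]).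
exists [seq (x, 0) | x <- F]; split.
- by move=> i; apply/segment_arc/hI; exact: mem_tnth.
- move=> p /= /mapP[x xF ->]; have [a [b [/andP[ax xb] H]]] := hF x xF.
  split; first by rewrite inE; split=> //=; rewrite SE; right.
  exists (`]a, b[ `*` setT).
    exists (`]a, b[%classic, setT) => //; split; last exact: filterT.
    by apply: open_nbhs_nbhs; split; [exact: interval_open|rewrite /= in_itv /= ax].
  apply/seteqP; split=> [[t y] [[/= tab _] [/= St ->]]|_ ->].
    by congr (_, _); apply: H => //; move: tab; rewrite in_itv.
  split; split=> //=; first by rewrite in_itv /= ax.
  by rewrite SE; right.
- apply/seteqP; split=> [[x y] [/= Sx ->]|[x y]].
    move: Sx; rewrite SE => -[[ab /= abI xab]|xF]; last by right; rewrite /=; exact: map_f.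
    left; have /tnthP[i iE] : ab \in in_tuple I by [].
    by exists i => //; split=> //=; rewrite -iE.
  move=> [[i _ [/= xi ->]]|/= /mapP[t tF [-> ->]]]; split=> //=; rewrite SE; last by right.
  by left; exists (tnth (in_tuple I) i) => //=; exact: mem_tnth.
Qed.

(** * The measure of a function satisfying [condition_star], and its support *)

Definition star_domain (R : realType) (E : set R) (z : R[i]) : Prop :=
  ~ realset E (complex.Re z, complex.Im z).

Lemma slit_domain_off (R : realType) (E : set R) (f : R[i] -> R[i]) (L : R) :
  compact E -> (forall x, E x -> - L <= x <= L) -> holomorphic_on (~` realset E) f ->
  slit_domain (star_domain E) f.
Proof.
move=> cE EL hf; split.
- move=> [x y] /= nz; have := hf (x, y) nz => /derivable_cderiv; exact: cderiv_ccont.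
- move=> [x y] /= nz; have cR : closed (realset E).
    apply: compact_closed; first exact: (@norm_hausdorff _ (R * R)%type).
    by apply: compact_setX => //; exact: compact_set1.
  have oR : open (~` realset E) by rewrite openC.
  have /nbhs_ballP[d /= d0 dH] := open_nbhs_nbhs (conj oR nz).
  exists d => // -[u v] wd; apply: dH; split; rewrite /ball /= distrC.
    by apply: le_lt_trans wd; have := Re_le_cabs ((u +i* v) - (x +i* y)); rewrite ReB.
  by apply: le_lt_trans wd; have := Im_le_cabs ((u +i* v) - (x +i* y)); rewrite ImB.
- by move=> [x y] /= /eqP y0 [_ /=].
- exists L => -[x y] zL [/= /EL xL y0]; move: zL; rewrite y0 -/(x%:C) cabs_real => h.
  by move: xL; rewrite -ler_norml leNgt h.
Qed.

Lemma poly_roots_seq (R : realType) (c : {poly R[i]}) : c != 0 ->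
  exists X : seq (R * R), forall x y, (x, y) \notin X -> c.[x +i* y] != 0.
Proof.
move=> c0; have [r rE] := closed_field_poly_normal c.
exists [seq (complex.Re z, complex.Im z) | z <- r] => x y; apply: contraNneq => cz.
apply/mapP; exists (x +i* y) => //.
have : root c (x +i* y) by apply/rootP.
rewrite rE rootZ ?lead_coef_eq0// root_prod_XsubC.
by [].
Qed.

Lemma star_near_infty (R : realType) (E : set R) (f : R[i] -> R[i]) (a0 : R) :
  condition_star E f a0 ->
  exists A r : R, [/\ 0 <= A, 0 < r & forall z, r < cabs z -> cabs (f z) <= A / cabs z].
Proof.
move=> [_ _ [M [r H]] a00]; exists (a0 + `|M|), (Num.max 1 r).
split; [by rewrite addr_ge0// ltW|by rewrite lt_max ltr01|].
move=> z; rewrite gt_max => /andP[z1 zr]; have z0 := lt_trans ltr01 z1.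
have -> : f z = (f z - a0%:C / z) + a0%:C / z by rewrite subrK.
apply: (le_trans (cabsD _ _)); rewrite addrC mulrDl; apply: lerD.
  by rewrite cabsM cabsV cabs_real gtr0_norm.
apply: (le_trans (H z zr)); apply: (@le_trans _ _ (`|M| / cabs z ^+ 2)).
  by rewrite ler_wpM2r ?ler_norm// invr_ge0 sqr_ge0.
by rewrite ler_wpM2l// lef_pV2 ?posrE ?exprn_gt0// expr2; apply: ler_peMr; exact: ltW.
Qed.

(** The bound is [L0 + 1] because the points [L0] and [- L0] may belong to E, and v has to be
    continuous for |x| equal to the bound. *)
Lemma star_nevanlinna (R : realType) (E : set R) (f : R[i] -> R[i]) (a0 L0 : R)
    (P u v : {poly {poly R[i]}}) (c : {poly R[i]}) (X : seq (R * R)) :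
  0 < L0 -> (forall x, E x -> - L0 <= x <= L0) ->
  slit_domain (star_domain E) f -> holomorphic_on (~` realset E) f -> condition_star E f a0 ->
  annihilates (star_domain E) f P -> u * P + v * P^`() = c%:P ->
  (forall x y, (x, y) \notin X -> c.[x +i* y] != 0) ->
  nevanlinna (fun x y => - complex.Im (f (x +i* y))) (L0 + 1) X.
Proof.
move=> L00 EL sD hf star Pf uv XH; have [fJ If _ a00] := star.
have [cf oD iD _] := sD.
have far (p : R * R) : L0 + 1 <= `|p.1| -> star_domain E (cplx p).
  by move=> h [/= /EL]; rewrite -ler_norml leNgt; move=> /negP n _; apply: n; lra.
split.
- by lra.
- move=> p pD; have Dp : star_domain E (cplx p).
    by case: pD => [p2|/far//]; apply: iD; rewrite /= gt_eqF.
  by apply: cvgN; apply: ccont_Im_continuous; exact: cf.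
- by move=> x y y0; rewrite oppr_gt0; exact: If.
- move=> x Lx; have := fJ (x, 0) (far (x, 0) Lx).
  rewrite (_ : conjc (cplx (x, 0)) = x +i* 0); last by rewrite /cplx /= oppr0.
  move=> /(congr1 (@complex.Im R)); rewrite cIm_conj /cplx /= => h.
  by rewrite -h; lra.
- move=> e e0; have [A [r [A0 r0 AH]]] := star_near_infty star.
  exists (r + A / e + 1) => x y y0 xy.
  have Ae : 0 <= A / e by rewrite divr_ge0// ltW.
  have big : r + A / e + 1 <= cabs (x +i* y).
    case: xy => h; first exact: le_trans h (Re_le_cabs (x +i* y)).
    by apply: (le_trans h); apply: le_trans (Im_le_cabs (x +i* y)); exact: ler_norm.
  have zr : r < cabs (x +i* y) by apply: lt_le_trans big; lra.
  have z0 := lt_trans r0 zr.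
  rewrite normrN; apply: (le_trans (Im_le_cabs _)); apply: (le_trans (AH _ zr)).
  rewrite ler_pdivrMr// mulrC -ler_pdivrMr//; apply: le_trans big.
  by lra.
- move=> x y y0 /XH cz; have Dz : star_domain E (x +i* y) by apply: iD; rewrite /= gt_eqF.
  have dfD z : star_domain E z -> exists l, cderiv f z l.
    by case: z => s t Dst; have := hf (s, t) Dst => /derivable_cderiv; eexists; eassumption.
  have [f1 [r [l2 [r0 df df1]]]] := algebraic_twice_cderiv sD Pf uv dfD Dz cz.
  have h := harmonicZ (-1) (harmonic_Im r0 df df1).
  by move: h; congr harmonic_at; apply/funext => s; apply/funext => t; rewrite mulN1r.
Qed.

Lemma star_measure (R : realType) (E : set R) (f : R[i] -> R[i]) (a0 L0 : R) :
  0 < L0 -> (forall x, E x -> - L0 <= x <= L0) -> closed E ->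
  slit_domain (star_domain E) f -> holomorphic_on (~` realset E) f -> condition_star E f a0 ->
  algebraic_on (~` realset E) f ->
  exists mu : {finite_measure set (R * R)%type -> \bar R},
    [/\ carried mu (`[- (L0 + 2), L0 + 2] `*` [set 0]), mu setT = a0%:E &
        forall z, complex.Im z != 0 -> cauchy_transform mu z = f z].
Proof.
move=> L00 EL cE sD hf star [P P0 PE]; have [fJ If asy a00] := star.
have Pann : annihilates (star_domain E) f P by move=> [x y] h; exact: (PE (x, y)).
have [Q mQ] := min_annihilator_exists P0 Pann; have [Q0 Qf _ _] := mQ.
have [u [v [c [c0 uv]]]] := min_annihilator_separable sD mQ.
have [X XH] := poly_roots_seq c0.
have nv := star_nevanlinna L00 EL sD hf star Qf uv XH.
have [mu mu0 muH] := herglotz_measure nv.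
(* [L0 + 2] adds the margin 1 of [stieltjes_line] to the bound [L0 + 1] of [star_nevanlinna]. *)
exists mu; pose S := `[- (L0 + 2), L0 + 2] `*` [set 0 : R] : set (R * R).
have cS : carried mu S.
  split; first by apply: measurableX.
  apply: subset_measure0 mu0; try by apply: measurableC; apply: measurableX.
  apply: subsetC => p [/=]; rewrite !in_itv /= => /andP[? ?] ?; split=> //=.
  by rewrite in_itv /=; apply/andP; split; lra.
have Sr : S `<=` @real_line R by move=> p [].
have L2 : 0 < L0 + 2 by lra.
have SL p : S p -> cabs (cplx p) <= L0 + 2.
  by case: p => x y [/=]; rewrite in_itv /= -ler_norml => xL ->; rewrite -/(x%:C) cabs_real.
have asy2 := cauchy_infty cS L2 SL.
have [A [r [A0 r0 AH]]] := star_near_infty star.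
have upper z : 0 < complex.Im z -> f z = cauchy_transform mu z.
  have := @upper_determined R f (cauchy_transform mu)
    (A + (fine (mu setT) + 2 * fine (mu setT))) (Num.max r (2 * (L0 + 2))); apply.
  - move=> [x y] /= y0; have Dz : star_domain E (x +i* y) by case: sD => _ _ iD _; apply: iD; rewrite /= gt_eqF.
    by have := hf (x, y) Dz => /derivable_cderiv; eexists; eassumption.
  - move=> [x y] /= y0; apply: (cauchy_cderiv cS y0) => p /Sr[_ p2].
    by apply: le_trans (Im_le_cabs _); rewrite ImB /=; rewrite /= in p2; rewrite p2 subr0 gtr0_norm.
  - move=> [x y] /= y0; have := neg_Im_cauchy x cS Sr y0; rewrite -muH// => /oppr_inj h.
    by rewrite -h.
  - move=> w; rewrite gt_max => /andP[wr wL]; have w0 := lt_trans r0 wr.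
    rewrite mulrDl; apply: (le_trans (cabsD _ _)); rewrite cabsN; apply: lerD; first exact: AH.
    have -> : cauchy_transform mu w = (fine (mu setT))%:C / w + (cauchy_transform mu w - (fine (mu setT))%:C / w).
      by rewrite addrC subrK.
    have m0 : 0 <= fine (mu setT) by rewrite fine_ge0.
    rewrite mulrDl; apply: (le_trans (cabsD _ _)); apply: lerD.
      by rewrite cabsM cabsV cabs_real ger0_norm.
    apply: (le_trans (asy2 w wL)); rewrite ler_pdivrMr ?exprn_gt0// expr2 mulrA divfK ?gt_eqF//.
    by rewrite -[leRHS]mulrA [fine _ * _]mulrC [leRHS]mulrA ler_wpM2r//; lra.
(* Both sides are symmetric under conjugation, which carries the equality to the lower half
   plane. *)
have all_nonreal z : complex.Im z != 0 -> cauchy_transform mu z = f z.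
  rewrite neq_lt => /orP[zn|zp]; last by rewrite upper.
  have zp : 0 < complex.Im (conjc z) by rewrite cIm_conj oppr_gt0.
  have k0 : cbounded S (fun p => (conjc z - cplx p)^-1).
    by move: zp; case: (conjc z) => x y /= y0; exact: kernel_upper.
  have E1 := cauchy_conj cS Sr k0; rewrite conjcK in E1.
  rewrite E1 -upper//; have Dz : star_domain E z by case: sD => _ _ iD _; apply: iD; rewrite lt_eqF.
  have := fJ _ Dz; rewrite (_ : cplx _ = z); last by case: (z).
  by move=> ->; rewrite conjcK.
split=> //.
have mufin : mu setT \is a fin_num by exact: fin_num_measure.
rewrite -(fineK mufin); congr (_%:E).
have [M [s Hs]] := asy.
apply: (@mass_determined _ _ _ _ M (2 * (L0 + 2)) s f) => z z0 zr; last exact: Hs.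
by rewrite -all_nonreal//; exact: asy2.
Qed.

Lemma off_support_bounded (R : realType) (mu : {finite_measure set (R * R)%type -> \bar R}) (p : R * R) :
  ~ msupport mu p -> cbounded (msupport mu) (fun q => (cplx p - cplx q)^-1).
Proof.
move=> np; have oS : open (~` msupport mu) by rewrite openC; exact: msupport_closed.
have [d /= d0 dU] : exists2 d : R, 0 < d & ball p d `<=` ~` msupport mu.
  by have /nbhs_ballP := open_nbhs_nbhs (conj oS np).
apply: (cbounded_kernel d0) => q sq.
rewrite leNgt; apply/negP => h; apply: (dU q _ sq); split; rewrite /ball /=.
  by apply: (le_lt_trans _ h); have := Re_le_cabs (cplx p - cplx q); rewrite ReB.
by apply: (le_lt_trans _ h); have := Im_le_cabs (cplx p - cplx q); rewrite ImB.
Qed.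

Lemma off_support_real (R : realType) (mu : {finite_measure set (R * R)%type -> \bar R}) (t : R) :
  msupport mu `<=` @real_line R -> ~ msupport mu (t, 0) ->
  complex.Im (cauchy_transform mu t%:C) = 0.
Proof.
move=> Sr nt; have := cauchy_conj (msupport_carried mu) Sr (off_support_bounded nt).
rewrite conjc_real => /(congr1 (@complex.Im R)); rewrite cIm_conj => h; lra.
Qed.

Definition vanishes_from_above (R : realType) (f : R[i] -> R[i]) (t : R) :=
  forall e : R, 0 < e -> exists2 d : R, 0 < d &
    forall z, 0 < complex.Im z -> cabs (z - t%:C) < d -> `|complex.Im (f z)| < e.

Lemma not_support_of_vanish (R : realType) (mu : {finite_measure set (R * R)%type -> \bar R}) (x d : R) :
  carried mu (@real_line R) -> 0 < d ->
  (forall t, `|t - x| < d -> vanishes_from_above (cauchy_transform mu) t) ->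
  ~ msupport mu (x, 0).
Proof.
move=> cR d0 H sx; have mu0 : mu (`[x - d / 4, x + d / 4] `*` setT) = 0%E.
  apply: (@local_vanish _ mu (x - d / 2) (x + d / 2)) => //; try lra.
  by move=> t /andP[t1 t2]; apply: H; rewrite ltr_norml; apply/andP; split; lra.
have := sx (`]x - d / 4, x + d / 4[ `*` setT).
rewrite (_ : mu _ = 0%E) ?ltxx => [H0|].
  suff : false by []; apply: H0; last by split=> //=; rewrite in_itv /=; apply/andP; split; lra.
  rewrite openE => p [/= p1 _]; exists (`]x - d / 4, x + d / 4[%classic, setT) => //.
  by split; [apply: open_nbhs_nbhs; split=> //; exact: interval_open|exact: filterT].
apply: subset_measure0 mu0; try by apply: measurableX.
by move=> p [/= + _]; rewrite in_itv /= => /andP[p1 p2]; split=> //=; rewrite in_itv /= !ltW.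
Qed.

(** Near a real point off E, f is continuous, and it is real on the axis by symmetry; hence Im f
    tends to 0 there and [local_vanish] removes the mass. *)
Lemma support_in_star (R : realType) (E : set R) (f : R[i] -> R[i]) (a0 L : R)
    (mu : {finite_measure set (R * R)%type -> \bar R}) :
  closed E -> slit_domain (star_domain E) f -> condition_star E f a0 ->
  carried mu (`[- L, L] `*` [set 0]) ->
  (forall z, complex.Im z != 0 -> cauchy_transform mu z = f z) ->
  msupport mu `<=` realset E.
Proof.
move=> cE [cf _ _ _] [fJ _ _ _] cS muf.
have cB : closed (`[- L, L] `*` [set 0] : set (R * R)).
  apply: compact_closed; first exact: (@norm_hausdorff _ (R * R)%type).
  by apply: compact_setX; [exact: segment_compact|exact: compact_set1].
have cR : carried mu (@real_line R) by apply: (carried_real cS) => p [].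
move=> [x y] sp; have [/= _ y0] := carried_msupport cS cB sp; split=> //=.
rewrite y0 in sp; apply: contrapT => nx.
have oE : open (~` E) by rewrite openC.
have /nbhs_ballP[d /= d0 dH] := open_nbhs_nbhs (conj oE nx).
apply: (not_support_of_vanish cR d0) sp => t td e e0.
have Dt : star_domain E t%:C.
  by move=> [/= Et _]; apply: (dH t) => //; rewrite /ball /= distrC.
have [d' d'0 d'H] := cf _ Dt e e0; exists d' => // z z0 zd.
rewrite muf ?gt_eqF//.
have ft : complex.Im (f t%:C) = 0.
  have := fJ (t, 0) Dt; rewrite (_ : cplx (t, 0) = t%:C)// conjc_real.
  by move=> /(congr1 (@complex.Im R)); rewrite cIm_conj => h; lra.
have := d'H z zd; apply: le_lt_trans; apply: le_trans (Im_le_cabs _).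
by rewrite ImB ft subr0.
Qed.

(** In the first case of [branch_dichotomy], a real point off the support would be a point of
    continuity with a real value of the transform, against the lower bound [k]; in the second, the
    transform vanishes from above on an interval. *)
Lemma support_alternative (R : realType) (E : set R) (f : R[i] -> R[i]) (a0 : R)
    (P u v : {poly {poly R[i]}}) (c : {poly R[i]})
    (mu : {finite_measure set (R * R)%type -> \bar R}) (x0 : R) :
  slit_domain (star_domain E) f -> min_annihilator (star_domain E) f P -> condition_star E f a0 ->
  u * P + v * P^`() = c%:P -> c.[x0%:C] != 0 -> (lead_coef P).[x0%:C] != 0 ->
  msupport mu `<=` @real_line R ->
  (forall z, complex.Im z != 0 -> cauchy_transform mu z = f z) ->
  exists2 d : R, 0 < d & forall t, `|t - x0| < d -> (msupport mu (t, 0) <-> msupport mu (x0, 0)).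
Proof.
move=> sD mP [fJ _ _ _] uv c0 l0 Sr muf.
have cR := carried_real (msupport_carried mu) Sr.
have fJ' z : star_domain E z -> star_domain E (conjc z) /\ f (conjc z) = conjc (f z).
  move=> Dz; have := fJ _ Dz; rewrite (_ : cplx _ = z); last by case: (z).
  split=> //; move: Dz; case: (z) => x y; rewrite /star_domain /= => nz [/= Ex y0].
  by apply: nz; split=> //=; apply/eqP; rewrite -oppr_eq0 y0.
have [d d0 [[k k0 kH]|vH]] := branch_dichotomy sD mP fJ' uv c0 l0; exists d => //.
  have all_in t : `|t - x0| < d -> msupport mu (t, 0).
    move=> td; apply: contrapT => nt.
    have [l dl] := cauchy_cderiv_off nt; have cc := cderiv_ccont dl.
    have [d' d'0 d'H] := cc k k0.
    pose s := Num.min (d' / 2) ((d - `|t - x0|) / 2).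
    have s0 : 0 < s by rewrite lt_min !divr_gt0// subr_gt0.
    have s1 : s < d' by rewrite gt_min; apply/orP; left; lra.
    have s2 : s < d - `|t - x0|.
      by rewrite gt_min; apply/orP; right; rewrite -subr_gt0 in td; lra.
    have si : cabs (0 +i* s) = s by rewrite cabsE /= expr0n add0r sqrtr_sqr gtr0_norm.
    have h1 := d'H (t +i* s).
    rewrite (_ : t +i* s - cplx (t, 0) = 0 +i* s) in h1; last first.
      by apply/eqP; rewrite eq_complex /= subrr subr0 !eqxx.
    rewrite si in h1; have {}h1 := h1 s1.
    have h2 : k <= `|complex.Im (f (t +i* s))|.
      apply: kH => //; rewrite (_ : t +i* s - x0%:C = (t - x0)%:C + (0 +i* s)); last first.
        by rewrite /real_complex_def; simpc.
      by apply: (le_lt_trans (cabsD _ _)); rewrite cabs_real si; lra.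
    move: h2; rewrite -muf ?gt_eqF// leNgt => /negP; apply.
    apply: le_lt_trans h1; apply: le_trans (Im_le_cabs _).
    by rewrite ImB (off_support_real Sr nt) subr0.
  by move=> t td; split=> _; apply: all_in; rewrite ?subrr ?normr0.
have none t : `|t - x0| < d -> ~ msupport mu (t, 0).
  move=> td; have d1 : 0 < d - `|t - x0| by rewrite subr_gt0.
  apply: (not_support_of_vanish cR d1) => w wt e e0.
  have wx : `|w - x0| < d.
    by rewrite (_ : w - x0 = (w - t) + (t - x0)); [apply: (le_lt_trans (ler_normD _ _)); lra|ring].
  have [d' d'0 d'H] := vH w wx e e0; exists d' => // z z0 zw.
  by rewrite muf ?gt_eqF//; exact: d'H.
by move=> t td; split=> h; [have := none t td h|have := none x0 _ h; rewrite subrr normr0 => /(_ d0)].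
Qed.

(* The integral in [defect] is taken for the product of the default structures
   on [R], whereas [planar_lebesgue] is a measure for the product of the
   structures generated by half-open intervals; hence [mu] is a bare set
   function here. *)
Lemma sintegral_off_null (T : Type) (R : realType) (mu : set T -> \bar R) (N : set T) (h : T -> R) :
  (forall A, A `<=` N -> mu A = 0%E) -> (forall x, ~ N x -> h x = 0) -> sintegral mu h = 0%E.
Proof.
move=> N0 hN; rewrite sintegralET; apply: fsbig1 => x _.
have [->|x0] := eqVneq x 0; first by rewrite mul0e.
rewrite N0 ?mule0// => y /= hy; apply: contrapT => /hN hy0.
by rewrite -hy hy0 eqxx in x0.
Qed.

Lemma simple_sup_off_null (d : measure_display) (T : measurableType d) (R : realType)
    (mu : set T -> \bar R) (N : set T) (g : T -> \bar R) :
  (forall A, A `<=` N -> mu A = 0%E) -> (forall x, 0 <= g x)%E -> (forall x, ~ N x -> g x = 0%E) ->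
  ereal_sup [set sintegral mu h | h in
    [set h : {nnsfun T >-> R} | forall x, ((h x)%:E <= g x)%E]] = 0%E.
Proof.
move=> N0 g0 gN.
have h0 (h : {nnsfun T >-> R}) : (forall x, (h x)%:E <= g x)%E -> sintegral mu h = 0%E.
  move=> hg; apply: (sintegral_off_null N0) => x /gN gx; apply/eqP; rewrite eq_le fun_ge0 andbT.
  by have := hg x; rewrite gx lee_fin.
apply/eqP; rewrite eq_le; apply/andP; split.
  by apply: ge_ereal_sup => _ [h hg <-]; rewrite h0.
by apply: ereal_sup_ubound; exists nnsfun0; [exact: g0|rewrite h0].
Qed.

Lemma integral_off_null (d : measure_display) (T : measurableType d) (R : realType)
    (mu : set T -> \bar R) (D N : set T) (g : T -> \bar R) :
  (forall A, A `<=` N -> mu A = 0%E) -> (forall x, 0 <= g x)%E -> (forall x, ~ N x -> g x = 0%E) ->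
  (\int[mu]_(x in D) g x = 0)%E.
Proof.
move=> N0 g0 gN; rewrite /integral !(simple_sup_off_null N0) ?sube0//.
- by move=> x /gN gx; rewrite funenegE /patch; case: ifP => _; rewrite ?gx ?oppe0 maxxx.
- by move=> x /gN gx; rewrite funeposE /patch; case: ifP => _; rewrite ?gx maxxx.
Qed.

(** The negative part is zero, so its integral falls under [simple_sup_off_null] with the empty set
    as exceptional set; the zero simple function bounds the other supremum from below. *)
Lemma integral_set_function_ge0 (d : measure_display) (T : measurableType d) (R : realType)
    (mu : set T -> \bar R) (D : set T) (g : T -> \bar R) :
  mu set0 = 0%E -> (forall x, 0 <= g x)%E -> (0 <= \int[mu]_(x in D) g x)%E.
Proof.
move=> mu0 g0; have n0 A : A `<=` set0 -> mu A = 0%E by rewrite subset0 => ->.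
have gD x : (0 <= (g \_ D) x)%E by rewrite /patch; case: ifP.
rewrite /integral [X in (_ - X)%E](simple_sup_off_null n0) ?sube0//; last first.
  by move=> x _; rewrite funenegE; apply/max_idPr; rewrite oppe_le0.
apply: ereal_sup_ubound; exists nnsfun0; first by move=> x; rewrite funepos_ge0.
exact: (sintegral_off_null n0).
Qed.

Lemma planar_real_line (R : realType) (A : set (R * R)) :
  A `<=` @real_line R -> planar_lebesgue A = 0%E.
Proof.
move=> Ar; rewrite /planar_lebesgue /product_measure1 integral0_eq// => x _ /=.
suff : xsection A x `<=` [set 0].
  move=> h; have [h0|/set0P[t ht]] := eqVneq (xsection A x) set0; first by rewrite h0 measure0.
  rewrite (_ : xsection A x = [set 0]); first exact: lebesgue_measure_set1.
  apply/seteqP; split=> // s ->; have := h _ ht => /= <-; exact: ht.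
by move=> t /xsectionP /Ar[].
Qed.

Lemma eq_by_density (R : realType) (f g : R[i] -> R[i]) (z : R[i]) :
  ccont f z -> ccont g z -> (forall w, complex.Im w != 0 -> f w = g w) -> f z = g z.
Proof.
move=> cf cg fg; apply/eqP; rewrite -subr_eq0 -cabs_eq0; apply/negPn/negP => ne.
have e0 : 0 < cabs (f z - g z) / 2 by rewrite divr_gt0// lt_def ne cabs_ge0.
have [d d0 dH] := cf _ e0; have [d' d0' dH'] := cg _ e0.
have m0 : 0 < Num.min d d' by rewrite lt_min d0.
have [w [w0 + _]] := @nonreal_nonroot_near R 1 z _ (oner_neq0 _) m0.
rewrite lt_min => /andP[/dH h1 /dH' h2]; rewrite -fg// cabsB in h2; rewrite cabsB in h1.
have := cabs_distD (f w) (f z) (g z); rewrite [cabs (f w - g z)]cabsB; lra.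
Qed.

Lemma defect_eq0 (R : realType) (P : {poly {poly R[i]}}) (K : set (R * R))
    (mu : {finite_measure set (R * R)%type -> \bar R}) :
  (1 <= degw P)%N ->
  (forall p, ~ @real_line R p -> evalP P (cplx p) (cauchy_transform mu (cplx p)) = 0) ->
  defect P K mu = 0%E.
Proof.
move=> dP PE; rewrite /defect /planar_lebesgue.
apply: (@integral_off_null _ _ _ _ _ (@real_line R)).
- exact: planar_real_line.
- by move=> p; rewrite lee_fin powR_ge0.
(* Here the degree in w must be positive: 0 to the power 0 is 1. *)
- move=> p /PE ->; rewrite cabs0 powR0//; rewrite invr_eq0 pnatr_eq0; lia.
Qed.

Lemma star_delta (R : realType) (P : {poly {poly R[i]}}) (f : R[i] -> R[i]) (K : set (R * R))
    (mu : {finite_measure set (R * R)%type -> \bar R}) :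
  germ_measures f K mu -> defect P K mu = 0%E -> is_delta P f K 0%E.
Proof.
move=> gmu dmu; split; first by exists mu.
move=> nu _; apply: integral_set_function_ge0 => [|p]; first exact: planar_real_line.
by rewrite lee_fin powR_ge0.
Qed.

Lemma support_structure (R : realType) (E : set R) (f : R[i] -> R[i]) (a0 L : R)
    (P : {poly {poly R[i]}}) (mu : {finite_measure set (R * R)%type -> \bar R}) :
  (forall x, E x -> - L <= x <= L) ->
  slit_domain (star_domain E) f -> min_annihilator (star_domain E) f P -> condition_star E f a0 ->
  msupport mu `<=` realset E ->
  (forall z, complex.Im z != 0 -> cauchy_transform mu z = f z) ->
  exists S : set R, [/\ finite_union_itv_pts S, msupport mu = realset S &
    finite_union_arcs_isolated (msupport mu)].
Proof.
move=> EL sD mP star sE muf; pose S := [set t | msupport mu (t, 0)].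
have sS : msupport mu = realset S.
  apply/seteqP; split=> [[t s] h|[t s] [h /= ->]//].
  by have [_ /= s0] := sE _ h; split=> //=; rewrite /S /= -s0.
have cS : closed S.
  apply: (@preimage_closed _ _ (fun t : R => (t, 0) : R * R) (msupport mu)); last exact: msupport_closed.
  by move=> t _; exact: (@cvg_pair R R R (nbhs t) (nbhs t) (nbhs (0 : R)) _ _ _ id (cst 0) cvg_id (@cvg_cst _ _ _ _ _)).
have [u [v [c [c0 uv]]]] := min_annihilator_separable sD mP.
have l0 : lead_coef P != 0 by case: mP; rewrite lead_coef_eq0.
have [X XH] := poly_roots_seq c0; have [Y YH] := poly_roots_seq l0.
(* Real parts of all complex roots of [c] and of the leading coefficient: a finite set containing
   every real root. *)
pose Z : seq R := [seq p.1 | p <- X ++ Y].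
have SL x : S x -> - L <= x <= L by move=> /sE[/EL].
have sr : msupport mu `<=` @real_line R by move=> p /sE[].
have lc x : x \notin Z -> exists2 d : R, 0 < d & forall t, `|t - x| < d -> (S t <-> S x).
  rewrite /Z map_cat mem_cat negb_or => /andP[xX xY].
  apply: (support_alternative sD mP star uv _ _ sr muf).
    by apply: XH; apply: contra xX => h; apply/mapP; exists (x, 0).
  by apply: YH; apply: contra xY => h; apply/mapP; exists (x, 0).
have [I [F [hI SE hF]]] := real_set_structure cS SL lc.
exists S; split=> //; last by rewrite sS; exact: arcs_of_structure SE hF.
by exists I, F; split=> // ab /hI /ltW.
Qed.

Lemma cplx_surj (R : realType) (z : R[i]) : cplx (complex.Re z, complex.Im z) = z.
Proof. by case: z. Qed.

Lemma off_real (R : realType) (E : set R) (z : R[i]) : complex.Im z != 0 ->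
  ~ realset E (complex.Re z, complex.Im z).
Proof. by move=> z0 [_ /= zE]; rewrite zE eqxx in z0. Qed.

Lemma measurable_poisson (R : realType) (x y : R) :
  measurable_fun setT (fun p : R * R => poisson x y p.1).
Proof.
apply: measurable_funM => //; apply: (measurableT_comp (@measurable_invr R)).
by apply: measurable_funD => //; apply: measurable_funX; apply: measurable_funB.
Qed.

Lemma star_of_measure (R : realType) (E : set R) (L : R)
    (mu : {finite_measure set (R * R)%type -> \bar R}) :
  0 < L -> (forall x, E x -> - L <= x <= L) -> msupport mu `<=` realset E -> mu setT != 0%E ->
  condition_star E (cauchy_transform mu) (fine (mu setT)).
Proof.
move=> L0 EL sE mu0; have sr : msupport mu `<=` @real_line R by move=> p /sE[].
have cS := msupport_carried mu.
have m0 : 0 < fine (mu setT).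
  by rewrite fine_gt0// lt_neqAle eq_sym mu0 measure_ge0 /= -ge0_fin_numE// fin_num_measure.
split=> //.
- move=> p np; apply: (cauchy_conj cS sr); apply: off_support_bounded => /sE; exact: np.
- move=> [x y] /= y0; rewrite -oppr_gt0 (neg_Im_cauchy x cS sr y0).
  (* A lower bound of the kernel on the support, where |x - t| <= |x| + L; times the positive mass
     it makes - Im strictly positive. *)
  pose k := y / ((`|x| + L) ^+ 2 + y ^+ 2).
  have k0 : 0 < k by rewrite divr_gt0// ltr_wpDl ?exprn_gt0// sqr_ge0.
  have lo p : msupport mu p -> k <= poisson x y p.1.
    move=> /sE[/EL pL _]; have sq : (x - p.1) ^+ 2 <= (`|x| + L) ^+ 2.
      have xL : `|x - p.1| <= `|x| + L.
        by apply: (le_trans (ler_normB _ _)); rewrite lerD2l ler_norml.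
      rewrite -(real_normK (num_real (x - p.1))); have := normr_ge0 (x - p.1); nra.
    rewrite /k /poisson ler_pM2l// lef_pV2 ?posrE ?poisson_den ?lerD2r//.
    by rewrite ltr_wpDl ?exprn_gt0// sqr_ge0.
  apply: (@lt_le_trans _ _ (k * fine (mu setT))); first exact: mulr_gt0.
  have -> : k * fine (mu setT) = \int[mu]_p cst k p.
    by rewrite Rintegral_cst.
  apply: (@le_carried _ mu _ _ _ (Num.max k y^-1) cS) => //.
  + exact: measurable_poisson.
  + by move=> p _; rewrite /= gtr0_norm// le_max lexx.
  + by move=> p _; rewrite ger0_norm ?poisson_ge0// le_max poisson_le_inv// orbT.
- exists (4 * L * fine (mu setT)), (2 * L) => z zL.
  apply: (cauchy_infty cS L0 _ zL) => -[t s] /sE[/EL /= tL ->].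
  by rewrite (_ : cplx _ = t%:C)// cabs_real ler_norml.
Qed.

Theorem theorem8p1 (R : realType) (E : set R) (hE : finite_union_itv_pts E) :
  (forall (f : R[i] -> R[i]) (a0 : R),
     holomorphic_on (~` realset E) f ->
     algebraic_on (~` realset E) f ->
     condition_star E f a0 ->
     exists mu : {finite_measure set (R * R)%type -> \bar R},
       [/\ [/\ msupport mu `<=` realset E,
               mu setT = a0%:E &
               forall p, ~ realset E p ->
                 f (cplx p) = cauchy_transform mu (cplx p)],
           (forall nu : {finite_measure set (R * R)%type -> \bar R},
              compact (msupport nu) ->
              nu setT = a0%:E ->
              (forall p, ~ realset E p ->
                 f (cplx p) = cauchy_transform nu (cplx p)) ->
              forall A, measurable A -> nu A = mu A),
           (exists2 S : set R, finite_union_itv_pts S &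
              msupport mu = realset S),
           mother_body f mu &
           forall P : {poly {poly R[i]}}, defining_poly P f ->
             forall K : set (R * R), compact K -> convex_set K ->
               realset E `<=` K -> is_delta P f K 0%E])
  /\
  (forall mu : {finite_measure set (R * R)%type -> \bar R},
     msupport mu `<=` realset E ->
     mu setT != 0%E ->
     algebraic_on (~` realset E) (cauchy_transform mu) ->
     exists a0 : R, condition_star E (cauchy_transform mu) a0).
Proof.
have [cE [L L0 EL]] := finite_union_compact hE; split; last first.
  by move=> mu sE mu0 _; exists (fine (mu setT)); exact: (star_of_measure L0 EL).
move=> f a0 hf af star; have clE : closed E := compact_closed (@Rhausdorff R) cE.
have sD := slit_domain_off cE EL hf.
have [cf oD iD [Li LiH]] := sD.
have [mu [cmu muT muf]] := star_measure L0 EL clE sD hf star af.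
have sE := support_in_star clE sD star cmu muf.
(* The equality is known at nonreal points; continuity of both sides extends it to the real points
   off E. *)
have muf' z : star_domain E z -> cauchy_transform mu z = f z.
  move=> Dz; apply: eq_by_density muf; last exact: cf.
  have [|l] := @cauchy_cderiv_off _ mu (complex.Re z, complex.Im z); first by move/sE.
  by rewrite cplx_surj; exact: cderiv_ccont.
have starp p : ~ realset E p -> star_domain E (cplx p) by case: p.
have mufE p : ~ realset E p -> f (cplx p) = cauchy_transform mu (cplx p).
  by move=> /starp /muf'.
have muf_infty : near_infty (fun z => cauchy_transform mu z = f z).
  by exists Li => z /LiH; exact: muf'.
have [Q Qf Qan] : exists2 Q, Q != 0 & annihilates (star_domain E) f Q.
  by have [Q Q0 QE] := af; exists Q => // z Dz; rewrite -(cplx_surj z); exact: QE.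
have [P mP] := min_annihilator_exists Qf Qan.
have [S [fS sS arcs]] := support_structure EL sD mP star sE muf.
exists mu; split.
- by split.
- move=> nu _ nuT nuf; apply: (cauchy_unique cmu); first by rewrite nuT muT.
  move=> z z0; have nE : ~ realset E (complex.Re z, complex.Im z) by exact: off_real.
  by have := nuf _ nE; rewrite cplx_surj => <-; rewrite muf.
- by exists S.
- split=> //.
    have cR : compact (realset E) by apply: compact_setX => //; exact: compact_set1.
    exact: subclosed_compact (@msupport_closed _ mu) cR sE.
  exists P; first exact: min_annihilator_defining sD mP.
  move=> p np; split=> [q Cq|q Cq]; have nq : ~ msupport mu q by exact: (connected_component_sub Cq).
    by have [l] := cauchy_cderiv_off nq; exact: cderivable.
  (* The complement of the support may contain points of E. There the relation holds for the
     transform, rather than for f, by continuity from nonreal points. *)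
  have an : annihilates (fun z => ~ msupport mu (complex.Re z, complex.Im z)) (cauchy_transform mu) P.
    apply: (@annihilates_closure _ _ _ _ 1 _ (oner_neq0 _)).
      by move=> z /cauchy_cderiv_off[l]; rewrite cplx_surj; exact: cderiv_ccont.
    by move=> z z0 _; rewrite muf//; case: mP => _ Pan _ _; apply: Pan; exact: off_real.
  by apply: an; case: q nq {Cq}.
(* [P0] is known to vanish on f only near infinity; [defining_annihilates] extends this to all
   points off E before the defect is computed. *)
- move=> P0 dP0 K _ _ EK.
  have dP1 : (1 <= degw P0)%N by case: dP0.
  apply: (@star_delta _ _ _ _ mu); first by split=> //; exact: subset_trans EK.
  apply: defect_eq0 => // p np; rewrite muf; last first.
    by apply/eqP => p2; apply: np; split.
  apply: (defining_annihilates sD mP dP0).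
  by apply: starp => -[_ h]; apply: np.
Qed.
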